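(* Suppose that all spatially critical points of $m$ are nondegenerate. Assume that $\{(\kappa_i(t),t): t\in[0,T],\ 1\le i\le N\}$, with $\kappa_i\in C^1([0,T])$, is the set of spatially local maximum points of $m$. Let $\lambda(\alpha)$ be the principal eigenvalue of $$\begin{cases}\partial_t\varphi-\partial_{xx}\varphi-\alpha\,\partial_x m\,\partial_x\varphi+V\varphi=\lambda\varphi & \text{in }(0,1)\times[0,T],\\ \partial_x\varphi(0,t)=\partial_x\varphi(1,t)=0 & \text{on }[0,T],\\ \varphi(x,0)=\varphi(x,T) & \text{on }(0,1).\end{cases}$$ Then $$\lim_{\alpha\to\infty}\lambda(\alpha)=\min_{1\le i\le N}\left\{\frac1T\int_0^T V(\kappa_i(s),s)\,\mathrm{d}s\right\}.$$
   Context: Standing assumptions: $T>0$; $\alpha>0$; $m\in C^{2,0}([0,1]\times\mathbb{R})$ (that is, $m,\partial_x m,\partial_{xx}m$ are continuous on $[0,1]\times\mathbb{R}$) and $V\in C([0,1]\times\mathbb{R})$ are both $T$-periodic in $t$. The principal eigenvalue $\lambda(\alpha)$ is the eigenvalue that is real and simple and whose eigenfunction can be chosen positive; it exists and satisfies $\lambda(\alpha)<\mathrm{Re}(\lambda)$ for every other eigenvalue $\lambda$. Terminology for $m$: - A spatially interior critical point of $m$ is a point $(x_*,t_* )\in(0,1)\times[0,T]$ with $\partial_x m(x_*,t_* )=0$; it is nondegenerate if $\partial_{xx}m(x_*,t_* )\ne 0$. - Every boundary point $(x_*,t_* )\in\{0,1\}\times[0,T]$ is called spatially critical; it is nondegenerate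 if $\partial_x m(x_*,t_* )\neq 0$ or $\partial_{xx}m(x_*,t_* )\ne0$. - A point of spatially local maximum of $m$ is a point $(x_*,t_* )\in[0,1]\times[0,T]$ such that $m(x_*,t_* )\ge m(x,t_* )$ for all $x$ in a small neighborhood of $x_*$ relative to $[0,1]$. *)

(* Defs.v *)
From HB Require Import structures.
From mathcomp Require Import all_boot all_order all_algebra.
From mathcomp Require Import all_classical all_reals all_analysis.

Set Implicit Arguments.
Unset Strict Implicit.
Unset Printing Implicit Defensive.

Import Order.TTheory GRing.Theory Num.Theory.
Import numFieldNormedType.Exports.
Local Open Scope classical_set_scope.
Local Open Scope ring_scope.

(* Points of the (x, t)-plane are pairs z = (x, t). *)

(* Derivative relative to D: the two-sided derivative at interior points of an
   interval D, the one-sided one at its end points. *)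
Definition derivable_in (R : realType) (D : set R) (f : R -> R) (x : R) : Prop :=
  cvg (h^-1 * (f (h + x) - f x) @[h --> within [set h | D (h + x)] 0^']).

Definition derive_in (R : realType) (D : set R) (f : R -> R) (x : R) : R :=
  lim (h^-1 * (f (h + x) - f x) @[h --> within [set h | D (h + x)] 0^']).

Definition C1_in (R : realType) (D : set R) (f : R -> R) : Prop :=
  (forall x, D x -> derivable_in D f x) /\ {within D, continuous (derive_in D f)}.

Definition dx (R : realType) (f : R * R -> R) (z : R * R) : R :=
  derive_in `[0, 1] (fun x => f (x, z.2)) z.1.

Definition x_derivable (R : realType) (J : set R) (f : R * R -> R) : Prop :=
  forall x t, `[0, 1]%classic x -> J t ->
    derivable_in `[0, 1] (fun y => f (y, t)) x.

(* C^{1,0}([0,1] x J) and C^{2,0}([0,1] x J) *)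
Definition C10 (R : realType) (J : set R) (f : R * R -> R) : Prop :=
  [/\ {within `[0, 1] `*` J, continuous f},
      x_derivable J f &
      {within `[0, 1] `*` J, continuous (dx f)}].

Definition C20 (R : realType) (J : set R) (f : R * R -> R) : Prop :=
  C10 J f /\ C10 J (dx f).

Definition t_periodic (R : realType) (T : R) (f : R * R -> R) : Prop :=
  forall x t, `[0, 1]%classic x -> f (x, t + T) = f (x, t).

Notation leb2 R := (@lebesgue_measure R \x @lebesgue_measure R)%E (only parsing).

Definition Qopen (R : realType) (T : R) : set (R * R) := `]0, 1[ `*` `]0, T[.

Definition Qclosed (R : realType) (T : R) : set (R * R) := `[0, 1] `*` `[0, T].

Definition C1_compact_support (R : realType) (Q : set (R * R))
    (psi : R * R -> R) : Prop :=
  [/\ forall z v, v = (1, 0) \/ v = (0, 1) -> derivable psi z v,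
      forall v, v = (1, 0) \/ v = (0, 1) -> continuous (fun z => 'D_v psi z),
      compact (closure [set z | psi z != 0]) &
      closure [set z | psi z != 0] `<=` Q].

(* g is the weak derivative of u in the direction v on Q; used with v = (1, 0)
   and v = (0, 1) *)
Definition weak_derivative (R : realType) (Q : set (R * R)) (v : R * R)
    (u g : R * R -> R) : Prop :=
  forall psi, C1_compact_support Q psi ->
    \int[leb2 R]_(z in Q) (u z * 'D_v psi z) =
    - \int[leb2 R]_(z in Q) (g z * psi z).

Definition in_all_Lp (R : realType) (Q : set (R * R)) (g : R * R -> R) : Prop :=
  measurable_fun (Q : set (measurableTypeR R * measurableTypeR R)) g /\
  forall p : R, 1 <= p ->
    (leb2 R).-integrable Q (fun z => (`|g z| `^ p)%:E).

(* phi is a strong solution of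
     d_t phi - d_xx phi - alpha d_x m d_x phi + V phi = f   in (0,1) x (0,T),
     d_x phi = 0 at x = 0 and x = 1,   phi(., 0) = phi(., T).
   For coefficients that are merely continuous in t, d_t phi and d_xx phi need
   not be continuous. As in the L^p theory, phi is required to lie in
   W^{2,1}_p((0,1) x (0,T)) for all finite p, with the equation holding almost
   everywhere: below, g is d_t phi and h is d_xx phi. Such phi has a continuous
   d_x phi up to the boundary, so that the boundary conditions are pointwise;
   this regularity is part of the definition. *)
Definition strong_solution (R : realType) (T : R) (m V : R * R -> R) (alpha : R)
    (phi f : R * R -> R) : Prop :=
  [/\ C10 `[0, T] phi,
      forall t, `[0, T]%classic t -> dx phi (0, t) = 0 /\ dx phi (1, t) = 0,
      forall x, `[0, 1]%classic x -> phi (x, 0) = phi (x, T) &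
      exists g h : R * R -> R,
        [/\ in_all_Lp (Qopen T) g /\ in_all_Lp (Qopen T) h,
            weak_derivative (Qopen T) (0, 1) phi g,
            weak_derivative (Qopen T) (1, 0) (dx phi) h &
            {ae leb2 R, forall z, Qopen T z ->
              g z - h z - alpha * dx m z * dx phi z + V z * phi z = f z}]].

(* A real eigenvalue with a positive eigenfunction which is simple, i.e., with
   L the operator above, the generalized eigenspace ker (L - lam)^2 is the line
   spanned by phi. (Other eigenvalues mu then satisfy lam < Re mu up to the
   shifts mu = lam + 2 k pi i / T, which are eigenvalues too, with
   eigenfunctions exp(2 k pi i t / T) phi.) *)
Definition principal_eigenvalue (R : realType) (T : R) (m V : R * R -> R)
    (alpha lam : R) : Prop :=
  exists phi : R * R -> R,
    [/\ strong_solution T m V alpha phi (fun z => lam * phi z),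
        forall z, Qclosed T z -> 0 < phi z &
        forall v w : R * R -> R,
          strong_solution T m V alpha v (fun z => lam * v z) ->
          strong_solution T m V alpha w (fun z => lam * w z + v z) ->
          exists c : R, forall z, Qclosed T z -> w z = c * phi z].

Definition all_critical_nondegenerate (R : realType) (T : R) (m : R * R -> R) :
    Prop :=
  forall t, `[0, T]%classic t ->
    (forall x, `]0, 1[%classic x -> dx m (x, t) = 0 -> dx (dx m) (x, t) != 0) /\
    (forall x, x = 0 \/ x = 1 -> dx m (x, t) != 0 \/ dx (dx m) (x, t) != 0).

Definition spatial_local_maxima (R : realType) (T : R) (m : R * R -> R) :
    set (R * R) :=
  [set z | Qclosed T z /\
    \forall y \near z.1, `[0, 1]%classic y -> m (y, z.2) <= m z].

(* Main.v *)
Require Import Defs.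
From HB Require Import structures.
From mathcomp Require Import all_boot all_order all_algebra.
From mathcomp Require Import all_classical all_reals all_analysis.
From mathcomp Require Import measurable_realfun ring lra.
Import Order.TTheory GRing.Theory Num.Theory.
Import numFieldNormedType.Exports.

(** Write [b] for the slope of [m] in [x] and
      L = d_t - d_xx - alpha b d_x + V.
    A large drift [alpha b] concentrates the dynamics on the curves
    [x = kappa_i(t)] of local maxima of [m]. Frozen on such a curve, the problem
    is the ordinary differential equation [f' + V(kappa_i(t), t) f = mu f], which
    has a positive periodic solution exactly when [mu] is the average of [V]
    along the curve. The proof makes this rigorous by comparing the positive
    eigenfunction with explicit functions, for which the equation is a strict
    inequality once alpha is large.

    Comparison ([touching], [touch_bound]). If [u > 0] is an eigenfunction and
    [P - th u] has a local minimum with value 0 at a point with positive time,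
    then [(L - lambda) P <= 0] there; the Neumann condition of [u] allows the
    point to lie at an end point of [0,1] when the slope of [P] has the right
    sign. An eigenfunction in W^{2,1}_p is not regular enough for this pointwise
    argument. It is therefore replaced by its average over a short time interval.
    The weak equation gives the identity [rectangle_identity] on rectangles, from
    which the average has a classical second derivative in [x] and a classical
    time derivative, and satisfies the equation up to an error [eps u], because
    the coefficients are uniformly continuous ([classical_approximation]).

    Upper bound ([upper_bound]). Let [f] be the periodic solution above and
    [P = - f + L0 (x - kappa_i)^4]. Close to the curve [P] is negative, and the
    minimum of [P / u] is attained there. Since [b] pushes towards the curve, the
    quartic term absorbs all errors and contact at this minimum forces
    [lambda < average_i + eps].

    Lower bound ([lower_bound]). The least value over a finite family of
    quotients [P / u] is used: the wells [f + L0 (x - kappa_i)^4] and, in each gap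
    between consecutive curves (or between a curve and an end point), a function
    [A0 (1 + exp (- K (x - y(t))^2))]. The constants are such that close to the
    curves the wells are lowest and far from them they are not, so that contact
    never occurs where a gap function ceases to be defined. Contact with well [i]
    gives [average_i - eps < lambda], and contact with a gap function is
    impossible when [lambda] stays below the averages: near [y] the function is
    strongly concave, and elsewhere the drift, which points away from [y], makes
    [L P] large.

    The curve [y] ([gap_hump]). In a gap [b] increases wherever it is small
    ([gap_slope]: a point with [b = 0] and negative slope would be a maximum).
    Hence the flow [y' = - alpha b(y, t)] contracts there and has a periodic
    orbit, along which [b] stays small, since an orbit through a point with large
    [b] would, backward in time, leave the gap at once ([euler_window]). Here [y]
    is an Euler polygon of this flow, closed up by the intermediate value theorem.
    In the two gaps at the ends, the end point itself serves as [y].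

    The geometric facts about the maxima ([wells], [separation],
    [order_preserved], [kap_periodic]) follow from nondegeneracy by
    compactness. *)

Set Implicit Arguments.
Unset Strict Implicit.
Local Open Scope classical_set_scope.
Local Open Scope ring_scope.

(** * Finite families *)

Lemma exists_below (R : realType) (s : seq R) : all (fun x => 0 < x) s ->
  exists2 k, 0 < k & all (fun x => k < x) s.
Proof.
elim: s => [|x s IH] /=; first by exists 1.
case/andP=> x0 /IH[k k0 ks]; exists (Num.min x k / 2); first by rewrite divr_gt0 // lt_min x0.
have m0 : 0 < Num.min x k by rewrite lt_min x0.
have lt y : Num.min x k <= y -> Num.min x k / 2 < y by move: m0; clear; lra.
apply/andP; split; first by apply: lt; rewrite ge_min lexx.
apply/allP => y ys; apply: lt; apply: ltW; have := allP ks y ys.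
by apply: le_lt_trans; rewrite ge_min lexx orbT.
Qed.

(** Used to choose one radius for finitely many curves. *)
Lemma finite_min (R : realType) (n : nat) (P : 'I_n -> R -> Prop) :
  (forall i r r', 0 < r' -> r' <= r -> P i r -> P i r') ->
  (forall i, exists2 r, 0 < r & P i r) -> exists2 r, 0 < r & forall i, P i r.
Proof.
move=> mono ex.
have [f Hf] : exists f : 'I_n -> R, forall i, 0 < f i /\ P i (f i).
  have ex' i : exists r, 0 < r /\ P i r by have [r ? ?] := ex i; exists r.
  by have [f Hf] := choice ex'; exists f.
pose r := \big[Num.min/1]_(i < n) f i.
have r0 : 0 < r.
  rewrite /r; elim/big_rec: _ => // i x _ x0; rewrite lt_min x0 andbT.
  by case: (Hf i).
exists r => // i; apply: (mono i (f i)) => //; last by case: (Hf i).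
by rewrite /r (bigD1 i) //= ge_min lexx.
Qed.

Lemma finite_eventually (R : realType) (K : finType) (P : K -> R -> Prop) :
  (forall k, exists A, forall al, A <= al -> P k al) ->
  exists A, forall al, A <= al -> forall k, P k al.
Proof.
move=> /choice[A HA]; exists (\sum_k `|A k|) => al hal k; apply: HA.
apply: le_trans (ler_norm _) _; apply: le_trans hal.
by rewrite (bigD1 k) //= lerDl sumr_ge0.
Qed.

Lemma bigmin_le (R : realType) (N : nat) (F : 'I_N.+1 -> R) i :
  \big[Num.min/F ord0]_(j < N.+1) F j <= F i.
Proof. by rewrite (bigD1 i) //= ge_min lexx. Qed.

Lemma bigmin_attained (R : realType) (N : nat) (F : 'I_N.+1 -> R) :
  exists i, \big[Num.min/F ord0]_(j < N.+1) F j = F i.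
Proof.
elim/big_rec: _ => [|i x _ [j ->]]; first by exists ord0.
by case: (leP (F i) (F j)) => _; [exists i|exists j].
Qed.

(** * Derivatives relative to a set *)

(** An explicit remainder estimate instead of a limit of difference quotients:
    it needs no accumulation point of [D], and passes to subsets of [D]. *)
Definition has_der (R : realType) (D : set R) (f : R -> R) (x l : R) : Prop :=
  forall e, 0 < e -> exists2 d, 0 < d & forall y, D y -> `|y - x| < d ->
    `|f y - f x - l * (y - x)| <= e * `|y - x|.

Lemma has_der_derive_in (R : realType) (D : set R) (f : R -> R) (x : R) :
  derivable_in D f x -> has_der D f x (derive_in D f x).
Proof.
move=> df e e0; have := df; rewrite /derivable_in => /cvgrPdist_le /(_ e e0).
rewrite /dnbhs !near_withinE => -[d /= d0 H]; exists d => // y Dy yx.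
have [->|nyx] := eqVneq y x; first by rewrite !subrr mulr0 subr0 normr0 mulr0.
have yx0 : y - x != 0 by rewrite subr_eq0.
have /= := H (y - x); rewrite /ball_ /= sub0r normrN => /(_ yx yx0).
rewrite subrK => /(_ Dy) h.
rewrite /derive_in.
set l := lim _ in h *.
have -> : f y - f x - l * (y - x) = - ((l - (y - x)^-1 * (f y - f x)) * (y - x)).
  by field.
by rewrite normrN normrM ler_wpM2r.
Qed.

Lemma has_der_subset (R : realType) (D E : set R) (f : R -> R) (x l : R) :
  D `<=` E -> has_der E f x l -> has_der D f x l.
Proof.
by move=> DE df e /df[d d0 H]; exists d => // y /DE; exact: H.
Qed.

Lemma has_der_is_derive (R : realType) (D : set R) (f : R -> R) (x l : R) :
  is_derive x 1 f l -> has_der D f x l.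
Proof.
move=> [df <-] e e0.
have := df; rewrite /derivable => /cvgrPdist_le /(_ e e0).
rewrite /dnbhs near_withinE => -[d /= d0 H]; exists d => // y Dy yx.
have [->|nyx] := eqVneq y x; first by rewrite !subrr mulr0 subr0 normr0 mulr0.
have yx0 : y - x != 0 by rewrite subr_eq0.
have /= := H (y - x); rewrite /ball_ /= sub0r normrN => /(_ yx yx0).
rewrite /GRing.scale /= mulr1 subrK => h.
rewrite -/('D_1 f x) in h.
have -> : f y - f x - 'D_1 f x * (y - x) =
    - (('D_1 f x - (y - x)^-1 * (f y - f x)) * (y - x)).
  by field.
by rewrite normrN normrM ler_wpM2r.
Qed.

Lemma has_der_eq (R : realType) (D : set R) (f : R -> R) (x l k : R) :
  l = k -> has_der D f x l -> has_der D f x k.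
Proof. by move=> ->. Qed.

Lemma has_der_ext (R : realType) (D : set R) (f g : R -> R) (x l : R) :
  D x -> (forall y, D y -> f y = g y) -> has_der D f x l -> has_der D g x l.
Proof.
move=> Dx fg df e /df[d d0 H]; exists d => // y Dy; rewrite -!fg //; exact: H.
Qed.

Lemma has_derD (R : realType) (D : set R) (f g : R -> R) (x l k : R) :
  has_der D f x l -> has_der D g x k ->
  has_der D (fun y => f y + g y) x (l + k).
Proof.
move=> df dg e e0; have e2 : 0 < e / 2 by lra.
have [d1 d10 H1] := df _ e2; have [d2 d20 H2] := dg _ e2.
exists (Num.min d1 d2); first by rewrite lt_min d10 d20.
move=> y Dy; rewrite lt_min => /andP[y1 y2].
have := H1 y Dy y1; have := H2 y Dy y2; set u := `|y - x|.
have -> : f y + g y - (f x + g x) - (l + k) * (y - x) =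
  (f y - f x - l * (y - x)) + (g y - g x - k * (y - x)) by ring.
move=> h1 h2; apply: le_trans (ler_normD _ _) _; lra.
Qed.

Lemma has_derZ (R : realType) (D : set R) (f : R -> R) (x l c : R) :
  has_der D f x l -> has_der D (fun y => c * f y) x (c * l).
Proof.
move=> df e e0; have c0 : 0 < `|c| + 1 by rewrite ltr_wpDl.
have [d d0 H] := df (e / (`|c| + 1)) (divr_gt0 e0 c0).
exists d => // y Dy yd; have := H y Dy yd.
have -> : c * f y - c * f x - c * l * (y - x) = c * (f y - f x - l * (y - x)) by ring.
rewrite normrM; set u := `|y - x|; set v := `|_ - _| => h.
have v0 : 0 <= v by exact: normr_ge0.
have : (`|c| + 1) * v <= e * u.
  apply: le_trans (ler_wpM2l (ltW c0) h) _.
  by rewrite le_eqVlt; apply/orP; left; apply/eqP; field; rewrite gt_eqF.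
by lra.
Qed.

Lemma has_derN (R : realType) (D : set R) (f : R -> R) (x l : R) :
  has_der D f x l -> has_der D (fun y => - f y) x (- l).
Proof.
move=> df; have := has_derZ (-1) df; rewrite mulN1r.
by under eq_fun do rewrite mulN1r.
Qed.

Lemma has_derB (R : realType) (D : set R) (f g : R -> R) (x l k : R) :
  has_der D f x l -> has_der D g x k ->
  has_der D (fun y => f y - g y) x (l - k).
Proof. by move=> df dg; apply: has_derD => //; exact: has_derN. Qed.

Lemma has_der_cst (R : realType) (D : set R) (c x : R) : has_der D (fun _ => c) x 0.
Proof. by move=> e e0; exists 1 => // y _ _; rewrite subrr mul0r subrr normr0 mulr_ge0// ltW. Qed.

Lemma has_der_id (R : realType) (D : set R) (x : R) : has_der D (fun y => y) x 1.
Proof. by move=> e e0; exists 1 => // y _ _; rewrite mul1r subrr normr0 mulr_ge0// ltW. Qed.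

Lemma has_der_cont (R : realType) (D : set R) (f : R -> R) (x l : R) :
  has_der D f x l -> forall e, 0 < e -> exists2 d, 0 < d &
    forall y, D y -> `|y - x| < d -> `|f y - f x| < e.
Proof.
move=> df e e0; have [d d0 H] := df 1 ltr01.
have l0 : 0 < `|l| + 1 by rewrite ltr_wpDl.
exists (Num.min d (e / (`|l| + 1))); first by rewrite lt_min d0 divr_gt0.
move=> y Dy; rewrite lt_min => /andP[y1 y2].
have := H y Dy y1; move: y2; rewrite ltr_pdivlMr // => y2 h.
have -> : f y - f x = (f y - f x - l * (y - x)) + l * (y - x) by ring.
apply: le_lt_trans (ler_normD _ _) _; rewrite normrM; lra.
Qed.

Lemma has_der_comp (R : realType) (D : set R) (f g : R -> R) (x l k : R) :
  has_der D f x l -> has_der [set: R] g (f x) k ->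
  has_der D (fun y => g (f y)) x (k * l).
Proof.
move=> df dg e e0.
have l0 : 0 < `|l| + 1 by rewrite ltr_wpDl.
have k0 : 0 < 2 * (`|k| + 1) by rewrite mulr_gt0// ltr_wpDl.
have e1 : 0 < e / (2 * (`|l| + 1)) by rewrite divr_gt0 // mulr_gt0.
have e2 : 0 < Num.min 1 (e / (2 * (`|k| + 1))) by rewrite lt_min ltr01 divr_gt0.
have [d1 d10 H1] := df _ e2; have [d2 d20 H2] := dg _ e1.
have [d3 d30 H3] := has_der_cont df d20.
exists (Num.min d1 d3); first by rewrite lt_min d10 d30.
move=> y Dy; rewrite lt_min => /andP[y1 y3].
have h1 := H1 y Dy y1; have h2 := H2 (f y) I (H3 y Dy y3).
set u := `|y - x| in h1 *.
have u0 : 0 <= u by exact: normr_ge0.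
have h1a : `|f y - f x - l * (y - x)| <= 1 * u.
  by apply: le_trans h1 _; rewrite ler_wpM2r // ge_min lexx.
have h1b : `|f y - f x - l * (y - x)| <= e / (2 * (`|k| + 1)) * u.
  by apply: le_trans h1 _; rewrite ler_wpM2r // ge_min lexx orbT.
have h3 : `|f y - f x| <= (`|l| + 1) * u.
  have -> : f y - f x = (f y - f x - l * (y - x)) + l * (y - x) by ring.
  apply: le_trans (ler_normD _ _) _; rewrite normrM -/u; move: h1a; clear; lra.
have -> : g (f y) - g (f x) - k * l * (y - x) =
  (g (f y) - g (f x) - k * (f y - f x)) + k * (f y - f x - l * (y - x)) by ring.
apply: le_trans (ler_normD _ _) _; rewrite normrM.
have A : `|g (f y) - g (f x) - k * (f y - f x)| <= e / 2 * u.
  apply: le_trans h2 _.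
  have -> : e / 2 * u = e / (2 * (`|l| + 1)) * ((`|l| + 1) * u).
    by field; rewrite gt_eqF.
  by rewrite ler_wpM2l // ltW.
have B : (`|k| + 1) * `|f y - f x - l * (y - x)| <= e / 2 * u.
  apply: le_trans (ler_wpM2l _ h1b) _; first by rewrite ltW // ltr_wpDl.
  rewrite le_eqVlt; apply/orP; left; apply/eqP; field.
  by rewrite gt_eqF // ltr_wpDl.
have : 0 <= `|f y - f x - l * (y - x)| by exact: normr_ge0.
move: A B; clear; lra.
Qed.

Lemma is_derive_has_der (R : realType) (f : R -> R) (x l : R) :
  has_der [set: R] f x l -> is_derive x 1 f l.
Proof.
move=> df; have H : h^-1 *: (f (h *: 1 + x) - f x) @[h --> 0^'] --> l.
  apply/cvgrPdist_le => e e0; have [d d0 Hd] := df e e0.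
  rewrite /dnbhs near_withinE; exists d => //= h; rewrite /ball_ /= sub0r normrN => hd h0.
  have := Hd (h + x) I; rewrite addrK => /(_ hd) => H.
  rewrite /GRing.scale /= mulr1.
  have -> : l - h^-1 * (f (h + x) - f x) = - ((f (h + x) - f x - l * h) / h) by field.
  by rewrite normrN normrM normfV ler_pdivrMr ?normr_gt0.
split; first by apply/cvg_ex; exists l.
exact: cvg_lim.
Qed.

Lemma has_der_sqr (R : realType) (x : R) : has_der [set: R] (fun y => y ^+ 2) x (2 * x).
Proof.
move=> e e0; exists e => // y _ ye.
have -> : y ^+ 2 - x ^+ 2 - 2 * x * (y - x) = (y - x) * (y - x) by ring.
by rewrite normrM ler_wpM2r // ltW.
Qed.

(** By polarization, the product rule follows from the rule for the square. *)
Lemma has_derM (R : realType) (D : set R) (f g : R -> R) (x l k : R) :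
  D x -> has_der D f x l -> has_der D g x k ->
  has_der D (fun y => f y * g y) x (l * g x + f x * k).
Proof.
move=> Dx df dg.
have h1 := has_der_comp (has_derD df dg) (@has_der_sqr _ (f x + g x)).
have h2 := has_der_comp (has_derB df dg) (@has_der_sqr _ (f x - g x)).
have h3 := has_derZ (1 / 4) (has_derB h1 h2).
apply: (has_der_eq _ (has_der_ext Dx _ h3)); first by field.
by move=> y _; field.
Qed.

Lemma has_der_expR (R : realType) (x : R) : has_der [set: R] (@expR R) x (expR x).
Proof. exact: has_der_is_derive. Qed.

Lemma has_der_pow4 (R : realType) (x : R) : has_der [set: R] (fun z => z ^+ 4) x (4 * x ^+ 3).
Proof.
have h := has_der_comp (@has_der_sqr _ x : has_der [set: R] (fun z => z ^+ 2) x (2 * x))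
  (@has_der_sqr _ (x ^+ 2)).
apply: (has_der_eq _ (has_der_ext _ _ h)) => //; first by ring.
by move=> y _; rewrite -exprM.
Qed.

Lemma has_der_pow3 (R : realType) (x : R) : has_der [set: R] (fun z => z ^+ 3) x (3 * x ^+ 2).
Proof.
have h := @has_derM _ [set: R] (fun z => z ^+ 2) (fun z => z) x _ _ I (@has_der_sqr _ x) (@has_der_id _ _ x).
apply: (has_der_eq _ (has_der_ext _ _ h)) => //; first by ring.
by move=> y _; rewrite -exprSr.
Qed.

Lemma has_der_translate (R : realType) (D : set R) (k x : R) : has_der D (fun y => y - k) x 1.
Proof. by rewrite -[1]subr0; apply: has_derB; [exact: has_der_id|exact: has_der_cst]. Qed.

Lemma has_der_unique (R : realType) (a b : R) (f : R -> R) (x l k : R) :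
  a < b -> a <= x <= b -> has_der `[a, b] f x l -> has_der `[a, b] f x k -> l = k.
Proof.
move=> ab axb dl dk; apply/eqP; rewrite -subr_eq0 -normr_eq0; apply: contraT => ne.
have e0 : 0 < `|l - k| / 4 by rewrite divr_gt0 // lt_neqAle eq_sym ne normr_ge0.
have [d1 d10 H1] := dl _ e0; have [d2 d20 H2] := dk _ e0.
have [|d d0 /= /and4P[k1 k2 k3 _]] := @exists_below _ [:: d1; d2; (b - a) / 2].
  by rewrite /= d10 d20 divr_gt0 // subr_gt0.
have [y [ayb yx]] : exists y, a <= y <= b /\ `|y - x| = d.
  have [h|h] := leP x ((a + b) / 2).
    by exists (x + d); split; [lra|rewrite addrC addKr gtr0_norm].
  by exists (x - d); split; [lra|rewrite addrAC subrr sub0r normrN gtr0_norm].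
have Dy : [set` `[a, b]] y by rewrite /= in_itv.
have := H1 y Dy; have := H2 y Dy; rewrite yx => /(_ k2) h2 /(_ k1) h1.
have : `|l - k| * d <= `|l - k| / 2 * d.
  rewrite -{1}yx -normrM.
  have -> : (l - k) * (y - x) = (f y - f x - k * (y - x)) - (f y - f x - l * (y - x)) by ring.
  apply: le_trans (ler_normB _ _) _; lra.
rewrite ler_pM2r //; lra.
Qed.

Lemma has_der_glue (R : realType) (a b c : R) (f : R -> R) (x l : R) :
  a <= x <= c -> (x <= b -> has_der `[a, b] f x l) -> (b <= x -> has_der `[b, c] f x l) ->
  has_der `[a, c] f x l.
Proof.
move=> axc hl hr e e0; case: (ltgtP x b) => xb.
- have [d d0 H] := hl (ltW xb) e e0.
  exists (Num.min d (b - x)); first by rewrite lt_min d0 subr_gt0.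
  move=> y; rewrite /= in_itv /= lt_min => yac /andP[y1 y2]; apply: H => //.
  by rewrite /= in_itv /=; move: y2; rewrite ltr_norml; lra.
- have [d d0 H] := hr (ltW xb) e e0.
  exists (Num.min d (x - b)); first by rewrite lt_min d0 subr_gt0.
  move=> y; rewrite /= in_itv /= lt_min => yac /andP[y1 y2]; apply: H => //.
  by rewrite /= in_itv /=; move: y2; rewrite ltr_norml; lra.
have xb1 : x <= b by rewrite xb. have xb2 : b <= x by rewrite xb.
have [d d0 H] := hl xb1 e e0; have [d' d'0 H'] := hr xb2 e e0.
exists (Num.min d d'); first by rewrite lt_min d0 d'0.
move=> y; rewrite /= in_itv /= lt_min => yac /andP[y1 y2].
have [yb|yb] := leP y b.
  by apply: H => //; rewrite /= in_itv /=; lra.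
by apply: H' => //; rewrite /= in_itv /=; lra.
Qed.

Lemma has_der_shift (R : realType) (a b c : R) (f : R -> R) (x l : R) :
  has_der `[a + c, b + c] f (x + c) l -> has_der `[a, b] (fun y => f (y + c)) x l.
Proof.
move=> df e e0; have [d d0 H] := df e e0; exists d => // y; rewrite /= in_itv /= => yab yx.
have E : y + c - (x + c) = y - x by ring.
have Dy : [set` `[a + c, b + c]] (y + c) by rewrite /= in_itv /=; lra.
by have := H _ Dy; rewrite E; apply.
Qed.

(** * Crossing arguments, mean value inequality, second-order expansions *)

(** A function that starts nonnegative and is nonnegative just after each of its
    zeros stays nonnegative: consider the supremum of the points where it is
    nonnegative. *)
Lemma cross_right (R : realType) (f : R -> R) (x y : R) :
  x <= y ->
  (forall s, x <= s <= y -> forall e, 0 < e -> exists2 d, 0 < d &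
    forall u, x <= u <= y -> `|u - s| < d -> `|f u - f s| < e) ->
  0 <= f x ->
  (forall s, x <= s < y -> f s = 0 -> exists2 d, 0 < d &
     forall u, x <= u <= y -> s < u < s + d -> 0 <= f u) ->
  0 <= f y.
Proof.
move=> xy fc fx0 H; rewrite leNgt; apply/negP => fy0.
pose S := [set s | x <= s <= y /\ 0 <= f s].
have Sx : S x by split; rewrite // lexx xy.
have hS : has_sup S.
  by split; [exists x | exists y => s [/andP[]]].
pose s := sup S.
have xs : x <= s by apply: ub_le_sup => //; case: hS.
have sy : s <= y by apply: ge_sup; [exists x|move=> u [/andP[]]].
have xsy : x <= s <= y by rewrite xs sy.
have fs0 : 0 <= f s.
  rewrite leNgt; apply/negP => fs.
  have fs' : 0 < - f s by lra.
  have [d d0 Hd] := fc s xsy _ fs'.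
  have [u Su su] := sup_adherent d0 hS.
  have us : u <= s by apply: ub_le_sup => //; case: hS.
  case: Su => uxy fu.
  have := Hd u uxy; rewrite ler0_norm ?subr_le0 //; rewrite -/s in su.
  have h : - (u - s) < d by lra.
  by move=> /(_ h); rewrite ltr_norml => /andP[]; lra.
have sny : s != y by apply/eqP => E; move: fs0; rewrite E; lra.
have sy' : s < y by rewrite lt_neqAle sny sy.
have hub u : S u -> u <= s by move=> Su; apply: ub_le_sup => //; case: hS.
have [d d0 Hd] : exists2 d, 0 < d & forall u, x <= u <= y -> s < u < s + d -> 0 <= f u.
  have [fs|fs] := eqVneq (f s) 0; first by apply: H => //; rewrite xs sy'.
  have fsp : 0 < f s by rewrite lt_neqAle eq_sym fs fs0.
  have [d d0 Hd] := fc s xsy _ fsp; exists d => // u uxy us.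
  have ud : `|u - s| < d by move: us; clear => us; rewrite ger0_norm; lra.
  by have := Hd u uxy ud; rewrite ltr_norml; clear; lra.
have [|k k0 /= /and3P[kd ky _]] := @exists_below _ [:: d; y - s].
  by rewrite /= d0 subr_gt0 sy'.
have uxy : x <= s + k <= y by move: xs k0 ky; clear; lra.
have su : s < s + k < s + d by move: k0 kd; clear; lra.
by have := hub _ (conj uxy (Hd _ uxy su)); move: k0; clear; lra.
Qed.

(** A positive derivative at every zero prevents [f] from becoming negative. *)
Lemma cross_right_der (R : realType) (f f' : R -> R) (x y : R) :
  x <= y -> (forall s, x <= s <= y -> has_der `[x, y] f s (f' s)) ->
  0 <= f x -> (forall s, x <= s < y -> f s = 0 -> 0 < f' s) -> 0 <= f y.
Proof.
move=> xy df fx H; apply: (cross_right xy _ fx).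
  move=> s xsy e e0; have [d d0 Hd] := has_der_cont (df s xsy) e0.
  by exists d => // u uxy; apply: Hd; rewrite /= in_itv.
move=> s xsy fs; have f's := H s xsy fs.
have xsy' : x <= s <= y by case/andP: xsy => -> /ltW ->.
have [d d0 Hd] := df s xsy' _ f's; exists d => // u uxy /andP[su us].
have ud : `|u - s| < d by rewrite ger0_norm; lra.
have Du : [set` `[x, y]] u by rewrite /= in_itv.
have := Hd u Du ud; rewrite fs subr0 [`|u - s|]ger0_norm; last lra.
by rewrite ler_norml => /andP[]; lra.
Qed.

Lemma cross_left_der (R : realType) (f f' : R -> R) (x y : R) :
  x <= y -> (forall s, x <= s <= y -> has_der `[x, y] f s (f' s)) ->
  0 <= f y -> (forall s, x < s <= y -> f s = 0 -> f' s < 0) -> 0 <= f x.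
Proof.
move=> xy df fy H.
have := @cross_right_der _ (fun s => f (- s)) (fun s => - f' (- s)) (- y) (- x).
rewrite !opprK; apply => //; first lra.
  move=> s sxy; have s' : x <= - s <= y by lra.
  move=> e /(df _ s')[d d0 Hd]; exists d => // u.
  rewrite /= in_itv /= => uxy us.
  have E : - u - - s = - (u - s) by ring.
  have u' : [set` `[x, y]] (- u) by rewrite /= in_itv /=; lra.
  have := Hd (- u) u'; rewrite E normrN mulrN mulNr; exact.
move=> s sxy fs; have s' : x < - s <= y by lra.
have := H _ s' fs; lra.
Qed.

(** For each [e > 0] the difference of the two sides, with slope [c + e] in
    place of [c], starts at 0 and has a positive derivative. *)
Lemma mean_value_le (R : realType) (f f' : R -> R) (x y c : R) :
  x <= y -> (forall s, x <= s <= y -> has_der `[x, y] f s (f' s)) ->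
  (forall s, x <= s <= y -> f' s <= c) -> f y - f x <= c * (y - x).
Proof.
move=> xy df H; apply/ler_addgt0Pl => e e0.
have yx : 0 < y - x + 1 by lra.
have ee : 0 < e / (y - x + 1) by rewrite divr_gt0.
have h : 0 <= (c + e / (y - x + 1)) * (y - x) - (f y - f x).
  apply: (@cross_right_der _ (fun s => (c + e / (y - x + 1)) * (s - x) - (f s - f x))
  (fun s => (c + e / (y - x + 1)) * (1 - 0) - (f' s - 0)) x y xy).
  - move=> s xsy; apply: has_derB; first apply: has_derZ; apply: has_derB;
      by [exact: has_der_id|exact: has_der_cst|exact: df].
  - by rewrite !subrr mulr0 subrr.
  move=> s /andP[xs sy] _; have := H s; rewrite xs ltW // => /(_ isT).
  rewrite subr0; lra.
have E : e / (y - x + 1) * (y - x) <= e.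
  by rewrite mulrAC ler_pdivrMr // ler_wpM2l ?ltW //; lra.
by lra.
Qed.

Lemma mean_value_abs (R : realType) (f f' : R -> R) (x y c : R) :
  x <= y -> (forall s, x <= s <= y -> has_der `[x, y] f s (f' s)) ->
  (forall s, x <= s <= y -> `|f' s| <= c) -> `|f y - f x| <= c * (y - x).
Proof.
move=> xy df H; rewrite ler_norml; apply/andP; split; last first.
  by apply: (mean_value_le xy df) => s /H; rewrite ler_norml => /andP[].
have h : (- f y) - (- f x) <= c * (y - x).
  apply: (@mean_value_le _ (fun s => - f s) (fun s => - f' s)) => //.
    by move=> s /df; exact: has_derN.
  by move=> s /H; rewrite ler_norml => /andP[]; lra.
lra.
Qed.

(** A second-order expansion at one point is all that a contact argument needs;
    it is weaker than the existence of a second derivative near [x]. *)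
Definition taylor2 (R : realType) (D : set R) (f : R -> R) (x p q : R) : Prop :=
  forall e, 0 < e -> exists2 d, 0 < d & forall y, D y -> `|y - x| < d ->
    `|f y - f x - p * (y - x) - q / 2 * (y - x) ^+ 2| <= e * (y - x) ^+ 2.

(** Estimate the derivative of the remainder and integrate by the mean value
    inequality. *)
Lemma taylor2P (R : realType) (a b : R) (f f' : R -> R) (x q : R) :
  a <= x <= b -> (forall s, a <= s <= b -> has_der `[a, b] f s (f' s)) ->
  has_der `[a, b] f' x q -> taylor2 `[a, b] f x (f' x) q.
Proof.
move=> axb df df' e e0; have [d d0 Hd] := df' e e0; exists d => // y.
rewrite /= in_itv /= => ayb yx.
pose g s := f s - f x - f' x * (s - x) - q / 2 * ((s - x) * (s - x)).
pose g' s := f' s - 0 - f' x * (1 - 0) - q / 2 * (2 * (s - x)).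
have dg s : a <= s <= b -> has_der `[a, b] g s (g' s).
  move=> asb; apply: has_derB; first apply: has_derB.
  - by apply: has_derB; [exact: df|exact: has_der_cst].
  - by apply: has_derZ; apply: has_derB; [exact: has_der_id|exact: has_der_cst].
  apply: has_derZ; apply: has_der_is_derive; split; last first.
    rewrite deriveM // deriveB // derive_id derive_cst /GRing.scale /=; ring.
  exact: derivableM.
have bd s : a <= s <= b -> `|s - x| <= `|y - x| -> `|g' s| <= e * `|y - x|.
  move=> asb sy; have Ds : [set` `[a, b]] s by rewrite /= in_itv.
  have := Hd s Ds (le_lt_trans sy yx).
  have -> : g' s = f' s - f' x - q * (s - x) by rewrite /g'; field.
  by move=> h; apply: le_trans h _; rewrite ler_wpM2l // ltW.
have -> : f y - f x - f' x * (y - x) - q / 2 * (y - x) ^+ 2 = g y - g x.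
  by rewrite /g expr2; ring.
have sub u v : a <= u -> v <= b -> forall s, u <= s <= v -> has_der `[u, v] g s (g' s).
  move=> au vb s usv; have asb : a <= s <= b by lra.
  by apply: has_der_subset (dg s asb) => z; rewrite /= !in_itv /=; lra.
have [xy|yx'] := leP x y.
  have := @mean_value_abs _ g g' x y (e * `|y - x|) xy.
  rewrite -mulrA ger0_norm ?subr_ge0 // -expr2; apply; first by apply: sub; lra.
  move=> s xsy; have := bd s; rewrite [`|y - x|]ger0_norm ?subr_ge0 //.
  by apply; [lra|rewrite ger0_norm; lra].
have := @mean_value_abs _ g g' y x (e * `|y - x|) (ltW yx').
rewrite [`|g x - g y|]distrC -mulrA; have -> : `|y - x| * (x - y) = (y - x) ^+ 2.
  by rewrite ltr0_norm ?subr_lt0 // expr2; ring.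
apply; first by apply: sub; lra.
move=> s ysx; apply: bd; first by lra.
by rewrite [`|y - x|]ltr0_norm ?subr_lt0 // ler0_norm; lra.
Qed.

Lemma taylor2D (R : realType) (D : set R) (f g : R -> R) (x p q p' q' : R) :
  taylor2 D f x p q -> taylor2 D g x p' q' ->
  taylor2 D (fun y => f y + g y) x (p + p') (q + q').
Proof.
move=> hf hg e e0; have e2 : 0 < e / 2 by lra.
have [d1 d10 H1] := hf _ e2; have [d2 d20 H2] := hg _ e2.
exists (Num.min d1 d2); first by rewrite lt_min d10 d20.
move=> y Dy; rewrite lt_min => /andP[y1 y2].
have h1 := H1 y Dy y1; have h2 := H2 y Dy y2.
have -> : f y + g y - (f x + g x) - (p + p') * (y - x) - (q + q') / 2 * (y - x) ^+ 2 =
  (f y - f x - p * (y - x) - q / 2 * (y - x) ^+ 2) +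
  (g y - g x - p' * (y - x) - q' / 2 * (y - x) ^+ 2) by ring.
apply: le_trans (ler_normD _ _) _; lra.
Qed.

Lemma taylor2Z (R : realType) (D : set R) (f : R -> R) (x p q c : R) :
  taylor2 D f x p q -> taylor2 D (fun y => c * f y) x (c * p) (c * q).
Proof.
move=> hf e e0; have c0 : 0 < `|c| + 1 by rewrite ltr_wpDl.
have [d d0 H] := hf (e / (`|c| + 1)) (divr_gt0 e0 c0).
exists d => // y Dy yd; have := H y Dy yd.
have -> : c * f y - c * f x - c * p * (y - x) - c * q / 2 * (y - x) ^+ 2 =
  c * (f y - f x - p * (y - x) - q / 2 * (y - x) ^+ 2) by ring.
set w := (y - x) ^+ 2; have w0 : 0 <= w by exact: sqr_ge0.
rewrite normrM; set v := `|_ - _| => h; have v0 : 0 <= v by exact: normr_ge0.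
have : (`|c| + 1) * v <= e * w.
  apply: le_trans (ler_wpM2l (ltW c0) h) _.
  by rewrite le_eqVlt; apply/orP; left; apply/eqP; field; rewrite gt_eqF.
lra.
Qed.

Section LocalMin.
Context (R : realType).
Implicit Types (f : R -> R) (x p q : R).

Lemma local_min_right f x p q : taylor2 `[0, 1] f x p q -> 0 <= x < 1 ->
  (exists2 d, 0 < d & forall y, 0 <= y <= 1 -> `|y - x| < d -> f x <= f y) -> 0 <= p.
Proof.
move=> hf x01 [d1 d10 H1]; rewrite leNgt; apply/negP => p0.
have [d d0 H] := hf 1 ltr01.
pose c := `|q| / 2 + 1; have c0 : 0 < c by rewrite /c ltr_wpDl // divr_ge0.
have [|k k0 /= /and5P[k1 k2 k3 k4 _]] := @exists_below _ [:: d; d1; 1 - x; - p / c].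
  by case/andP: x01 => _ x1; rewrite /= d0 d10 subr_gt0 x1 divr_gt0 // oppr_gt0.
rewrite ltr_pdivlMr // in k4.
have y01 : 0 <= x + k <= 1 by lra.
have E : x + k - x = k by ring.
have := H (x + k) y01; have := H1 (x + k) y01.
rewrite E gtr0_norm // => /(_ k2) h1 /(_ k1); rewrite mul1r => /ler_normlP[_ h2].
have : p * k + q / 2 * k ^+ 2 + k ^+ 2 >= 0 by lra.
have : q / 2 * k ^+ 2 <= `|q| / 2 * k ^+ 2.
  by rewrite ler_wpM2r ?sqr_ge0 // ler_pM2r // ler_norm.
have : k * (k * c) < k * - p by rewrite ltr_pM2l.
rewrite /c expr2; lra.
Qed.

(** Reflection [x |-> 1 - x] of [local_min_right]. *)
Lemma local_min_left f x p q : taylor2 `[0, 1] f x p q -> 0 < x <= 1 ->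
  (exists2 d, 0 < d & forall y, 0 <= y <= 1 -> `|y - x| < d -> f x <= f y) -> p <= 0.
Proof.
move=> hf x01 [d1 d10 H1].
have hg : taylor2 `[0, 1] (fun y => f (1 - y)) (1 - x) (- p) q.
  move=> e e0; have [d d0 H] := hf e e0; exists d => // y; rewrite /= in_itv /= => y01 yx.
  have E : 1 - y - x = - (y - (1 - x)) by ring.
  have Dy : [set` `[0, 1]] (1 - y) by rewrite /= in_itv /=; lra.
  have := H (1 - y) Dy; rewrite E normrN => /(_ yx).
  by rewrite sqrrN mulrN mulNr (_ : 1 - (1 - x) = x) //; ring.
suff : 0 <= - p by lra.
apply: (@local_min_right (fun y => f (1 - y)) (1 - x) (- p) q hg); first lra.
exists d1 => // y y01 yx; rewrite (_ : 1 - (1 - x) = x); last by ring.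
apply: H1; first lra.
by rewrite (_ : 1 - y - x = - (y - (1 - x))) ?normrN //; ring.
Qed.

Lemma local_min_second f x p q : taylor2 `[0, 1] f x p q -> 0 <= x <= 1 -> p = 0 ->
  (exists2 d, 0 < d & forall y, 0 <= y <= 1 -> `|y - x| < d -> f x <= f y) -> 0 <= q.
Proof.
move=> hf x01 p0 [d1 d10 H1]; rewrite leNgt; apply/negP => q0.
have q4 : 0 < - q / 4 by lra.
have [d d0 H] := hf _ q4.
have [|k k0 /= /and4P[k1 k2 k3 _]] := @exists_below _ [:: d; d1; 1 / 2].
  by rewrite /= d0 d10 divr_gt0.
have [y [y01 yx yk]] : exists y, [/\ 0 <= y <= 1, `|y - x| = k & (y - x) ^+ 2 = k ^+ 2].
  have [h|h] := leP x (1 / 2).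
    have E : x + k - x = k by ring.
    by exists (x + k); rewrite E gtr0_norm //; split => //; lra.
  have E : x - k - x = - k by ring.
  by exists (x - k); rewrite E normrN sqrrN gtr0_norm //; split => //; lra.
have := H y y01; have := H1 y y01; rewrite yx yk p0 mul0r subr0 => /(_ k2) h1 /(_ k1) /ler_normlP[_ h2].
have : 0 < - q * k ^+ 2 by rewrite mulr_gt0 ?exprn_gt0 //; lra.
lra.
Qed.
End LocalMin.

(** * Continuity on boxes *)

Lemma within_comp (X Y : topologicalType) (Z : topologicalType) (D : set Y)
    (g : X -> Y) (f : Y -> Z) :
  continuous g -> (forall x, D (g x)) -> {within D, continuous f} ->
  continuous (f \o g).
Proof.
move=> cg gD cf x.
have h : f @ within D (nbhs (g x)) --> f (g x).
  by have := cf (g x); rewrite /continuous_at /nbhs /= /nbhs_subspace mem_set.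
move=> A /h H; have := cg x _ H; rewrite /= /nbhs /= => H'.
by apply: filterS H' => y; apply; exact: gD.
Qed.

(** Composing with the projection onto a segment turns continuity relative to
    the segment into continuity on the whole line. *)
Definition clamp (R : realType) (a b x : R) : R := Num.max a (Num.min x b).

Lemma clamp_in (R : realType) (a b x : R) : a <= b -> a <= clamp a b x <= b.
Proof. by move=> ab; rewrite /clamp; case: (leP x b) => h1; [case: (leP a x)|case: (leP a b)]; lra. Qed.

Lemma clamp_id (R : realType) (a b x : R) : a <= x <= b -> clamp a b x = x.
Proof. by move=> /andP[ax xb]; rewrite /clamp min_l // max_r. Qed.

Lemma clamp_cont (R : realType) (a b : R) : continuous (clamp a b).
Proof.
move=> x; apply: (@continuous_max _ _ (fun=> a) (fun y => Num.min y b)); first exact: cvg_cst.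
by apply: (@continuous_min _ _ id (fun=> b)); [exact: cvg_id|exact: cvg_cst].
Qed.

Lemma within_clamp (R : realType) (a b : R) (f : R -> R) : a <= b ->
  {within `[a, b], continuous f} -> continuous (f \o clamp a b).
Proof.
move=> ab; apply: within_comp; first exact: clamp_cont.
by move=> x; rewrite /= in_itv /=; exact: clamp_in.
Qed.

Lemma cont_pair (X Y Z : topologicalType) (f : X -> Y) (g : X -> Z) :
  continuous f -> continuous g -> continuous (fun x => (f x, g x)).
Proof. by move=> cf cg x; apply: cvg_pair; [exact: cf|exact: cg]. Qed.

Definition clamp2 (R : realType) (a b : R) (z : R * R) : R * R :=
  (clamp 0 1 z.1, clamp a b z.2).

Lemma clamp2_cont (R : realType) (a b : R) : continuous (clamp2 a b).
Proof.
apply: cont_pair => z.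
  by apply: (@continuous_comp _ _ _ fst); [exact: cvg_fst|exact: clamp_cont].
by apply: (@continuous_comp _ _ _ snd); [exact: cvg_snd|exact: clamp_cont].
Qed.

Lemma within_clamp2 (R : realType) (a b : R) (f : R * R -> R) : a <= b ->
  {within `[0, 1] `*` `[a, b], continuous f} -> continuous (f \o clamp2 a b).
Proof.
move=> ab; apply: within_comp; first exact: clamp2_cont.
by move=> x; split; rewrite /= in_itv /=; exact: clamp_in.
Qed.

Lemma box_compact (R : realType) (a b c d : R) : compact (`[a, b] `*` `[c, d] : set (R * R)).
Proof. by apply: compact_setX; exact: segment_compact. Qed.

Lemma EVT_min2 (R : realType) (f : R * R -> R) (a b c d : R) :
  a <= b -> c <= d -> continuous f ->
  exists x t, [/\ a <= x <= b, c <= t <= d &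
    forall y s, a <= y <= b -> c <= s <= d -> f (x, t) <= f (y, s)].
Proof.
move=> ab cd cf.
have ne : (`[a, b] `*` `[c, d] : set (R * R)) !=set0.
  by exists (a, c); split; rewrite /= in_itv /= lexx.
have [[x t]] := compact_EVT_min ne (@box_compact _ a b c d) (continuous_subspaceT cf).
rewrite inE => -[/=]; rewrite !in_itv /= => ? ? H; exists x, t; split => // y s ? ?.
by apply: H; rewrite inE; split; rewrite /= in_itv.
Qed.

Lemma EVT_max2 (R : realType) (f : R * R -> R) (a b c d : R) :
  a <= b -> c <= d -> continuous f ->
  exists x t, [/\ a <= x <= b, c <= t <= d &
    forall y s, a <= y <= b -> c <= s <= d -> f (y, s) <= f (x, t)].
Proof.
move=> ab cd cf.
have cf' : continuous (fun z => - f z) by move=> z; apply: cvgN; exact: cf.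
have [x [t [? ? H]]] := EVT_min2 ab cd cf'.
by exists x, t; split => // y s ? ?; rewrite -lerN2; exact: H.
Qed.

Lemma bounded2 (R : realType) (f : R * R -> R) (a b c d : R) : continuous f ->
  exists2 B, 0 < B &
    forall y s, a <= y <= b -> c <= s <= d -> `|f (y, s)| <= B.
Proof.
move=> cf; have [ab|ab] := leP a b; last first.
  by exists 1 => // y s; lra.
have [cd|cd] := leP c d; last first.
  by exists 1 => // y s; lra.
have cf' : continuous (fun z => `|f z|) by move=> z; apply: cvg_norm; exact: cf.
have [x [t [? ? H]]] := EVT_max2 ab cd cf'.
by exists (`|f (x, t)| + 1) => [|y s hy hs]; [rewrite ltr_wpDl|rewrite ler_wpDr // H].
Qed.

(** The distance attains a positive minimum on the compact set of pairs of
    points at which the values differ by at least [e]. *)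
Lemma ucont2 (R : realType) (f : R * R -> R) (a b c d : R) : continuous f ->
  forall e, 0 < e -> exists2 r, 0 < r & forall x t y s,
    a <= x <= b -> c <= t <= d -> a <= y <= b -> c <= s <= d ->
    `|x - y| < r -> `|t - s| < r -> `|f (x, t) - f (y, s)| < e.
Proof.
move=> cf e e0.
pose B : set (R * R) := `[a, b] `*` `[c, d].
pose K : set ((R * R) * (R * R)) := (B `*` B) `&` [set w | e <= `|f w.1 - f w.2|].
have cg : continuous (fun w : (R * R) * (R * R) => `|f w.1 - f w.2|).
  move=> w; apply: cvg_norm; apply: cvgB.
    by apply: (@continuous_comp _ _ _ fst f); [exact: cvg_fst|exact: cf].
  by apply: (@continuous_comp _ _ _ snd f); [exact: cvg_snd|exact: cf].
have cK : compact K.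
  apply: compact_closedI; first by apply: compact_setX; exact: box_compact.
  rewrite (_ : [set w | _] = (fun w => `|f w.1 - f w.2|) @^-1` [set r | e <= r]) //.
  by apply: closed_comp => [w _|]; [exact: cg|exact: closed_ge].
have [K0|nK] := pselect (K !=set0); last first.
  exists 1 => // x t y s hx ht hy hs _ _; rewrite ltNge; apply/negP => h.
  by apply: nK; exists ((x, t), (y, s)); split => //; split; split; rewrite /= in_itv.
pose g (w : (R * R) * (R * R)) : R := `|w.1.1 - w.2.1| + `|w.1.2 - w.2.2|.
have cdist : continuous g.
  have c1 : continuous (fun w : (R * R) * (R * R) => w.1) by move=> w; exact: cvg_fst.
  have c2 : continuous (fun w : (R * R) * (R * R) => w.2) by move=> w; exact: cvg_snd.
  have d1 : continuous (fun w : R * R => w.1) by move=> w; exact: cvg_fst.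
  have d2 : continuous (fun w : R * R => w.2) by move=> w; exact: cvg_snd.
  move=> w; apply: cvgD; apply: cvg_norm; apply: cvgB.
  - exact: (continuous_comp (@c1 w) (@d1 _)).
  - exact: (continuous_comp (@c2 w) (@d1 _)).
  - exact: (continuous_comp (@c1 w) (@d2 _)).
  - exact: (continuous_comp (@c2 w) (@d2 _)).
have [[[x0 t0] [y0 s0]]] := compact_EVT_min K0 cK (continuous_subspaceT cdist).
rewrite inE => -[_ /= H0] Hmin.
have g0 : 0 < g ((x0, t0), (y0, s0)).
  rewrite lt_neqAle eq_sym addr_ge0 // andbT; apply/eqP => E; move: E H0; rewrite /g /=.
  move=> /eqP; rewrite paddr_eq0 // !normr_eq0 !subr_eq0 => /andP[/eqP -> /eqP ->].
  by rewrite subrr normr0 leNgt e0.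
exists (g ((x0, t0), (y0, s0)) / 2); first by rewrite divr_gt0.
move=> x t y s hx ht hy hs xy ts; rewrite ltNge; apply/negP => h.
have : g ((x0, t0), (y0, s0)) <= g ((x, t), (y, s)).
  by apply: Hmin; rewrite inE; split => //; split; split; rewrite /= in_itv.
by rewrite {2}/g /=; lra.
Qed.

Lemma cont_section1 (R : realType) (f : R * R -> R) (t : R) :
  continuous f -> continuous (fun x => f (x, t)).
Proof.
move=> cf x; apply: (@continuous_comp _ _ _ (fun x => (x, t)) f); last exact: cf.
by apply: cont_pair => y; [exact: cvg_id|exact: cvg_cst].
Qed.

Lemma cont_section2 (R : realType) (f : R * R -> R) (x : R) :
  continuous f -> continuous (fun t => f (x, t)).
Proof.
move=> cf t; apply: (@continuous_comp _ _ _ (fun t => (x, t)) f); last exact: cf.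
by apply: cont_pair => y; [exact: cvg_cst|exact: cvg_id].
Qed.

Lemma cont_epsP (R : realType) (f : R -> R) : 
  (forall x e, 0 < e -> exists2 d, 0 < d & forall y, `|y - x| < d -> `|f y - f x| < e) ->
  continuous f.
Proof.
move=> H x; apply/cvgrPdist_lt => e e0; have [d d0 Hd] := H x e e0.
exists d => //= y; rewrite /ball_ /= distrC => yx; rewrite distrC; exact: Hd.
Qed.

Lemma cont_epsP2 (R : realType) (f : R * R -> R) :
  (forall (x t e : R), 0 < e -> exists2 d, 0 < d & forall y s : R,
     `|y - x| < d -> `|s - t| < d -> `|f (y, s) - f (x, t)| < e) ->
  continuous f.
Proof.
move=> H [x t]; apply/cvgrPdist_lt => e e0; have [d d0 Hd] := H x t e e0.
exists (ball x d, ball t d); first by split; apply: nbhsx_ballx.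
move=> [y s] [/=]; rewrite /ball /= distrC => yx; rewrite distrC => st.
by rewrite distrC; exact: Hd.
Qed.

Lemma clamp_lo (R : realType) (a b x : R) : a <= b -> x <= a -> clamp a b x = a.
Proof. by move=> ab xa; rewrite /clamp max_l // ge_min xa. Qed.

Lemma clamp_hi (R : realType) (a b x : R) : a <= b -> b <= x -> clamp a b x = b.
Proof. by move=> ab xa; rewrite /clamp min_r // max_r. Qed.

Lemma clamp_lip (R : realType) (a b x y : R) : a <= b ->
  `|clamp a b y - clamp a b x| <= `|y - x|.
Proof.
move=> ab; wlog yx : x y / x <= y.
  move=> H; have [|/ltW] := leP x y; first exact: H.
  by move=> /H; rewrite distrC (distrC x).
rewrite [leRHS]ger0_norm ?subr_ge0 // /clamp.
rewrite ler_norml !maxEle !minEle.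
by case: (leP x b) => ?; case: (leP y b) => ?; case: (leP a x) => ?;
  case: (leP a y) => ?; case: (leP a b) => ?; lra.
Qed.

Lemma clamp_continuous_in (R : realType) (a b : R) (f : R -> R) : a <= b ->
  (forall x, a <= x <= b -> forall e, 0 < e -> exists2 d, 0 < d &
    forall y, a <= y <= b -> `|y - x| < d -> `|f y - f x| < e) ->
  continuous (fun x => f (clamp a b x)).
Proof.
move=> ab H; apply: cont_epsP => x e e0.
have [d d0 Hd] := H _ (clamp_in x ab) e e0; exists d => // y yx.
apply: Hd; first exact: clamp_in.
by apply: le_lt_trans yx; exact: clamp_lip.
Qed.

Lemma clamp2_id (R : realType) (T x t : R) : 0 <= x <= 1 -> 0 <= t <= T ->
  clamp2 0 T (x, t) = (x, t).
Proof. by move=> x01 tT; rewrite /clamp2 /= !clamp_id. Qed.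

Lemma cont_clamp2_setT (R : realType) (T : R) (f : R * R -> R) : 0 <= T ->
  {within `[0, 1] `*` [set: R], continuous f} -> continuous (f \o clamp2 0 T).
Proof.
move=> T0; apply: within_comp; first exact: clamp2_cont.
by move=> x; split => //; rewrite /= in_itv /=; exact: clamp_in.
Qed.

Lemma family_min (R : realType) (K : finType) (dom : K -> set (R * R)) (F : K -> R * R -> R) :
  (forall k, compact (dom k)) -> (forall k, continuous (F k)) -> (exists k, dom k !=set0) ->
  exists k z, dom k z /\ forall k' z', dom k' z' -> F k z <= F k' z'.
Proof.
move=> cd cF [k0 d0].
have ex k : exists z, dom k !=set0 -> dom k z /\ forall z', dom k z' -> F k z <= F k z'.
  have [ne|e] := pselect (dom k !=set0); last by exists (0, 0).
  have [z] := compact_EVT_min ne (cd k) (continuous_subspaceT (cF k)).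
  rewrite inE => dz Hz; exists z => _; split=> // z' dz'; apply: Hz.
  by rewrite inE.
have [z Hz] := choice ex.
have h0 : `[< dom k0 !=set0 >] by apply/asboolP.
case: (@arg_minP _ _ _ k0 (fun k => `[< dom k !=set0 >]) (fun k => F k (z k)) h0) => k /asboolP ne min.
exists k, (z k); have [dz _] := Hz k ne; split=> // k' z' dz'.
have ne' : dom k' !=set0 by exists z'.
by have [_ h] := Hz k' ne'; apply: le_trans (h _ dz'); apply: min; apply/asboolP.
Qed.

(** * Integrals over segments *)

Definition seg_int (R : realType) (a b : R) (f : R -> R) : R :=
  \int[@lebesgue_measure R]_(x in `[a, b]) f x.

Section SegInt.
Context (R : realType).
Implicit Types (f g : R -> R) (a b c : R).

Lemma seg_integrable f a b : continuous f ->
  (@lebesgue_measure R).-integrable `[a, b] (EFin \o f).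
Proof.
move=> cf; apply: continuous_compact_integrable; first exact: segment_compact.
exact: continuous_subspaceT.
Qed.

Lemma seg_intD f g a b : continuous f -> continuous g ->
  seg_int a b (fun x => f x + g x) = seg_int a b f + seg_int a b g.
Proof. by move=> cf cg; apply: RintegralD => //; exact: seg_integrable. Qed.

Lemma seg_intB f g a b : continuous f -> continuous g ->
  seg_int a b (fun x => f x - g x) = seg_int a b f - seg_int a b g.
Proof. by move=> cf cg; apply: RintegralB => //; exact: seg_integrable. Qed.

Lemma seg_intZ f a b c : continuous f ->
  seg_int a b (fun x => c * f x) = c * seg_int a b f.
Proof. by move=> cf; apply: RintegralZl => //; exact: seg_integrable. Qed.

Lemma seg_int_ext f g a b : (forall x, a <= x <= b -> f x = g x) ->
  seg_int a b f = seg_int a b g.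
Proof.
by move=> fg; apply: eq_Rintegral => x; rewrite inE /= in_itv /=; exact: fg.
Qed.

Lemma seg_int_cst a b c : a <= b -> seg_int a b (fun=> c) = c * (b - a).
Proof.
move=> ab; rewrite /seg_int Rintegral_cst //; congr (_ * _).
rewrite -[RHS]/(fine (b - a)%:E); congr fine.
apply: etrans (@lebesgue_measure_itv R `[a, b]) _; rewrite /= lte_fin.
by case: ltP => h; rewrite // (_ : b = a) ?subrr //; apply/le_anti; rewrite h ab.
Qed.

Lemma seg_int_le f g a b : continuous f -> continuous g ->
  (forall x, a <= x <= b -> f x <= g x) -> seg_int a b f <= seg_int a b g.
Proof.
move=> cf cg fg; apply: le_Rintegral => //; exact: seg_integrable.
Qed.

Lemma seg_int_abs f a b c : a <= b -> continuous f ->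
  (forall x, a <= x <= b -> `|f x| <= c) -> `|seg_int a b f| <= c * (b - a).
Proof.
move=> ab cf H; rewrite -seg_int_cst // ler_norml -mulN1r -seg_intZ; last exact: cst_continuous.
apply/andP; split; apply: seg_int_le => //; try exact: cst_continuous.
  by move=> x /H; rewrite ler_norml => /andP[]; lra.
by move=> x /H; rewrite ler_norml => /andP[].
Qed.

Lemma seg_int_split f a b c : a <= b -> b <= c -> continuous f ->
  seg_int a c f = seg_int a b f + seg_int b c f.
Proof.
move=> ab bc cf; apply/eqP; rewrite addrC -subr_eq; apply/eqP.
have h := @Rintegral_itvB R f (BLeft a) (BRight c) b (@seg_integrable f a c cf) ab bc.
rewrite /seg_int h Rintegral_itv_obnd_cbnd //.
by apply: integrableS (@seg_integrable f b c cf) => //; exact: subset_itv_oc_cc.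
Qed.

Lemma seg_int_point f a : seg_int a a f = 0.
Proof. by rewrite /seg_int set_itv1 Rintegral_set1. Qed.

Lemma seg_int_osc f a b c e : a <= b -> continuous f ->
  (forall x, a <= x <= b -> `|f x - c| <= e) ->
  `|seg_int a b f - c * (b - a)| <= e * (b - a).
Proof.
move=> ab cf H; rewrite -seg_int_cst // -seg_intB //; last exact: cst_continuous.
by apply: seg_int_abs => // x; apply: cvgB; [exact: cf|exact: cvg_cst].
Qed.

Lemma seg_int_der f a b t : a <= t <= b -> continuous f ->
  has_der `[a, b] (fun s => seg_int a s f) t (f t).
Proof.
move=> tab cf e e0; have /cvgrPdist_le /(_ e e0) [d /= d0 Hd] := cf t.
have {}Hd s : `|s - t| < d -> `|f s - f t| <= e.
  by move=> h; rewrite distrC; apply: Hd; rewrite /ball_ /= distrC.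
exists d => // s; rewrite /= in_itv /= => sab st.
have [ts|st'] := leP t s.
  have E := @seg_int_split f a t s; rewrite E //; last lra.
  rewrite [`|s - t|]ger0_norm ?subr_ge0 // (addrC (seg_int a t f)) addrK.
  apply: seg_int_osc => // x xts; apply: Hd; rewrite ger0_norm; last lra.
  by apply: le_lt_trans st; rewrite ger0_norm; lra.
have E := @seg_int_split f a s t; rewrite E; [|lra|lra|exact: cf].
rewrite opprD addrA subrr add0r.
have -> : - seg_int s t f - f t * (s - t) = - (seg_int s t f - f t * (t - s)) by ring.
rewrite normrN [`|s - t|]ltr0_norm ?subr_lt0 // opprB.
apply: seg_int_osc => //; first exact: ltW.
move=> x xts; apply: Hd; rewrite ler0_norm; last lra.
by apply: le_lt_trans st; rewrite ltr0_norm; lra.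
Qed.
End SegInt.

(** The derivative of [seg_int a t f' - f t] vanishes, so the mean value
    inequality shows that this function is constant. *)
Lemma FTC2_der (R : realType) (f f' : R -> R) (a b : R) : a <= b -> continuous f' ->
  (forall s, a <= s <= b -> has_der `[a, b] f s (f' s)) ->
  seg_int a b f' = f b - f a.
Proof.
move=> ab cf df.
have h : `|(seg_int a b f' - f b) - (seg_int a a f' - f a)| <= 0 * (b - a).
  apply: (@mean_value_abs _ (fun t => seg_int a t f' - f t) (fun t => f' t - f' t)) => //.
    by move=> s sab; apply: has_derB; [exact: seg_int_der|exact: df].
  by move=> s _; rewrite subrr normr0.
move: h; rewrite mul0r normr_le0 subr_eq0 seg_int_point sub0r => /eqP; lra.
Qed.

(** * Iterated integrals on the parabolic rectangle *)

Section Product.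
Context (R : realType).

(** A continuous function of two variables is the pointwise limit of functions
    that are step functions of the first variable, and these are measurable for
    the product of the two sigma-algebras. *)
Lemma cont_measurable2 (f : R * R -> R) : continuous f ->
  measurable_fun (`[0, +oo[ `*` setT : set (measurableTypeR R * measurableTypeR R)) f.
Proof.
move=> cf.
pose h (n : nat) (z : measurableTypeR R * measurableTypeR R) : R :=
  f ((Num.truncn (n.+1%:R * z.1))%:R / n.+1%:R, z.2).
apply: (@measurable_fun_cvg _ _ _ _ h).
  move=> n.
  pose E (i : nat) : set (measurableTypeR R * measurableTypeR R) :=
    `[i%:R / n.+1%:R, i.+1%:R / n.+1%:R[ `*` setT.
  have mE i : measurable (E i) by apply: measurableX => //; exact: measurable_itv.
  have n0 : 0 < n.+1%:R :> R by rewrite ltr0n.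
  have -> : `[0, +oo[ `*` setT = \bigcup_i E i.
    apply/seteqP; split=> [[x t] /= []|[x t] [i _] [] /=].
      rewrite in_itv /= andbT => x0 _; exists (Num.truncn (n.+1%:R * x)) => //.
      split => //=; rewrite in_itv /= ler_pdivrMr // ltr_pdivlMr // mulrC.
      by apply: truncn_itv; rewrite mulr_ge0 // ltW.
    rewrite !in_itv /= andbT => /andP[ix _] _; split => //.
    by apply: le_trans ix; rewrite divr_ge0.
  apply/measurable_fun_bigcup => // i.
  apply: (@eq_measurable_fun _ _ _ _ _ (fun z => f (i%:R / n.+1%:R, z.2))).
    move=> [x t]; rewrite inE => -[/=]; rewrite in_itv /= => /andP[h1 h2] _.
    rewrite /h /=; congr (f (_%:R / _, _)); apply/esym/truncn_def.
    by rewrite mulrC -ler_pdivrMr // h1 -ltr_pdivlMr.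
  apply: (@measurable_funS _ _ _ _ setT) => //.
  apply: (@measurableT_comp _ _ _ _ _ _ (fun t : measurableTypeR R => f (i%:R / n.+1%:R, t))).
    by apply: continuous_measurable_fun; exact: cont_section2.
  exact: measurable_snd.
move=> [x t] [/=]; rewrite in_itv /= andbT => x0 _.
rewrite /h /=.
suff H : (Num.truncn (n.+1%:R * x))%:R / n.+1%:R @[n --> \oo] --> x.
  exact: (cvg_comp _ (fun y => f (y, t)) H (@cont_section1 _ f t cf x)).
apply/cvgrPdist_le => e e0.
near=> n.
have n0 : 0 < n.+1%:R :> R by rewrite ltr0n.
have nx : 0 <= n.+1%:R * x by rewrite mulr_ge0.
have /andP[h1 h2] := truncn_itv nx.
have E : x = n.+1%:R * x / n.+1%:R by field; rewrite gt_eqF.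
have hn : n.+1%:R^-1 < e by near: n; exact: (near_infty_natSinv_lt (PosNum e0)).
rewrite {1}E -mulrBl normrM ger0_norm ?subr_ge0 // ger0_norm ?invr_ge0 ?ltW //.
apply: le_lt_trans hn.
rewrite ler_piMl ?invr_ge0 ?(ltW n0) //.
by move: h2; rewrite -natr1; lra.
Unshelve. all: by end_near.
Qed.

Lemma leb2_finite (T : R) : 0 < T -> (leb2 R (Qopen T) < +oo)%E.
Proof.
move=> T0; rewrite /Qopen product_measure1E //.
rewrite [X in (X < _)%E](_ : _ = (1 - 0)%:E * (T - 0)%:E)%E; last first.
  congr (_ * _)%E.
    by apply: etrans (@lebesgue_measure_itv R `]0, 1[) _; rewrite /= lte_fin ltr01.
  by apply: etrans (@lebesgue_measure_itv R `]0, T[) _; rewrite /= lte_fin T0.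
by rewrite -EFinM ltry.
Qed.

Lemma measurable_Qopen (T : R) :
  measurable (Qopen T : set (measurableTypeR R * measurableTypeR R)).
Proof. by apply: measurableX; exact: measurable_itv. Qed.

Lemma Qopen_measurable_fun (T : R) (f : R * R -> R) : continuous f ->
  measurable_fun (Qopen T : set (measurableTypeR R * measurableTypeR R)) f.
Proof.
move=> cf; apply: measurable_funS (cont_measurable2 cf).
  by apply: measurableX => //; exact: measurable_itv.
move=> [x t] [/=]; rewrite !in_itv /= => /andP[/ltW x0 _] _; split => //=.
by rewrite x0.
Qed.

Lemma Qopen_bounded (T : R) (f : R * R -> R) : continuous f ->
  exists2 B, 0 < B & forall z, Qopen T z -> `|f z| <= B.
Proof.
move=> cf; have [B B0 H] := @bounded2 _ f 0 1 0 T cf; exists B => // -[x t] [/=].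
rewrite !in_itv /= => /andP[/ltW ? /ltW ?] /andP[/ltW ? /ltW ?]; apply: H; lra.
Qed.

Lemma Qopen_integrable (T : R) (f : R * R -> R) : 0 < T -> continuous f ->
  (leb2 R).-integrable (Qopen T) (EFin \o f).
Proof.
move=> T0 cf; apply: measurable_bounded_integrable.
- exact: measurable_Qopen.
- exact: leb2_finite.
- exact: Qopen_measurable_fun.
have [B B0 H] := Qopen_bounded T cf.
by exists B; split; rewrite ?num_real // => y By z /H h; apply: le_trans h (ltW By).
Qed.

Lemma Rintegral_oo (f : R -> R) (a b : R) : continuous f ->
  \int[@lebesgue_measure R]_(x in `]a, b[) f x = seg_int a b f.
Proof.
move=> cf; rewrite /seg_int; have i := @seg_integrable R f a b cf.
rewrite Rintegral_itv_obnd_cbnd; last first.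
  by apply: integrableS i => //; exact: subset_itv_oo_cc.
rewrite Rintegral_itv_bndo_bndc //.
by apply: integrableS i => //; exact: subset_itv_co_cc.
Qed.

Lemma integral_ooE (f : R -> R) (a b : R) : continuous f ->
  (\int[@lebesgue_measure R]_(x in `]a, b[) (f x)%:E = (seg_int a b f)%:E)%E.
Proof.
move=> cf; rewrite -Rintegral_oo // /Rintegral fineK //.
apply: integrable_fin_num => //.
apply: (integrableS _ _ _ (@seg_integrable R f a b cf)) => //.
exact: subset_itv_oo_cc.
Qed.

Lemma seg_int_param_cont (f : R * R -> R) (a b c d : R) : c <= d -> continuous f ->
  forall x, a <= x <= b -> forall e, 0 < e -> exists2 r, 0 < r & forall y,
    a <= y <= b -> `|y - x| < r ->
    `|seg_int c d (fun t => f (y, t)) - seg_int c d (fun t => f (x, t))| <= e.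
Proof.
move=> cd cf x xab e e0.
have e1 : 0 < e / (d - c + 1) by rewrite divr_gt0 //; lra.
have [r r0 H] := @ucont2 _ f a b c d cf _ e1; exists r => // y yab yx.
rewrite -seg_intB; [|exact: cont_section2|exact: cont_section2].
apply: (@le_trans _ _ (e / (d - c + 1) * (d - c))).
  apply: seg_int_abs => //.
    by move=> t; apply: cvgB; exact: cont_section2.
  by move=> t tcd; apply/ltW/H; rewrite ?subrr ?normr0.
by rewrite mulrAC ler_pdivrMr; [rewrite ler_wpM2l ?ltW //; lra|lra].
Qed.

Lemma seg_int_param_continuous (f : R * R -> R) (c d : R) : c <= d -> continuous f ->
  continuous (fun x => seg_int c d (fun t => f (x, t))).
Proof.
move=> cd cf; apply: cont_epsP => x e e0.
have e2 : 0 < e / 2 by lra.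
have xx : x - 1 <= x <= x + 1 by lra.
have [r r0 H] := @seg_int_param_cont f (x - 1) (x + 1) c d cd cf x xx _ e2.
exists (Num.min r 1); first by rewrite lt_min r0 ltr01.
move=> y; rewrite lt_min => /andP[yr y1].
have /(_ _ yr) h := H y; apply: le_lt_trans (h _) _; last lra.
by move: y1; rewrite ltr_norml; lra.
Qed.

Definition swap (z : R * R) : R * R := (z.2, z.1).

Lemma swap_cont (f : R * R -> R) : continuous f -> continuous (f \o swap).
Proof.
move=> cf z; apply: continuous_comp; last exact: cf.
by apply: cont_pair => w; [exact: cvg_snd|exact: cvg_fst].
Qed.

(** Fubini's theorem for a bounded function on a set of finite measure. *)
Lemma Qopen_int1 (T : R) (f : R * R -> R) : 0 < T -> continuous f ->
  \int[leb2 R]_(z in Qopen T) f z =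
    seg_int 0 1 (fun x => seg_int 0 T (fun t => f (x, t))).
Proof.
move=> T0 cf; have iQ := Qopen_integrable T0 cf.
rewrite -Rintegral_oo; last by apply: seg_int_param_continuous => //; exact: ltW.
have i1 : (leb2 R).-integrable setT (EFin \o (f \_ (Qopen T))).
  by rewrite -restrict_EFin; exact: (integrable_mkcond _ (measurable_Qopen T)).1.
transitivity (\int[leb2 R]_z (f \_ (Qopen T)) z); first exact: Rintegral_mkcond.
rewrite /Rintegral; congr fine.
apply: etrans (esym (integral12_prod_meas1 i1)) _.
rewrite [RHS]integral_mkcond; apply: eq_integral => x _.
rewrite patchE; case: ifPn => xin.
  rewrite -integral_ooE; last exact: cont_section2.
  rewrite integral_mkcond; apply: eq_integral => t _ /=; rewrite !patchE.
  have -> : ((x, t) \in Qopen T) = (t \in `]0, T[%classic).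
    rewrite /Qopen; apply/idP/idP; rewrite !inE; first by case.
    by move=> ht; split => //; move: xin; rewrite inE.
  by case: ifP.
apply: integral0_eq => t _ /=; rewrite patchE.
case: ifPn => //; rewrite inE /Qopen => -[/= hx _].
by move: xin; rewrite notin_setE.
Qed.

Lemma Qopen_int2 (T : R) (f : R * R -> R) : 0 < T -> continuous f ->
  \int[leb2 R]_(z in Qopen T) f z =
    seg_int 0 T (fun t => seg_int 0 1 (fun x => f (x, t))).
Proof.
move=> T0 cf; have iQ := Qopen_integrable T0 cf.
rewrite -Rintegral_oo; last first.
  by apply: (@seg_int_param_continuous (f \o swap) 0 1) => //; exact: swap_cont.
have i1 : (leb2 R).-integrable setT (EFin \o (f \_ (Qopen T))).
  by rewrite -restrict_EFin; exact: (integrable_mkcond _ (measurable_Qopen T)).1.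
transitivity (\int[leb2 R]_z (f \_ (Qopen T)) z); first exact: Rintegral_mkcond.
rewrite /Rintegral; congr fine.
apply: etrans (esym (integral21_prod_meas1 i1)) _.
rewrite [RHS]integral_mkcond; apply: eq_integral => t _.
rewrite patchE; case: ifPn => tin.
  rewrite -integral_ooE; last exact: cont_section1.
  rewrite integral_mkcond; apply: eq_integral => x _ /=; rewrite !patchE.
  have -> : ((x, t) \in Qopen T) = (x \in `]0, 1[%classic).
    rewrite /Qopen; apply/idP/idP; rewrite !inE; first by case.
    by move=> ht; split => //; move: tin; rewrite inE.
  by case: ifP.
apply: integral0_eq => x _ /=; rewrite patchE.
case: ifPn => //; rewrite inE /Qopen => -[/= _ hx].
by move: tin; rewrite notin_setE.
Qed.

End Product.

(** * The lemma of du Bois-Reymond *)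

Definition C1_bump (R : realType) (lo hi : R) (b b' : R -> R) : Prop :=
  [/\ forall x, has_der [set: R] b x (b' x), continuous b' &
    exists c d, [/\ lo < c, d < hi & forall x, b x != 0 -> c <= x <= d]].

Lemma C1_bump_cont (R : realType) (lo hi : R) (b b' : R -> R) :
  C1_bump lo hi b b' -> continuous b.
Proof.
move=> [db _ _]; apply: cont_epsP => x e e0; have [d d0 Hd] := has_der_cont (db x) e0.
by exists d => // y; exact: Hd.
Qed.

Lemma C1_bump_lo (R : realType) (lo hi : R) (b b' : R -> R) :
  C1_bump lo hi b b' -> b lo = 0.
Proof.
by move=> [_ _ [c [d [lc dh H]]]]; apply/eqP; apply: contraT => /H; lra.
Qed.

Lemma C1_bump_hi (R : realType) (lo hi : R) (b b' : R -> R) :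
  C1_bump lo hi b b' -> b hi = 0.
Proof.
by move=> [_ _ [c [d [lc dh H]]]]; apply/eqP; apply: contraT => /H; lra.
Qed.

Definition pos_part (R : realType) (u : R) : R := Num.max u 0.
Definition pos_sqr (R : realType) (u : R) : R := pos_part u ^+ 2.

Lemma pos_sqr_der (R : realType) (u : R) :
  has_der [set: R] (@pos_sqr R) u (2 * pos_part u).
Proof.
move=> e e0; exists e => // y _ ye.
apply: (@le_trans _ _ (`|y - u| * `|y - u|)); last by rewrite ler_wpM2r // ltW.
rewrite -normrM ger0_norm -?expr2 ?sqr_ge0 // /pos_sqr /pos_part expr2.
have yy : 0 <= y * y by rewrite -expr2 sqr_ge0.
have uu : 0 <= u * u by rewrite -expr2 sqr_ge0.
have yu : 0 <= (y - u) * (y - u) by rewrite -expr2 sqr_ge0.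
rewrite ler_norml; case: (leP u 0) => u0; case: (leP y 0) => y0.
- lra.
- have : 0 <= y * - u by rewrite mulr_ge0 ?oppr_ge0 // ltW.
  lra.
- have : 0 <= u * - y by rewrite mulr_ge0 ?oppr_ge0 // ltW.
  lra.
- lra.
Qed.

Definition hat (R : realType) (s d x : R) : R :=
  pos_part (x - s + d) - 2 * pos_part (x - s) + pos_part (x - s - d).
(** A function that rises from 0 to a constant on [[s - d, s + d]]; its
    derivative is twice the tent function [hat]. *)
Definition ramp (R : realType) (s d x : R) : R :=
  pos_sqr (x - s + d) - 2 * pos_sqr (x - s) + pos_sqr (x - s - d).

Lemma ramp_der (R : realType) (s d x : R) :
  has_der [set: R] (ramp s d) x (2 * hat s d x).
Proof.
have sh c : has_der [set: R] (fun y => pos_sqr (y - c)) x (2 * pos_part (x - c)).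
  apply: (@has_der_eq _ _ _ _ (2 * pos_part (x - c) * (1 - 0))); first by ring.
  apply: (@has_der_comp _ _ (fun y => y - c)); last exact: pos_sqr_der.
  by apply: has_derB; [exact: has_der_id|exact: has_der_cst].
have E1 y : y - s + d = y - (s - d) by ring.
have E2 y : y - s - d = y - (s + d) by ring.
apply: (@has_der_eq _ _ _ _
  (2 * pos_part (x - (s - d)) - 2 * (2 * pos_part (x - s)) + 2 * pos_part (x - (s + d)))).
  by rewrite /hat E1 E2; ring.
apply: (@has_der_ext _ _ (fun y => pos_sqr (y - (s - d)) - 2 * pos_sqr (y - s) + pos_sqr (y - (s + d)))) => //.
  by move=> y _; rewrite /ramp E1 E2.
by apply: has_derD; [apply: has_derB; [|apply: has_derZ]|].
Qed.

Lemma hat_continuous (R : realType) (s d : R) : continuous (hat s d).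
Proof.
have h c : continuous (fun x : R => pos_part (x - c)).
  move=> x; apply: (@continuous_max _ _ (fun y => y - c) (fun=> 0)); last exact: cvg_cst.
  by apply: cvgB; [exact: cvg_id|exact: cvg_cst].
have E1 y : y - s + d = y - (s - d) by ring.
have E2 y : y - s - d = y - (s + d) by ring.
rewrite (_ : hat s d = fun x => pos_part (x - (s - d)) - 2 * pos_part (x - s) + pos_part (x - (s + d))); last first.
  by apply/funext => x; rewrite /hat E1 E2.
move=> x; apply: cvgD; last exact: h.
by apply: cvgB; [exact: h|apply: cvgM; [exact: cvg_cst|exact: h]].
Qed.

Lemma hat_ge0 (R : realType) (s d x : R) : 0 <= d -> 0 <= hat s d x.
Proof.
move=> d0; rewrite /hat /pos_part.
by case: (leP (x - s + d) 0) => ?; case: (leP (x - s) 0) => ?; case: (leP (x - s - d) 0) => ?; lra.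
Qed.

Lemma hat_out (R : realType) (s d x : R) : 0 <= d -> d <= `|x - s| -> hat s d x = 0.
Proof.
move=> d0; rewrite /hat /pos_part; case: (ger0P (x - s)) => h1 h2;
case: (leP (x - s + d) 0) => ?; case: (leP (x - s) 0) => ?; case: (leP (x - s - d) 0) => ?; lra.
Qed.

Lemma ramp_left (R : realType) (s d x : R) : 0 <= d -> x <= s - d -> ramp s d x = 0.
Proof. by move=> d0 h; rewrite /ramp /pos_sqr /pos_part !max_r; [ring|lra|lra|lra]. Qed.

Lemma ramp_right (R : realType) (s d x : R) : 0 <= d -> s + d <= x -> ramp s d x = 2 * d ^+ 2.
Proof. by move=> d0 h; rewrite /ramp /pos_sqr /pos_part !max_l; [ring|lra|lra|lra]. Qed.

(** Test with the difference of two ramps, whose derivative is a tent at [s]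
    minus a tent at [t]: if [G s > G t], the integral is positive. *)
Lemma du_Bois_open_le (R : realType) (lo hi : R) (G : R -> R) (s t : R) :
  continuous G ->
  (forall b b', C1_bump lo hi b b' -> seg_int lo hi (fun x => G x * b' x) = 0) ->
  lo < s -> s < t -> t < hi -> G s <= G t.
Proof.
move=> cG H los st thi; rewrite leNgt; apply/negP => Gst.
pose e := (G s - G t) / 4; pose m := (G s + G t) / 2.
have e0 : 0 < e by rewrite /e; lra.
have /cvgrPdist_lt /(_ e e0) [d1 /= d10 H1] := cG s.
have /cvgrPdist_lt /(_ e e0) [d2 /= d20 H2] := cG t.
have {}H1 x : `|x - s| < d1 -> G s - e < G x < G s + e.
  by rewrite distrC => /H1; rewrite ltr_norml; lra.
have {}H2 x : `|x - t| < d2 -> G t - e < G x < G t + e.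
  by rewrite distrC => /H2; rewrite ltr_norml; lra.
have [|d d0 /= /and5P[/ltW dd1 /ltW dd2 /ltW dd3 /ltW dd4 /andP[/ltW dd5 _]]] :=
    @exists_below _ [:: d1; d2; (t - s) / 3; (s - lo) / 2; (hi - t) / 2].
  by rewrite /= d10 d20 !divr_gt0 ?subr_gt0.
(* the two tents are disjoint, and [G] is above its middle value on the first
   one and below it on the second *)
pose b x := ramp s d x - ramp t d x.
pose b' x := 2 * hat s d x - 2 * hat t d x.
have cb' : continuous b'.
  by move=> x; apply: cvgB; (apply: cvgM; [exact: cvg_cst|exact: hat_continuous]).
have db x : has_der [set: R] b x (b' x) by apply: has_derB; exact: ramp_der.
have hb : C1_bump lo hi b b'.
  split => //; exists (s - d), (t + d); split; [move: dd4 los|move: dd5 thi|]; try by clear; lra.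
  move=> x; apply: contra_neqT; rewrite negb_and -!ltNge => /orP[h|h]; rewrite /b.
    by rewrite !ramp_left ?subrr //; move: h d0 dd3 st; clear; lra.
  by rewrite !ramp_right ?subrr //; move: h d0 dd3 st; clear; lra.
have ab : lo <= hi by lra.
have I1 := H b b' hb.
have I2 : seg_int lo hi b' = 0.
  rewrite (@FTC2_der _ b) // ?(C1_bump_hi hb) ?(C1_bump_lo hb) ?subrr //.
  by move=> x _; exact: has_der_subset (db x).
have I3 : seg_int lo hi (fun x => 2 * hat s d x) = 2 * d ^+ 2.
  rewrite (@FTC2_der _ (ramp s d)) //.
  - by rewrite ramp_right ?ramp_left; [ring|move: d0 dd3 dd4 dd5 st los thi; clear; lra ..].
  - by move=> x; apply: cvgM; [exact: cvg_cst|exact: hat_continuous].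
  - by move=> x _; exact: has_der_subset (@ramp_der _ s d x).
have cGb : continuous (fun x => G x * b' x).
  by move=> x; apply: cvgM; [exact: cG|exact: cb'].
have cmb : continuous (fun x => m * b' x).
  by move=> x; apply: cvgM; [exact: cvg_cst|exact: cb'].
have ch : continuous (fun x => 2 * hat s d x).
  by move=> x; apply: cvgM; [exact: cvg_cst|exact: hat_continuous].
have : seg_int lo hi (fun x => e * (2 * hat s d x)) <=
       seg_int lo hi (fun x => G x * b' x - m * b' x).
  apply: seg_int_le.
  - by move=> x; apply: cvgM; [exact: cvg_cst|exact: ch].
  - by move=> x; apply: cvgB; [exact: cGb|exact: cmb].
  move=> x _; rewrite -mulrBl /b'.
  have hs := @hat_ge0 _ s d x (ltW d0); have ht := @hat_ge0 _ t d x (ltW d0).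
  have [xs|xs] := ltP `|x - s| d.
    have -> : hat t d x = 0.
      apply: hat_out; first exact: ltW.
      by move: xs dd3 d0; rewrite ltr_norml ler_normr; clear; lra.
    have := H1 x (lt_le_trans xs dd1) => /andP[h _].
    have : e <= G x - m by move: h; rewrite /e /m; clear; lra.
    by move=> h'; rewrite mulr0 subr0 ler_wpM2r // mulr_ge0.
  rewrite (hat_out _ xs) ?(ltW d0) // !mulr0 sub0r.
  have [xt|xt] := ltP `|x - t| d.
    have := H2 x (lt_le_trans xt dd2) => /andP[_ h].
    have : G x - m <= 0 by move: h Gst; rewrite /e /m; clear; lra.
    by move=> h'; have := mulr_le0_ge0 h' ht; clear; lra.
  by rewrite (hat_out _ xt) ?(ltW d0) // !mulr0 oppr0 mulr0.
rewrite seg_intB // (seg_intZ _ _ _ cb') (seg_intZ _ _ _ ch).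
rewrite I1 I2 I3 mulr0 subr0; have : 0 < e * (2 * d ^+ 2) by apply: mulr_gt0 => //; apply: mulr_gt0 => //; exact: exprn_gt0.
lra.
Qed.

(** Equality inside follows by applying the previous lemma to [G] and to [- G],
    and extends to the end points by continuity. *)
Lemma du_Bois_closed (R : realType) (lo hi : R) (G : R -> R) (s t : R) :
  lo < hi -> continuous G ->
  (forall b b', C1_bump lo hi b b' -> seg_int lo hi (fun x => G x * b' x) = 0) ->
  lo <= s <= hi -> lo <= t <= hi -> G s = G t.
Proof.
move=> lohi cG H.
have cN : continuous (fun x => - G x) by move=> x; apply: cvgN; exact: cG.
have HN b b' : C1_bump lo hi b b' -> seg_int lo hi (fun x => - G x * b' x) = 0.
  move=> hb; rewrite (@seg_int_ext _ _ (fun x => -1 * (G x * b' x))).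
    rewrite seg_intZ ?(H _ _ hb) ?mulr0 //.
    by case: hb => _ cb _ x; apply: cvgM; [exact: cG|exact: cb].
  by move=> x _; ring.
have op x y : lo < x -> x < y -> y < hi -> G x = G y.
  move=> h1 h2 h3; apply/le_anti; rewrite (du_Bois_open_le cG H) //=.
  by have := du_Bois_open_le cN HN h1 h2 h3; rewrite lerN2.
(* all values are compared with the one at the middle, since [s] and [t] may be
   end points *)
pose mid := (lo + hi) / 2.
have opm x : lo < x < hi -> G x = G mid.
  move=> hx; have [h|h|->//] := ltgtP x mid.
    by apply: op => //; rewrite /mid; lra.
  by apply/esym/op => //; rewrite /mid; lra.
suff cl x : lo <= x <= hi -> G x = G mid by move=> /cl -> /cl ->.
move=> hx; apply/eqP; rewrite -subr_eq0 -normr_eq0; apply: contraT => ne.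
have e0 : 0 < `|G x - G mid| by rewrite lt_neqAle eq_sym ne normr_ge0.
have /cvgrPdist_lt /(_ _ e0) [d /= d0 Hd] := cG x.
have [y [hy yx]] : exists y, lo < y < hi /\ `|x - y| < d.
  have [|k k1 /= /and3P[k2 k3 _]] := @exists_below _ [:: d; (hi - lo) / 4].
    by rewrite /= d0 divr_gt0 // subr_gt0.
  have [xm|xm] := leP x mid.
    by exists (x + k); split; rewrite /mid in xm; [lra|rewrite ltr_norml; lra].
  by exists (x - k); split; rewrite /mid in xm; [lra|rewrite ltr_norml; lra].
have := Hd y yx; rewrite (opm y hy) ltxx //.
Qed.

(** A weak derivative that is continuous is a classical one: subtract a
    primitive of [S] and integrate by parts. *)
Lemma du_Bois_Reymond (R : realType) (lo hi : R) (P S : R -> R) (s t : R) :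
  lo < hi -> continuous P -> continuous S ->
  (forall b b', C1_bump lo hi b b' ->
     seg_int lo hi (fun x => P x * b' x + S x * b x) = 0) ->
  lo <= s -> s <= t -> t <= hi -> P t - P s = seg_int s t S.
Proof.
move=> lohi cP cS H los st thi; have lohi' := ltW lohi.
pose J x := seg_int lo (clamp lo hi x) S.
have cJ : continuous J.
  apply: (@clamp_continuous_in _ lo hi (fun y => seg_int lo y S)) => // x hx e e0.
  have [d d0 Hd] := has_der_cont (seg_int_der hx cS) e0.
  by exists d => // y hy; apply: Hd; rewrite /= in_itv.
have EJ x : lo <= x <= hi -> J x = seg_int lo x S by move=> hx; rewrite /J clamp_id.
have dJ x : lo <= x <= hi -> has_der `[lo, hi] J x (S x).
  move=> hx; apply: (has_der_ext _ _ (seg_int_der hx cS)); first by rewrite /= in_itv.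
  by move=> y; rewrite /= in_itv /= => /EJ.
have E : P s - J s = P t - J t.
  apply: (@du_Bois_closed _ lo hi (fun x => P x - J x)) => //; try lra.
    by move=> x; apply: cvgB; [exact: cP|exact: cJ].
  move=> b b' hb; have cb := C1_bump_cont hb; case: (hb) => db cb' _.
  have c1 : continuous (fun x => P x * b' x + S x * b x).
    by move=> x; apply: cvgD; apply: cvgM; by [exact: cP|exact: cb'|exact: cS|exact: cb].
  have c2 : continuous (fun x => S x * b x + J x * b' x).
    by move=> x; apply: cvgD; apply: cvgM; by [exact: cJ|exact: cb'|exact: cS|exact: cb].
  rewrite (@seg_int_ext _ _ (fun x => (P x * b' x + S x * b x) - (S x * b x + J x * b' x))).
    rewrite seg_intB // (H _ _ hb) (@FTC2_der _ (fun x => J x * b x)) //.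
      by rewrite (C1_bump_hi hb) (C1_bump_lo hb) !mulr0 !subrr.
    move=> x hx; apply: has_derM; first by rewrite /= in_itv.
      exact: dJ.
    exact: has_der_subset (db x).
  by move=> x _; ring.
have := @seg_int_split _ S lo s t los st cS; rewrite -!EJ; lra.
Qed.

(** * From the weak equation to an identity on rectangles *)

Section Tensor.
Context (R : realType).

Lemma tensor_dir1 (a a' b : R -> R) (z : R * R) :
  (forall x, has_der [set: R] a x (a' x)) ->
  derivable (fun z : R * R => a z.1 * b z.2) z (1, 0) /\
  'D_(1, 0) (fun z : R * R => a z.1 * b z.2) z = a' z.1 * b z.2.
Proof.
move=> da; case: z => x t.
have [dx ex] := is_derive_has_der (da x).
have cv : h^-1 *: (a (h *: 1 + x) - a x) @[h --> 0^'] --> a' x by rewrite -ex.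
have H : h^-1 *: ((fun z : R * R => a z.1 * b z.2) (h *: (1, 0) + (x, t)) -
    (fun z : R * R => a z.1 * b z.2) (x, t)) @[h --> 0^'] --> a' x * b t.
  rewrite (_ : (fun h => _) = fun h => (h^-1 *: (a (h *: 1 + x) - a x)) * b t).
    by apply: cvgM => //; exact: cvg_cst.
  apply/funext => h /=; rewrite /GRing.scale /= mulr0 add0r; ring.
by split; [apply/cvg_ex; exists (a' x * b t)|exact: cvg_lim].
Qed.

Lemma tensor_dir2 (a b b' : R -> R) (z : R * R) :
  (forall x, has_der [set: R] b x (b' x)) ->
  derivable (fun z : R * R => a z.1 * b z.2) z (0, 1) /\
  'D_(0, 1) (fun z : R * R => a z.1 * b z.2) z = a z.1 * b' z.2.
Proof.
move=> db; case: z => x t.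
have [dx ex] := is_derive_has_der (db t).
have cv : h^-1 *: (b (h *: 1 + t) - b t) @[h --> 0^'] --> b' t by rewrite -ex.
have H : h^-1 *: ((fun z : R * R => a z.1 * b z.2) (h *: (0, 1) + (x, t)) -
    (fun z : R * R => a z.1 * b z.2) (x, t)) @[h --> 0^'] --> a x * b' t.
  rewrite (_ : (fun h => _) = fun h => a x * (h^-1 *: (b (h *: 1 + t) - b t))).
    by apply: cvgM => //; exact: cvg_cst.
  apply/funext => h /=; rewrite /GRing.scale /= mulr0 add0r; ring.
by split; [apply/cvg_ex; exists (a x * b' t)|exact: cvg_lim].
Qed.

Lemma tensor_continuous (a b : R -> R) : continuous a -> continuous b ->
  continuous (fun z : R * R => a z.1 * b z.2).
Proof.
move=> ca cb z; apply: cvgM.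
  by apply: (@continuous_comp _ _ _ fst a); [exact: cvg_fst|exact: ca].
by apply: (@continuous_comp _ _ _ snd b); [exact: cvg_snd|exact: cb].
Qed.

(** Products of one-dimensional test functions suffice for what follows, since
    only identities between iterated integrals are derived from the weak
    equation. *)
Lemma tensor_test (T : R) (a a' b b' : R -> R) :
  C1_bump 0 1 a a' -> C1_bump 0 T b b' ->
  C1_compact_support (Qopen T) (fun z => a z.1 * b z.2).
Proof.
move=> ha hb; have ca := C1_bump_cont ha; have cb := C1_bump_cont hb.
case: ha => da ca' [c1 [d1 [c10 d11 H1]]]; case: hb => db cb' [c2 [d2 [c20 d21 H2]]].
have K : closure [set z : R * R | a z.1 * b z.2 != 0] `<=` `[c1, d1] `*` `[c2, d2].
  rewrite closureE; apply: smallest_sub.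
    by apply: compact_closed; [exact: norm_hausdorff|exact: box_compact].
  move=> z /=; rewrite mulf_eq0 negb_or => /andP[/H1 ? /H2 ?].
  by split; rewrite /= in_itv.
split.
- by move=> z v [->|->]; [have [] := tensor_dir1 b z da|have [] := tensor_dir2 a z db].
- move=> v [->|->].
    have -> : (fun z => 'D_(1, 0) (fun z0 : R * R => a z0.1 * b z0.2) z) =
      (fun z => a' z.1 * b z.2) by apply/funext => z; have [] := tensor_dir1 b z da.
    exact: tensor_continuous.
  have -> : (fun z => 'D_(0, 1) (fun z0 : R * R => a z0.1 * b z0.2) z) =
    (fun z => a z.1 * b' z.2) by apply/funext => z; have [] := tensor_dir2 a z db.
  exact: tensor_continuous.
- by apply: (subclosed_compact _ (@box_compact _ c1 d1 c2 d2) K); exact: closed_closure.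
move=> z /K [] /=; rewrite !in_itv /= => ? ?; split; rewrite /= in_itv /=; lra.
Qed.

Lemma integrable_Lp (T : R) (g : R * R -> R) : in_all_Lp (Qopen T) g ->
  (leb2 R).-integrable (Qopen T) (EFin \o g).
Proof.
move=> [mg /(_ 1 (lexx 1))]; under eq_fun do rewrite powRr1 //.
move=> /integrableP[_ fin]; apply/integrableP; split; first exact/measurable_EFinP.
apply: le_lt_trans fin; rewrite le_eqVlt; apply/orP; left; apply/eqP.
by apply: eq_integral => z _ /=; rewrite normr_id.
Qed.

Lemma integrable_mul (T : R) (g psi : R * R -> R) :
  (leb2 R).-integrable (Qopen T) (EFin \o g) -> continuous psi ->
  (leb2 R).-integrable (Qopen T) (EFin \o (fun z => g z * psi z)).
Proof.
move=> ig cp; have [B B0 H] := Qopen_bounded T cp.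
apply: (@integrableMl _ _ _ _ _ (@measurable_Qopen R T) (EFin \o g) psi) => //.
  exact: Qopen_measurable_fun.
by exists B; split; rewrite ?num_real // => y By z /H h; apply: le_trans h (ltW By).
Qed.

(** The weak derivatives [g] and [h] disappear: on products they are replaced by
    the continuous functions [u], [p] and [F]. *)
Lemma weak_identity (T : R) (u p F g h : R * R -> R) (a a' b b' : R -> R) :
  0 < T -> continuous u -> continuous p -> continuous F ->
  in_all_Lp (Qopen T) g -> in_all_Lp (Qopen T) h ->
  weak_derivative (Qopen T) (0, 1) u g ->
  weak_derivative (Qopen T) (1, 0) p h ->
  {ae leb2 R, forall z, Qopen T z -> g z - h z = F z} ->
  C1_bump 0 1 a a' -> C1_bump 0 T b b' ->
  \int[leb2 R]_(z in Qopen T) (p z * (a' z.1 * b z.2)) -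
  \int[leb2 R]_(z in Qopen T) (u z * (a z.1 * b' z.2)) =
  \int[leb2 R]_(z in Qopen T) (F z * (a z.1 * b z.2)).
Proof.
move=> T0 cu cp cF /integrable_Lp ig /integrable_Lp ih wg wh ae ha hb.
have ht := tensor_test ha hb.
have := wg _ ht; have := wh _ ht.
have ca := C1_bump_cont ha; have cb := C1_bump_cont hb.
case: ha => da ca' _; case: hb => db cb' _.
have -> : (fun z : R * R => p z * 'D_(1, 0) (fun z0 : R * R => a z0.1 * b z0.2) z) =
    (fun z => p z * (a' z.1 * b z.2)).
  by apply/funext => z; have [_ ->] := tensor_dir1 b z da.
have -> : (fun z : R * R => u z * 'D_(0, 1) (fun z0 : R * R => a z0.1 * b z0.2) z) =
    (fun z => u z * (a z.1 * b' z.2)).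
  by apply/funext => z; have [_ ->] := tensor_dir2 a z db.
move=> -> ->.
pose psi (z : R * R) := a z.1 * b z.2.
have cpsi : continuous psi by exact: tensor_continuous.
have igp := integrable_mul ig cpsi; have ihp := integrable_mul ih cpsi.
rewrite opprK addrC -RintegralB //; last exact: measurable_Qopen.
rewrite /Rintegral; congr fine; apply: ae_eq_integral.
- exact: measurable_Qopen.
- have := integrableB (measurable_Qopen T) igp ihp; case/integrableP => + _.
  by apply: eq_measurable_fun => z _ /=.
- apply/measurable_EFinP; apply: Qopen_measurable_fun.
  by move=> z; apply: cvgM; [exact: cF|exact: cpsi].
apply: negligibleS ae => z /= nz H; apply: nz => Qz; rewrite -(H Qz) /psi.
by congr EFin; ring.
Qed.
End Tensor.

Section Rectangle.
Context (R : realType).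

Lemma seg_int_swap0 (f : R * R -> R) (T : R) : 0 <= T -> continuous f ->
  seg_int 0 T (fun t => seg_int 0 1 (fun x => f (x, t))) =
  seg_int 0 1 (fun x => seg_int 0 T (fun t => f (x, t))).
Proof.
rewrite le_eqVlt => /predU1P[<-|T0] cf; last by rewrite -Qopen_int2 // Qopen_int1.
rewrite seg_int_point (@seg_int_ext _ _ (fun=> 0)).
  by rewrite seg_int_cst ?ler01 // mul0r.
by move=> x _; rewrite seg_int_point.
Qed.

Lemma seg_int_swap (f : R * R -> R) (s t : R) : 0 <= s -> s <= t -> continuous f ->
  seg_int s t (fun r => seg_int 0 1 (fun x => f (x, r))) =
  seg_int 0 1 (fun x => seg_int s t (fun r => f (x, r))).
Proof.
move=> s0 st cf; have t0 : 0 <= t by lra.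
have c1 : continuous (fun r => seg_int 0 1 (fun x => f (x, r))).
  by apply: (@seg_int_param_continuous _ (f \o @swap R) 0 1 ler01); exact: swap_cont.
have c2 x := @cont_section2 _ f x cf.
rewrite (@seg_int_ext _ (fun x => seg_int s t (fun r => f (x, r)))
  (fun x => seg_int 0 t (fun r => f (x, r)) - seg_int 0 s (fun r => f (x, r)))); last first.
  by move=> x _; rewrite (@seg_int_split _ _ 0 s t s0 st) //; lra.
rewrite seg_intB; try exact: seg_int_param_continuous.
rewrite -!seg_int_swap0 // (@seg_int_split _ _ 0 s t s0 st c1); lra.
Qed.

(** The equation integrated over the rectangle [[x, y] x [s, t]]. It follows
    from [weak_identity] by the lemma of du Bois-Reymond, first in time and then
    in space; all functions that remain are continuous. *)
Lemma rectangle_identity (T : R) (u p F g h : R * R -> R) :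
  0 < T -> continuous u -> continuous p -> continuous F ->
  in_all_Lp (Qopen T) g -> in_all_Lp (Qopen T) h ->
  weak_derivative (Qopen T) (0, 1) u g ->
  weak_derivative (Qopen T) (1, 0) p h ->
  {ae leb2 R, forall z, Qopen T z -> g z - h z = F z} ->
  forall s t x y, 0 <= s -> s <= t -> t <= T -> 0 <= x -> x <= y -> y <= 1 ->
  seg_int s t (fun r => p (y, r)) - seg_int s t (fun r => p (x, r)) =
  seg_int x y (fun z => u (z, t) - u (z, s) - seg_int s t (fun r => F (z, r))).
Proof.
move=> T0 cu cp cF ig ih wg wh ae s t x y s0 st tT x0 xy y1.
have cm (f : R * R -> R) (c : R -> R) : continuous f -> continuous c ->
    continuous (fun z : R * R => f z * c z.1).
  move=> cf cc z; apply: cvgM; first exact: cf.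
  by apply: (@continuous_comp _ _ _ fst c); [exact: cvg_fst|exact: cc].
have cX (f : R * R -> R) : continuous f -> continuous (fun r => seg_int 0 1 (fun z => f (z, r))).
  by move=> cf; apply: (@seg_int_param_continuous _ (f \o @swap R) 0 1 ler01); exact: swap_cont.
(* fix the test function in [x]: the du Bois-Reymond lemma in time *)
have key a a' : C1_bump 0 1 a a' ->
    seg_int 0 1 (fun z => u (z, t) * a z) - seg_int 0 1 (fun z => u (z, s) * a z) =
    seg_int s t (fun r => seg_int 0 1 (fun z => F (z, r) * a z - p (z, r) * a' z)).
  move=> ha; have ca := C1_bump_cont ha; have ca' : continuous a' by case: ha.
  have cD : continuous (fun z : R * R => F z * a z.1 - p z * a' z.1).
    by move=> z; apply: cvgB; apply: cm.
  apply: (@du_Bois_Reymond _ 0 T (fun r => seg_int 0 1 (fun z => u (z, r) * a z))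
     (fun r => seg_int 0 1 (fun z => F (z, r) * a z - p (z, r) * a' z))) => //.
  - exact: (cX _ (cm _ _ cu ca)).
  - exact: (cX _ cD).
  move=> b b' hb; have cb := C1_bump_cont hb; have cb' : continuous b' by case: hb.
  have := @weak_identity _ T u p F g h a a' b b' T0 cu cp cF ig ih wg wh ae ha hb.
  have ct (f : R * R -> R) (c d : R -> R) : continuous f -> continuous c -> continuous d ->
      continuous (fun z : R * R => f z * (c z.1 * d z.2)).
    by move=> cf cc cd z; apply: cvgM; [exact: cf|exact: tensor_continuous].
  have red (f : R * R -> R) (c d : R -> R) : continuous f -> continuous c -> continuous d ->
      \int[leb2 R]_(z in Qopen T) (f z * (c z.1 * d z.2)) =
      seg_int 0 T (fun r => d r * seg_int 0 1 (fun z => f (z, r) * c z)).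
    move=> cf cc cd; rewrite Qopen_int2 //; last exact: ct.
    apply: seg_int_ext => r _; rewrite -seg_intZ; last exact: (@cont_section1 _ _ r (cm _ _ cf cc)).
    by apply: seg_int_ext => z _ /=; ring.
  rewrite !red // => E.
  have cbx (f : R * R -> R) (d c : R -> R) : continuous f -> continuous c -> continuous d ->
      continuous (fun r => d r * seg_int 0 1 (fun z => f (z, r) * c z)).
    by move=> cf cc cd r; apply: cvgM; [exact: cd|exact: (cX _ (cm _ _ cf cc))].
  rewrite (@seg_int_ext _ _ (fun r => b' r * seg_int 0 1 (fun z => u (z, r) * a z) +
    (b r * seg_int 0 1 (fun z => F (z, r) * a z) - b r * seg_int 0 1 (fun z => p (z, r) * a' z)))).
    rewrite seg_intD; last 2 first.
    - exact: cbx.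
    - by move=> r; apply: cvgB; apply: cbx.
    have aux (A B C : R) : A - B = C -> B + (C - A) = 0 by move=> <-; ring.
    by rewrite seg_intB; [exact: aux E|exact: cbx|exact: cbx].
  move=> r _; rewrite seg_intB; first ring.
  - exact: (@cont_section1 _ _ r (cm _ _ cF ca)).
  - exact: (@cont_section1 _ _ r (cm _ _ cp ca')).
apply: (@du_Bois_Reymond _ 0 1 (fun z => seg_int s t (fun r => p (z, r)))
  (fun z => u (z, t) - u (z, s) - seg_int s t (fun r => F (z, r)))) => //.
- exact: seg_int_param_continuous.
- move=> z; apply: cvgB; last exact: seg_int_param_continuous.
  by apply: cvgB; exact: cont_section1.
move=> a a' ha; have := key a a' ha.
have ca := C1_bump_cont ha; have ca' : continuous a' by case: ha.
have cD : continuous (fun z : R * R => F z * a z.1 - p z * a' z.1).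
  by move=> z; apply: cvgB; apply: cm.
rewrite (@seg_int_swap (fun z : R * R => F z * a z.1 - p z * a' z.1)) // => E.
have cT (f : R * R -> R) (c : R -> R) : continuous f -> continuous c ->
    continuous (fun z => c z * seg_int s t (fun r => f (z, r))).
  by move=> cf cc z; apply: cvgM; [exact: cc|exact: seg_int_param_continuous].
have cua r : continuous (fun z => u (z, r) * a z).
  exact: (@cont_section1 _ _ r (cm _ _ cu ca)).
have E2 : seg_int 0 1 (fun z => seg_int s t (fun r => F (z, r) * a z - p (z, r) * a' z)) =
  seg_int 0 1 (fun z => a z * seg_int s t (fun r => F (z, r))) -
  seg_int 0 1 (fun z => a' z * seg_int s t (fun r => p (z, r))).
  rewrite -seg_intB; [|exact: cT|exact: cT]; apply: seg_int_ext => z _.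
  have c2F := @cont_section2 _ F z cF; have c2p := @cont_section2 _ p z cp.
  rewrite -!seg_intZ // -seg_intB; last 2 first.
  - by move=> r; apply: cvgM; [exact: cvg_cst|exact: c2F].
  - by move=> r; apply: cvgM; [exact: cvg_cst|exact: c2p].
  by apply: seg_int_ext => r _; ring.
move: E; rewrite /= E2 => E.
rewrite (@seg_int_ext _ _ (fun z => (a' z * seg_int s t (fun r => p (z, r)) -
   a z * seg_int s t (fun r => F (z, r))) + (u (z, t) * a z - u (z, s) * a z))).
  rewrite seg_intD; last 2 first.
  - by move=> z; apply: cvgB; apply: cT.
  - by move=> z; apply: cvgB; apply: cua.
  have aux (A B C D : R) : A - B = C - D -> D - C + (A - B) = 0 by move=> ->; ring.
  by rewrite seg_intB ?seg_intB; [exact: aux E|exact: cua|exact: cua|exact: cT|exact: cT].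
by move=> z _; ring.
Qed.
End Rectangle.

(** * Steklov averages of time-periodic functions *)

Section Steklov.
Context (R : realType) (T : R).
Hypothesis T0 : 0 < T.
Implicit Types (w : R * R -> R).

(** The extension of [w] from [[0, T]] to [[0, 2 T]] by periodicity, when [w (x,
    T) = w (x, 0)]; this formula is continuous without any case distinction. *)
Definition per_ext w (z : R * R) : R :=
  w (z.1, clamp 0 T z.2) + w (z.1, clamp 0 T (z.2 - T)) - w (z.1, 0).

(** The integral of [per_ext w] over [[0, t]]. *)
Definition per_int w (z : R * R) : R :=
  seg_int 0 (clamp 0 T z.2) (fun r => w (z.1, r)) +
  seg_int 0 (clamp 0 T (z.2 - T)) (fun r => w (z.1, r)).

(** The Steklov average of [w]: its mean over the time interval [[t, t + h]]. *)
Definition steklov w (h : R) (z : R * R) : R :=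
  h^-1 * (per_int w (z.1, z.2 + h) - per_int w z).

Lemma per_ext_continuous w : continuous w -> continuous (per_ext w).
Proof.
have cs (c : R) : continuous (fun z : R * R => (z.1, clamp 0 T (z.2 - c))).
  apply: cont_pair => z; first exact: cvg_fst.
  apply: (@continuous_comp _ _ _ (fun z => z.2 - c) (clamp 0 T)); last exact: clamp_cont.
  by apply: cvgB; [exact: cvg_snd|exact: cvg_cst].
move=> cw z; apply: cvgB; first apply: cvgD.
- apply: (@continuous_comp _ _ _ (fun z : R * R => (z.1, clamp 0 T z.2)) w); last exact: cw.
  have := cs 0 z; rewrite /continuous_at subr0.
  by apply: cvg_trans; apply: near_eq_cvg; near=> u; rewrite subr0.
- by apply: (@continuous_comp _ _ _ (fun z : R * R => (z.1, clamp 0 T (z.2 - T))) w);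
    [exact: cs|exact: cw].
apply: (@continuous_comp _ _ _ (fun z : R * R => (z.1, 0)) w); last exact: cw.
by apply: cont_pair => y; [exact: cvg_fst|exact: cvg_cst].
Unshelve. all: by end_near.
Qed.

Lemma per_ext_lo w x t : t <= T -> 0 <= t -> per_ext w (x, t) = w (x, t).
Proof.
have T0' := ltW T0.
by move=> tT t0; rewrite /per_ext /= clamp_id ?t0 // (@clamp_lo _ 0 T (t - T)) //; [ring|lra].
Qed.

Lemma per_ext_hi w x t : w (x, T) = w (x, 0) -> T <= t -> t <= 2 * T ->
  per_ext w (x, t) = w (x, t - T).
Proof.
have T0' := ltW T0.
by move=> wT Tt t2; rewrite /per_ext /= (@clamp_hi _ 0 T t) // clamp_id; [rewrite wT; ring|lra].
Qed.

Lemma per_int_lo w x t : t <= T -> 0 <= t -> per_int w (x, t) = seg_int 0 t (fun r => w (x, r)).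
Proof.
have T0' := ltW T0.
move=> tT t0; rewrite /per_int /= clamp_id ?t0 // (@clamp_lo _ 0 T (t - T)) //; last lra.
by rewrite seg_int_point addr0.
Qed.

Lemma per_int_hi w x t : T <= t -> t <= 2 * T ->
  per_int w (x, t) = seg_int 0 T (fun r => w (x, r)) + seg_int 0 (t - T) (fun r => w (x, r)).
Proof. have T0' := ltW T0. by move=> Tt t2; rewrite /per_int /= (@clamp_hi _ 0 T t) // clamp_id //; lra. Qed.

Lemma per_int_der w x t : continuous w -> w (x, T) = w (x, 0) -> 0 <= t <= 2 * T ->
  has_der `[0, 2 * T] (fun s => per_int w (x, s)) t (per_ext w (x, t)).
Proof.
move=> cw wT t2; have cx : continuous (fun r => w (x, r)) by exact: cont_section2.
apply: (@has_der_glue _ 0 T) => // tT.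
  have tt : 0 <= t <= T by lra.
  rewrite per_ext_lo //; last lra.
  apply: has_der_ext (seg_int_der tt cx); first by rewrite /= in_itv.
  by move=> y; rewrite /= in_itv /= => /andP[? ?]; rewrite per_int_lo.
rewrite per_ext_hi //; last lra.
have tt : 0 <= t - T <= T by lra.
have h := @has_der_shift _ T (2 * T) (- T) (fun s => seg_int 0 s (fun r => w (x, r))) t (w (x, t - T)).
have /h {}h : has_der `[T + - T, 2 * T + - T] (fun s => seg_int 0 s (fun r => w (x, r))) (t + - T) (w (x, t - T)).
  by have := seg_int_der tt cx; rewrite subrr (_ : 2 * T - T = T); [|ring].
have := has_derD (@has_der_cst _ `[T, 2 * T] (seg_int 0 T (fun r => w (x, r))) t) h.
rewrite add0r; apply: has_der_ext; first by rewrite /= in_itv /=; lra.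
by move=> y; rewrite /= in_itv /= => /andP[? ?]; rewrite per_int_hi.
Qed.

(** The average has a time derivative even where [w] has none. *)
Lemma steklov_der w x t h : continuous w -> w (x, T) = w (x, 0) -> 0 < h <= T -> 0 <= t <= T ->
  has_der `[0, T] (fun s => steklov w h (x, s)) t (h^-1 * (per_ext w (x, t + h) - per_ext w (x, t))).
Proof.
move=> cw wT hT tT; apply: has_derZ; apply: has_derB.
  apply: (@has_der_shift _ 0 T h (fun s => per_int w (x, s))).
  apply: (@has_der_subset _ _ `[0, 2 * T]); last by apply: per_int_der => //; lra.
  by move=> y; rewrite /= !in_itv /=; lra.
apply: (@has_der_subset _ _ `[0, 2 * T]); last by apply: per_int_der => //; lra.
by move=> y; rewrite /= !in_itv /=; lra.
Qed.

Lemma steklov_close w e : continuous w -> (forall x, w (x, T) = w (x, 0)) -> 0 < e ->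
  exists2 d, 0 < d & forall h x t, 0 < h -> h < d -> h <= T -> 0 <= x <= 1 -> 0 <= t <= T ->
    `|steklov w h (x, t) - w (x, t)| <= e.
Proof.
move=> cw wT e0.
have [d d0 H] := @ucont2 _ (per_ext w) 0 1 0 (2 * T) (per_ext_continuous cw) e e0.
exists d => // h x t h0 hd hT x01 tT.
have th : t <= t + h by lra.
have M : `|(per_int w (x, t + h) - w (x, t) * (t + h)) - (per_int w (x, t) - w (x, t) * t)| <= e * (t + h - t).
  apply: (@mean_value_abs _ (fun s => per_int w (x, s) - w (x, t) * s)
    (fun s => per_ext w (x, s) - w (x, t) * 1)) => //.
    move=> s hs; apply: has_derB; last by apply: has_derZ; exact: has_der_id.
    apply: (@has_der_subset _ _ `[0, 2 * T]); last by apply: per_int_der => //; lra.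
    by move=> y; rewrite /= !in_itv /=; lra.
  move=> s hs; rewrite mulr1 -(@per_ext_lo w x t); try lra.
  apply: ltW; apply: H; rewrite ?subrr ?normr0 //; try lra.
  by rewrite ger0_norm; lra.
have E : t + h - t = h by ring.
rewrite E in M.
have -> : steklov w h (x, t) - w (x, t) =
  h^-1 * ((per_int w (x, t + h) - w (x, t) * (t + h)) - (per_int w (x, t) - w (x, t) * t)).
  by rewrite /steklov /=; field; rewrite gt_eqF.
by rewrite normrM normfV [`|h|]gtr0_norm // ler_pdivrMl // (mulrC h e).
Qed.

Lemma seg_int_joint_continuous w : continuous w ->
  continuous (fun z : R * R => seg_int 0 (clamp 0 T z.2) (fun r => w (z.1, r))).
Proof.
move=> cw; apply: cont_epsP2 => x t e e0 /=.
have T1 : 0 < T + 1 by rewrite addr_gt0.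
have [d d0 H] := @ucont2 _ w (x - 1) (x + 1) 0 T cw (e / 2 / (T + 1)) (divr_gt0 (divr_gt0 e0 (ltr0Sn R 1)) T1).
have [B B0 HB] := @bounded2 _ w x x 0 T cw.
pose d' := Num.min (Num.min d 1) (e / 2 / B).
exists d'; first by rewrite !lt_min d0 ltr01 !divr_gt0.
move=> y s; rewrite distrC /d' !lt_min => /andP[/andP[xy xy1] _].
rewrite distrC => /andP[_ ts].
have cy := @cont_section2 _ w y cw; have cx := @cont_section2 _ w x cw.
have /andP[s1 s2] := @clamp_in _ 0 T s (ltW T0).
have A : `|seg_int 0 (clamp 0 T s) (fun r => w (x, r)) - seg_int 0 (clamp 0 T s) (fun r => w (y, r))|
    < e / 2.
  rewrite -seg_intB //; apply: (@le_lt_trans _ _ (e / 2 / (T + 1) * (clamp 0 T s - 0))).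
    apply: seg_int_abs => //.
      by move=> r; apply: cvgB; [exact: cx|exact: cy].
    have x1 : x - 1 <= x <= x + 1 by clear; lra.
    have y1 : x - 1 <= y <= x + 1 by move: xy1; rewrite ltr_norml; clear; lra.
    move=> r hr; have rT : 0 <= r <= T by move: hr s2; clear; lra.
    by apply/ltW/H; rewrite ?subrr ?normr0 ?divr_gt0.
  have E : e / 2 / (T + 1) * (T + 1) = e / 2 by field; rewrite gt_eqF.
  have : 0 < e / 2 / (T + 1) by rewrite !divr_gt0.
  move=> k; rewrite -[ltRHS]E ltr_pM2l //; lra.
have B2 : `|seg_int 0 (clamp 0 T t) (fun r => w (x, r)) - seg_int 0 (clamp 0 T s) (fun r => w (x, r))|
    < e / 2.
  have lip u v : 0 <= u -> u <= v -> v <= T ->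
     `|seg_int 0 v (fun r => w (x, r)) - seg_int 0 u (fun r => w (x, r))| <= B * (v - u).
    move=> u0 uv vT; rewrite (@seg_int_split _ _ 0 u v) // addrAC subrr add0r.
    by apply: seg_int_abs => // r hr; apply: HB; [rewrite lexx|move: hr u0 vT; clear; lra].
  have /andP[t1 t2] := @clamp_in _ 0 T t (ltW T0).
  have cl := @clamp_lip _ 0 T t s (ltW T0).
  have BE : B * `|clamp 0 T s - clamp 0 T t| < e / 2.
    rewrite mulrC -ltr_pdivlMr //; apply: le_lt_trans cl _; by rewrite distrC.
  have [ab|ab] := leP (clamp 0 T s) (clamp 0 T t).
    apply: le_lt_trans (lip _ _ s1 ab t2) _; apply: le_lt_trans BE.
    by rewrite distrC ger0_norm // subr_ge0.
  rewrite distrC; apply: le_lt_trans (lip _ _ t1 (ltW ab) s2) _; apply: le_lt_trans BE.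
  by rewrite ger0_norm // subr_ge0 ltW.
rewrite -[ltRHS](_ : e / 2 + e / 2 = e); last by field.
set I1 := seg_int 0 (clamp 0 T t) _ in B2 *.
set I2 := seg_int 0 (clamp 0 T s) (fun r => w (x, r)) in A B2.
set I3 := seg_int 0 (clamp 0 T s) (fun r => w (y, r)) in A *.
rewrite distrC.
have -> : I1 - I3 = (I1 - I2) + (I2 - I3) by ring.
by apply: le_lt_trans (ler_normD _ _) _; apply: ltrD.
Qed.

Lemma per_int_continuous w : continuous w -> continuous (per_int w).
Proof.
move=> cw z; apply: cvgD; first exact: seg_int_joint_continuous.
apply: (@continuous_comp _ _ _ (fun z : R * R => (z.1, z.2 - T))
  (fun z : R * R => seg_int 0 (clamp 0 T z.2) (fun r => w (z.1, r)))); last first.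
  exact: seg_int_joint_continuous.
apply: cont_pair => y; first exact: cvg_fst.
by apply: cvgB; [exact: cvg_snd|exact: cvg_cst].
Qed.

Lemma steklov_continuous w h : continuous w -> continuous (steklov w h).
Proof.
move=> cw z; apply: cvgM; first exact: cvg_cst.
apply: cvgB; last exact: per_int_continuous.
apply: (@continuous_comp _ _ _ (fun z : R * R => (z.1, z.2 + h)) (per_int w)).
  apply: cont_pair => y; first exact: cvg_fst.
  by apply: cvgD; [exact: cvg_snd|exact: cvg_cst].
exact: per_int_continuous.
Qed.

(** Differentiation under the integral sign, with the derivative relative to
    [[0, 1]]. *)
Lemma seg_int_param_der w p s x : continuous w -> continuous p ->
  (forall y r, 0 <= y <= 1 -> 0 <= r <= T -> has_der `[0, 1] (fun z => w (z, r)) y (p (y, r))) ->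
  0 <= s <= T -> 0 <= x <= 1 ->
  has_der `[0, 1] (fun y => seg_int 0 s (fun r => w (y, r))) x (seg_int 0 s (fun r => p (x, r))).
Proof.
move=> cw cp dw sT x01 e e0.
have T1 : 0 < T + 1 by rewrite addr_gt0.
have e1 : 0 < e / (T + 1) by rewrite divr_gt0.
have [d d0 H] := @ucont2 _ p 0 1 0 T cp _ e1; exists d => // y; rewrite /= in_itv /= => y01 yx.
have c2 (f : R * R -> R) (z : R) : continuous f -> continuous (fun r => f (z, r)).
  exact: cont_section2.
rewrite mulrC -seg_intZ; last exact: c2.
rewrite -seg_intB; [|exact: c2|exact: c2].
rewrite -seg_intB; last 2 first.
- by move=> r; apply: cvgB; apply: c2.
- by move=> r; apply: cvgM; [exact: cvg_cst|exact: c2].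
apply: (@le_trans _ _ (e / (T + 1) * `|y - x| * (s - 0))).
  apply: seg_int_abs; first lra.
    move=> r; apply: cvgB; first by apply: cvgB; apply: c2.
    by apply: cvgM; [exact: cvg_cst|exact: c2].
  move=> r hr.
  have mv a b : 0 <= a -> a <= b -> b <= 1 -> (forall z, a <= z <= b -> `|z - x| <= `|y - x|) ->
     `|(w (b, r) - p (x, r) * b) - (w (a, r) - p (x, r) * a)| <= e / (T + 1) * (b - a).
    move=> a0 ab b1 hz; apply: (@mean_value_abs _ (fun z => w (z, r) - p (x, r) * z)
      (fun z => p (z, r) - p (x, r) * 1)) => //.
      move=> z hz'; apply: has_derB; last by apply: has_derZ; exact: has_der_id.
      apply: (@has_der_subset _ _ `[0, 1]).
        by move=> u; rewrite /= !in_itv /=; move: a0 b1; clear; lra.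
      by apply: dw; [move: hz' a0 b1; clear; lra|move: hr sT; clear; lra].
    move=> z hz'; have z01 : 0 <= z <= 1 by move: hz' a0 b1; clear; lra.
    have rT : 0 <= r <= T by move: hr sT; clear; lra.
    rewrite mulr1; apply/ltW/H; rewrite ?subrr ?normr0 //.
    by apply: le_lt_trans yx; exact: hz.
  have [xy|xy] := leP x y.
    have := mv x y; rewrite [`|y - x|]ger0_norm ?subr_ge0 //.
    have -> : w (y, r) - p (x, r) * y - (w (x, r) - p (x, r) * x) =
       w (y, r) - w (x, r) - (y - x) * p (x, r) by ring.
    move: x01 y01 xy; clear => x01 y01 xy; apply; try lra; move=> z hz; rewrite ger0_norm; lra.
  have := mv y x; rewrite [`|y - x|]ltr0_norm ?subr_lt0 // opprB -normrN.
  have -> : - (w (x, r) - p (x, r) * x - (w (y, r) - p (x, r) * y)) =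
       w (y, r) - w (x, r) - (y - x) * p (x, r) by ring.
  move: x01 y01 xy; clear => x01 y01 xy; apply; try lra; move=> z hz; rewrite ler0_norm; lra.
rewrite subr0 -mulrA (mulrC `|y - x|) mulrA ler_wpM2r //.
rewrite mulrAC ler_pdivrMr // ler_wpM2l //; [exact: ltW|lra].
Qed.

Lemma per_int_param_der w p t x : continuous w -> continuous p ->
  (forall y r, 0 <= y <= 1 -> 0 <= r <= T -> has_der `[0, 1] (fun z => w (z, r)) y (p (y, r))) ->
  0 <= x <= 1 ->
  has_der `[0, 1] (fun y => per_int w (y, t)) x (per_int p (x, t)).
Proof.
move=> cw cp dw x01.
have h1 := @seg_int_param_der w p (clamp 0 T t) x cw cp dw (clamp_in _ (ltW T0)) x01.
have h2 := @seg_int_param_der w p (clamp 0 T (t - T)) x cw cp dw (clamp_in _ (ltW T0)) x01.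
exact: (has_derD h1 h2).
Qed.

Lemma steklov_param_der w p t x h : continuous w -> continuous p ->
  (forall y r, 0 <= y <= 1 -> 0 <= r <= T -> has_der `[0, 1] (fun z => w (z, r)) y (p (y, r))) ->
  0 <= x <= 1 ->
  has_der `[0, 1] (fun y => steklov w h (y, t)) x (steklov p h (x, t)).
Proof.
move=> cw cp dw x01.
exact: (has_derZ _ (has_derB (per_int_param_der (t + h) cw cp dw x01) (per_int_param_der t cw cp dw x01))).
Qed.

Lemma steklov_periodic w h x : 0 < h <= T -> steklov w h (x, T) = steklov w h (x, 0).
Proof.
have T0' := ltW T0.
move=> hT; rewrite /steklov /= per_int_hi; [|lra|lra].
rewrite per_int_lo; [|lra|lra]. rewrite per_int_lo; [|lra|lra]. rewrite per_int_lo; [|lra|lra].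
have -> : T + h - T = h by ring.
by rewrite add0r seg_int_point; congr (_ * _); ring.
Qed.

Lemma steklov_zero w h x t : (forall r, 0 <= r <= T -> w (x, r) = 0) -> steklov w h (x, t) = 0.
Proof.
move=> w0; rewrite /steklov /per_int /=.
have z s : seg_int 0 (clamp 0 T s) (fun r => w (x, r)) = 0.
  have /andP[s1 s2] := @clamp_in _ 0 T s (ltW T0).
  rewrite (@seg_int_ext _ _ (fun=> 0)); first by rewrite seg_int_cst // mul0r.
  by move=> r hr; apply: w0; lra.
by rewrite !z; ring.
Qed.
End Steklov.

(** * Classical approximation of the principal eigenfunction *)

(** An approximate eigenfunction for which the terms of the equation exist at
    every point. The error is measured relative to [u], since it is compared
    with multiples of [u]. *)
Definition near_eigenfunction (R : realType) (T : R) (m V : R * R -> R)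
    (al lam eps : R) (u ut ux uxx : R * R -> R) : Prop :=
  [/\ continuous u,
      forall x t, 0 <= x <= 1 -> 0 <= t <= T -> 0 < u (x, t),
      forall x, u (x, T) = u (x, 0),
      forall x t, 0 <= x <= 1 -> 0 <= t <= T ->
        taylor2 `[0, 1] (fun y => u (y, t)) x (ux (x, t)) (uxx (x, t)) /\
        has_der `[0, T] (fun s => u (x, s)) t (ut (x, t)) &
      (forall t, 0 <= t <= T -> ux (0, t) = 0 /\ ux (1, t) = 0) /\
      forall x t, 0 <= x <= 1 -> 0 <= t <= T ->
        `|ut (x, t) - uxx (x, t) - al * dx m (x, t) * ux (x, t)
          + (V (x, t) - lam) * u (x, t)| <= eps * u (x, t)].

Lemma dx_has_der (R : realType) (J : set R) (f : R * R -> R) x t :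
  x_derivable J f -> 0 <= x <= 1 -> J t ->
  has_der `[0, 1] (fun y => f (y, t)) x (dx f (x, t)).
Proof.
by move=> df x01 Jt; apply: has_der_derive_in; apply: df.
Qed.

Lemma dx_eq (R : realType) (J : set R) (f : R * R -> R) x s t :
  x_derivable J f -> J s -> J t -> 0 <= x <= 1 ->
  (forall y, 0 <= y <= 1 -> f (y, s) = f (y, t)) -> dx f (x, s) = dx f (x, t).
Proof.
move=> df Js Jt x01 H.
apply: (@has_der_unique _ 0 1 (fun y => f (y, t)) x) => //; last exact: (dx_has_der df).
apply: has_der_ext (dx_has_der df x01 Js); first by rewrite /= in_itv.
by move=> y; rewrite /= in_itv /= => /H.
Qed.

(** The identity on rectangles says that the time integral of [d_x phi] is
    itself differentiable in [x]; this is the second derivative of the Steklov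
    average of [phi]. *)
Lemma per_int_rect_der (R : realType) (T : R) (u p F : R * R -> R) (x t : R) :
  0 < T -> continuous u -> continuous p -> continuous F ->
  (forall z, u (z, T) = u (z, 0)) ->
  (forall s t x y, 0 <= s -> s <= t -> t <= T -> 0 <= x -> x <= y -> y <= 1 ->
    seg_int s t (fun r => p (y, r)) - seg_int s t (fun r => p (x, r)) =
    seg_int x y (fun z => u (z, t) - u (z, s) - seg_int s t (fun r => F (z, r)))) ->
  0 <= x <= 1 -> 0 <= t <= 2 * T ->
  has_der `[0, 1] (fun y => per_int T p (y, t)) x
    (per_ext T u (x, t) - u (x, 0) - per_int T F (x, t)).
Proof.
move=> T0 cu cp cF uT rect x01 t2; have T0' := ltW T0.
pose I z := per_ext T u (z, t) - u (z, 0) - per_int T F (z, t).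
have cI : continuous I.
  move=> z; apply: cvgB; last by apply: cont_section1; exact: per_int_continuous.
  by apply: cvgB; apply: cont_section1 => //; exact: per_ext_continuous.
have E y : 0 <= y <= 1 -> per_int T p (0, t) + seg_int 0 y I = per_int T p (y, t).
  move=> /andP[y0 y1].
  suff : per_int T p (y, t) - per_int T p (0, t) = seg_int 0 y I by lra.
  have c1 s : continuous (fun z => u (z, s)) by exact: cont_section1.
  have c2 s : 0 <= s -> continuous (fun z => seg_int 0 s (fun r => F (z, r))).
    by move=> s0; exact: seg_int_param_continuous.
  case/andP: t2 => t0 t2; have [tT|tT] := leP t T.
    rewrite !per_int_lo // (rect 0 t 0 y) //.
    by apply: seg_int_ext => z _; rewrite /I per_ext_lo // per_int_lo.
  have tT' : 0 <= t - T by lra.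
  rewrite !per_int_hi //; try lra.
  have := rect 0 T 0 y; have := rect 0 (t - T) 0 y.
  have tTT : t - T <= T by lra.
  move=> /(_ (lexx _) tT' tTT (lexx _) y0 y1) r1.
  move=> /(_ (lexx _) T0' (lexx _) (lexx _) y0 y1) r2.
  transitivity (seg_int 0 y (fun z => (u (z, t - T) - u (z, 0) - seg_int 0 (t - T) (fun r => F (z, r))) +
    (u (z, T) - u (z, 0) - seg_int 0 T (fun r => F (z, r))))).
    rewrite seg_intD -?r1 -?r2; first by ring.
      by move=> z; apply: cvgB; [apply: cvgB; exact: c1|exact: c2].
    by move=> z; apply: cvgB; [apply: cvgB; exact: c1|exact: c2].
  apply: seg_int_ext => z _.
  have e1 : per_ext T u (z, t) = u (z, t - T) by apply: per_ext_hi => //; exact: ltW.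
  have e2 : per_int T F (z, t) = seg_int 0 T (fun r => F (z, r)) + seg_int 0 (t - T) (fun r => F (z, r)).
    by apply: per_int_hi => //; exact: ltW.
  by rewrite /I e1 e2 uT; ring.
have := has_derD (@has_der_cst _ `[0, 1] (per_int T p (0, t)) x) (seg_int_der x01 cI).
rewrite add0r; apply: has_der_ext; first by rewrite /= in_itv.
by move=> y; rewrite /= in_itv /= => /E.
Qed.

(** The Steklov average of [phi] over a short time [k] is classical. Averaging
    does not commute with the multiplication by the coefficients, but as [k]
    tends to 0 the averages of [phi], [d_x phi] and of the lower-order terms [F]
    converge uniformly, and so the resulting error is below [eps u]. *)
Lemma classical_approximation (R : realType) (T : R) (m V phi : R * R -> R) (al lam eps : R) :
  0 < T -> C20 [set: R] m -> t_periodic T m ->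
  {within `[0, 1] `*` [set: R], continuous V} -> t_periodic T V ->
  strong_solution T m V al phi (fun z => lam * phi z) ->
  (forall z, Qclosed T z -> 0 < phi z) -> 0 < eps ->
  exists u ut ux uxx, near_eigenfunction T m V al lam eps u ut ux uxx.
Proof.
move=> T0 [[cm dm cdm] [_ ddm cddm]] mT cV VT [[cphi dphi cdphi] neu phiT] [g [h [[ig ih] wg wh ae]]] pos eps0.
have T0' := ltW T0.
have T0T : (0 : R) <= 0 <= T by rewrite lexx.
have TTT : 0 <= T <= T by rewrite lexx T0'.
pose u := phi \o clamp2 0 T; pose p := dx phi \o clamp2 0 T.
pose b := dx m \o clamp2 0 T; pose W := (fun z => V z - lam) \o clamp2 0 T.
pose F (z : R * R) := al * b z * p z - W z * u z.
have cu : continuous u by exact: within_clamp2.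
have cp : continuous p by exact: within_clamp2.
have cb : continuous b by exact: cont_clamp2_setT.
have cW : continuous W.
  have cV' := cont_clamp2_setT T0' cV.
  by move=> z; apply: cvgB; [exact: cV'|exact: cvg_cst].
have cF : continuous F.
  move=> z; apply: cvgB; apply: cvgM; try by [exact: cp|exact: cW|exact: cu].
  by apply: cvgM; [exact: cvg_cst|exact: cb].
have c01 (x : R) : 0 <= clamp 0 1 x <= 1 by exact: clamp_in.
have uT z : u (z, T) = u (z, 0).
  by rewrite /u /= /clamp2 /= !(@clamp_id _ 0 T) // phiT //= in_itv /=.
have pT z : p (z, T) = p (z, 0).
  rewrite /p /= /clamp2 /= !(@clamp_id _ 0 T) //.
  apply: (dx_eq dphi) => //; try by rewrite /= in_itv.
  by move=> y y01; rewrite phiT //= in_itv.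
have mper y : 0 <= y <= 1 -> m (y, T) = m (y, 0).
  by move=> y01; rewrite -(mT y 0) ?add0r //= in_itv.
have FT z : F (z, T) = F (z, 0).
  rewrite /F uT pT; congr (_ * _ * _ - _ * _).
    rewrite /b /= /clamp2 /= !(@clamp_id _ 0 T) //.
    exact: (dx_eq dm).
  rewrite /W /= /clamp2 /= !(@clamp_id _ 0 T) //.
  by rewrite -(VT _ 0) ?add0r //= in_itv /=.
have inQ z : Qopen T z -> clamp2 0 T z = z.
  case: z => x t [/=]; rewrite !in_itv /= => hx ht.
  by apply: clamp2_id; [move: hx|move: ht]; clear; lra.
have wg' : weak_derivative (Qopen T) (0, 1) u g.
  move=> psi hpsi; rewrite -(wg psi hpsi); apply: eq_Rintegral => z; rewrite inE => /inQ E.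
  by rewrite /u /= E.
have wh' : weak_derivative (Qopen T) (1, 0) p h.
  move=> psi hpsi; rewrite -(wh psi hpsi); apply: eq_Rintegral => z; rewrite inE => /inQ E.
  by rewrite /p /= E.
have ae' : {ae leb2 R, forall z, Qopen T z -> g z - h z = F z}.
  apply: negligibleS ae => z /= nz H; apply: nz => Qz; have := H Qz.
  by rewrite /F /b /p /W /u /= inQ // => E; move: E; clear; lra.
have rect := rectangle_identity T0 cu cp cF ig ih wg' wh' ae'.
have du y r : 0 <= y <= 1 -> 0 <= r <= T -> has_der `[0, 1] (fun z => u (z, r)) y (p (y, r)).
  move=> y01 rT; rewrite /p /= clamp2_id //.
  apply: has_der_ext (dx_has_der dphi y01 _); first by rewrite /= in_itv.
    by move=> z; rewrite /= in_itv /= => z01; rewrite /u /= clamp2_id.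
  by rewrite /= in_itv.
have [x0 [t0 [hx0 ht0 umin]]] := EVT_min2 (ler01 : (0 : R) <= 1) T0' cu.
pose c0 := u (x0, t0).
have c00 : 0 < c0 by rewrite /c0 /u /= clamp2_id //; apply: pos; split; rewrite /= in_itv.
have [B1 B10 HB1] := @bounded2 _ b 0 1 0 T cb.
have [B2 B20 HB2] := @bounded2 _ W 0 1 0 T cW.
(* an error [e] in [phi], [d_x phi] and [F] causes an error [e K] in the
   equation; [c0 / 2] is a lower bound for the average *)
pose K := 1 + `|al| * B1 + B2.
have K0 : 0 < K.
  have : 0 <= `|al| * B1 by rewrite mulr_ge0 // ltW.
  by rewrite /K; move: B20; clear; lra.
pose e := Num.min (c0 / 2) (eps * (c0 / 2) / K).
have e0 : 0 < e by rewrite lt_min !divr_gt0 // mulr_gt0 // divr_gt0.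
have e1 : e <= c0 / 2 by rewrite ge_min lexx.
have e2 : e * K <= eps * (c0 / 2) by rewrite -ler_pdivlMr // ge_min lexx orbT.
have [d1 d10 H1] := steklov_close T0 cu uT e0.
have [d2 d20 H2] := steklov_close T0 cp pT e0.
have [d3 d30 H3] := steklov_close T0 cF FT e0.
have [|k k0 /= /and5P[k1 k2 k3 /ltW kT _]] := @exists_below _ [:: d1; d2; d3; T].
  by rewrite /= d10 d20 d30 T0.
have kk : 0 < k <= T by rewrite k0 kT.
pose Ut (z : R * R) := k^-1 * (per_ext T u (z.1, z.2 + k) - per_ext T u z).
exists (steklov T u k), Ut, (steklov T p k), (fun z => Ut z - steklov T F k z).
have Ubig x t : 0 <= x <= 1 -> 0 <= t <= T -> c0 / 2 <= steklov T u k (x, t).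
  move=> x01 tT; have := H1 k x t k0 k1 kT x01 tT; have := umin x t x01 tT.
  by rewrite -/c0 ler_norml; move: e1; clear; lra.
split.
- exact: steklov_continuous.
- by move=> x t x01 tT; apply: lt_le_trans (Ubig x t x01 tT); rewrite divr_gt0.
- by move=> x; exact: steklov_periodic.
- move=> x t x01 tT; split; last first.
    exact: steklov_der.
  apply: (@taylor2P _ 0 1 (fun y => steklov T u k (y, t)) (fun y => steklov T p k (y, t))) => //.
    by move=> s s01; exact: steklov_param_der.
  have t1 : 0 <= t + k <= 2 * T by move: tT kk; clear; lra.
  have t2 : 0 <= t <= 2 * T by move: tT; clear; lra.
  have h1 := per_int_rect_der T0 cu cp cF uT rect x01 t1.
  have h2 := per_int_rect_der T0 cu cp cF uT rect x01 t2.
  apply: (has_der_eq _ (has_derZ k^-1 (has_derB h1 h2))).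
  by rewrite /Ut /steklov /=; ring.
split.
  move=> t tT.
  have z01 := introT andP (conj (lexx (0 : R)) (@ler01 R)).
  have o01 := introT andP (conj (@ler01 R) (lexx (1 : R))).
  by split; apply: steklov_zero => // r rT; rewrite /p /= clamp2_id //;
    have [] := neu r; rewrite /= ?in_itv.
move=> x t x01 tT.
have h1 := H1 k x t k0 k1 kT x01 tT; have h2 := H2 k x t k0 k2 kT x01 tT.
have h3 := H3 k x t k0 k3 kT x01 tT.
have hb := HB1 x t x01 tT; have hW := HB2 x t x01 tT.
have Eb : dx m (x, t) = b (x, t) by rewrite /b /= clamp2_id.
have EW : V (x, t) - lam = W (x, t) by rewrite /W /= clamp2_id.
rewrite Eb EW.
apply: (@le_trans _ _ (eps * (c0 / 2))); last by apply: ler_wpM2l; [exact: ltW|exact: Ubig].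
apply: le_trans e2.
have -> : Ut (x, t) - (Ut (x, t) - steklov T F k (x, t)) - al * b (x, t) * steklov T p k (x, t) +
    W (x, t) * steklov T u k (x, t) =
  (steklov T F k (x, t) - F (x, t)) - al * b (x, t) * (steklov T p k (x, t) - p (x, t)) +
    W (x, t) * (steklov T u k (x, t) - u (x, t)).
  by rewrite /F; ring.
have -> : e * K = e + `|al| * B1 * e + B2 * e by rewrite /K; ring.
apply: le_trans (ler_normD _ _) _; apply: lerD; last first.
  by rewrite normrM; apply: ler_pM.
apply: le_trans (ler_normB _ _) _; apply: lerD => //.
by rewrite !normrM; apply: ler_pM => //; exact: ler_wpM2l.
Qed.

(** * Comparison at a contact point *)

(** At a contact point the first derivatives in [x] agree, the second derivative
    of [P] is at least that of [th u], and its time derivative is at most that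
    of [th u], because only earlier times are compared. At an end point of [[0,
    1]] equality of the first derivatives comes from the Neumann condition of
    [u] and the sign of [px]. *)
Lemma touching (R : realType) (T al lam eps th : R) (m V u ut ux uxx P : R * R -> R)
    (x0 t0 pt px pxx : R) :
  near_eigenfunction T m V al lam eps u ut ux uxx ->
  0 <= x0 <= 1 -> 0 < t0 <= T ->
  taylor2 `[0, 1] (fun y => P (y, t0)) x0 px pxx ->
  has_der `[0, t0] (fun s => P (x0, s)) t0 pt ->
  (exists2 d, 0 < d & forall y, 0 <= y <= 1 -> `|y - x0| < d ->
      th * u (y, t0) <= P (y, t0)) ->
  (exists2 d, 0 < d & forall s, 0 <= s <= t0 -> `|s - t0| < d ->
      th * u (x0, s) <= P (x0, s)) ->
  P (x0, t0) = th * u (x0, t0) ->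
  (x0 = 0 -> px <= 0) -> (x0 = 1 -> 0 <= px) ->
  pt - pxx - al * dx m (x0, t0) * px + (V (x0, t0) - lam) * P (x0, t0)
    <= `|th| * (eps * u (x0, t0)).
Proof.
move=> [cu upos uT ud [un ueq]] x01 t0T Ptay Pder [dx1 dx10 Hx] [dt1 dt10 Ht] PE P0 P1.
have t0T' : 0 <= t0 <= T by case/andP: t0T => /ltW -> ->.
have [utay uder] := ud x0 t0 x01 t0T'.
have [u0 u1] := un t0 t0T'.
have Dtay := taylor2D Ptay (taylor2Z (- th) utay).
have Dmin : exists2 d, 0 < d & forall y, 0 <= y <= 1 -> `|y - x0| < d ->
    P (x0, t0) + - th * u (x0, t0) <= P (y, t0) + - th * u (y, t0).
  by exists dx1 => // y y01 yx; have := Hx y y01 yx; rewrite PE; clear; lra.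
have epx : px = th * ux (x0, t0).
  have r := local_min_right Dtay _ Dmin; have l := local_min_left Dtay _ Dmin.
  have [E|n0] := eqVneq x0 0.
    have h0 : 0 <= x0 < 1 by rewrite E lexx ltr01.
    by have := r h0; have := P0 E; rewrite [in ux _]E u0; clear; lra.
  have [E|n1] := eqVneq x0 1.
    have h0 : 0 < x0 <= 1 by rewrite E lexx ltr01.
    by have := l h0; have := P1 E; rewrite [in ux _]E u1; clear; lra.
  have h0 : 0 <= x0 < 1 by rewrite lt_neqAle n1; case/andP: x01 => -> ->.
  have h1 : 0 < x0 <= 1 by rewrite lt_neqAle eq_sym n0; case/andP: x01 => -> ->.
  by have := r h0; have := l h1; clear; lra.
have epxx : th * uxx (x0, t0) <= pxx.
  have := local_min_second Dtay x01 _ Dmin; rewrite epx => H.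
  have : 0 <= pxx + - th * uxx (x0, t0) by apply: H; ring.
  by clear; lra.
have ept : pt <= th * ut (x0, t0).
  rewrite leNgt; apply/negP => h.
  have uder' : has_der `[0, t0] (fun s => u (x0, s)) t0 (ut (x0, t0)).
    by apply: has_der_subset uder => y; rewrite /= !in_itv /=; move: t0T; clear; lra.
  have Dd := has_derD Pder (has_derZ (- th) uder').
  have e0 : 0 < (pt - th * ut (x0, t0)) / 2 by move: h; clear; lra.
  have [d d0 H] := Dd _ e0.
  have [|k k0 /= /and4P[k1 k2 k3 _]] := @exists_below _ [:: d; dt1; t0].
    by case/andP: t0T => t00 _; rewrite /= d0 dt10 t00.
  have s0 : 0 <= t0 - k <= t0 by move: k0 k3; clear; lra.
  have E : t0 - k - t0 = - k by ring.
  have := H (t0 - k) s0; have := Ht (t0 - k) s0; rewrite E normrN gtr0_norm //.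
  move=> /(_ k2) h1 /(_ k1) /ler_normlP[_ h2].
  have : 0 < (pt - th * ut (x0, t0)) * k by rewrite mulr_gt0 // subr_gt0.
  by rewrite PE in h2; move: h1 h2; clear; lra.
have K : `|th * (ut (x0, t0) - uxx (x0, t0) - al * dx m (x0, t0) * ux (x0, t0)
          + (V (x0, t0) - lam) * u (x0, t0))| <= `|th| * (eps * u (x0, t0)).
  by rewrite normrM ler_wpM2l // ueq.
apply: le_trans (le_trans (ler_norm _) K).
rewrite epx PE; move: epxx ept; clear; lra.
Qed.

(** * Geometry of the curves of maxima *)

(** First and second order characterization of a nondegenerate local maximum on
    [[0, 1]], the end points included; [b] and [bx] stand for the first two
    derivatives. *)
Definition crit_max (R : realType) (b bx : R * R -> R) (x t : R) : Prop :=
  [/\ 0 < x -> 0 <= b (x, t), x < 1 -> b (x, t) <= 0 & b (x, t) = 0 -> bx (x, t) < 0].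

Lemma slice_der_subset (R : realType) (b bx : R * R -> R) (x y s t : R) :
  (forall x t : R, 0 <= x <= 1 -> has_der `[0, 1] (fun y => b (y, t)) x (bx (x, t))) ->
  0 <= x -> y <= 1 -> x <= s <= y ->
  has_der `[x, y] (fun z => b (z, t)) s (bx (s, t)).
Proof.
move=> db x0 y1 xsy; have s01 : 0 <= s <= 1 by lra.
by apply: has_der_subset (db _ t s01) => z; rewrite /= !in_itv /=; lra.
Qed.

(** One number [r] serves both as the width of the neighbourhood and as the rate
    at which the drift points towards the curve. *)
Definition well_at (R : realType) (T : R) (b : R * R -> R) (N : nat) (kap : 'I_N.+1 -> R -> R)
    (i : 'I_N.+1) (r : R) : Prop :=
  forall x t, 0 <= x <= 1 -> 0 <= t <= T -> `|x - kap i t| <= r ->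
    (kap i t < x -> b (x, t) <= - r * (x - kap i t)) /\
    (x < kap i t -> r * (kap i t - x) <= b (x, t)).

(** At each time either the drift on the curve is away from 0, which happens
    only at an end point, or its slope is negative. By compactness in time one
    of these holds with uniform constants, and uniform continuity carries it to
    a neighbourhood of the curve. *)
Lemma well_ex (R : realType) (T : R) (b bx : R * R -> R) (N : nat) (kap : 'I_N.+1 -> R -> R) i :
  0 < T -> continuous b -> continuous bx ->
  (forall x t : R, 0 <= x <= 1 -> has_der `[0, 1] (fun y => b (y, t)) x (bx (x, t))) ->
  (forall x t : R, 0 <= x <= 1 -> 0 <= t <= T -> crit_max b bx x t <-> exists i, x = kap i t) ->
  (forall i (t : R), 0 <= t <= T -> 0 <= kap i t <= 1) ->
  (forall i, continuous (fun t => kap i (clamp 0 T t))) ->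
  exists2 r, 0 < r & well_at T b kap i r.
Proof.
move=> T0 cb cbx db crit k01 ck.
pose G t := Num.max `|b (kap i (clamp 0 T t), clamp 0 T t)| (- bx (kap i (clamp 0 T t), clamp 0 T t)).
have cz : continuous (fun t => (kap i (clamp 0 T t), clamp 0 T t)).
  by apply: cont_pair; [exact: ck|exact: clamp_cont].
have cG : continuous G.
  move=> t; apply: (@continuous_max _ _
    (fun t => `|b (kap i (clamp 0 T t), clamp 0 T t)|)
    (fun t => - bx (kap i (clamp 0 T t), clamp 0 T t))).
    apply: cvg_norm; apply: (@continuous_comp _ _ _ (fun t => (kap i (clamp 0 T t), clamp 0 T t)) b).
      exact: cz.
    exact: cb.
  apply: cvgN; apply: (@continuous_comp _ _ _ (fun t => (kap i (clamp 0 T t), clamp 0 T t)) bx).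
    exact: cz.
  exact: cbx.
have [t0] := EVT_min (ltW T0) (continuous_subspaceT cG); rewrite in_itv /= => ht0 Gmin.
pose a := G t0 / 2.
have G0 t : 0 <= t <= T -> 0 < G t.
  move=> tT; rewrite /G clamp_id // lt_max.
  have [|_ _ h] := (crit _ _ (k01 i t tT) tT).2; first by exists i.
  have [E|ne] := eqVneq (b (kap i t, t)) 0; last by rewrite normr_gt0 ne.
  by rewrite oppr_gt0 h ?orbT.
have a0 : 0 < a by rewrite divr_gt0 // G0.
have Ga t : 0 <= t <= T -> 2 * a <= `|b (kap i t, t)| \/ bx (kap i t, t) <= - (2 * a).
  move=> tT; have := Gmin t; rewrite in_itv /= => /(_ tT).
  have -> : G t0 = 2 * a by rewrite /a; field.
  by rewrite /G clamp_id // le_max => /orP[|h]; [left|right; lra].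
have [d1 d10 H1] := @ucont2 _ b 0 1 0 T cb a a0.
have [d2 d20 H2] := @ucont2 _ bx 0 1 0 T cbx a a0.
pose r := Num.min (Num.min d1 d2 / 2) a.
have r0 : 0 < r by rewrite lt_min a0 divr_gt0 // lt_min d10 d20.
have ra : r <= a by rewrite ge_min lexx orbT.
have [rd1 rd2] : r < d1 /\ r < d2.
  have A : r <= Num.min d1 d2 / 2 by rewrite ge_min lexx.
  have B : Num.min d1 d2 <= d1 by rewrite ge_min lexx.
  have C : Num.min d1 d2 <= d2 by rewrite ge_min lexx orbT.
  by lra.
exists r => // x t x01 tT xk; have kk := k01 i t tT.
have [|cr1 cr2 _] := (crit _ _ kk tT).2; first by exists i.
have nb y : 0 <= y <= 1 -> `|y - kap i t| <= r -> `|b (y, t) - b (kap i t, t)| < a.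
  move=> y01 yk; apply: H1; rewrite ?subrr ?normr0 //; exact: le_lt_trans yk rd1.
have nbx y : 0 <= y <= 1 -> `|y - kap i t| <= r -> `|bx (y, t) - bx (kap i t, t)| < a.
  move=> y01 yk; apply: H2; rewrite ?subrr ?normr0 //; exact: le_lt_trans yk rd2.
have [h|h] := Ga t tT.
  have hx : `|b (x, t) - b (kap i t, t)| < a by exact: nb.
  move: hx; rewrite ltr_norml => /andP[hx1 hx2].
  case: (ger0P (b (kap i t, t))) h => [b0|b0] h.
    have k1 : kap i t = 1.
      have [k1|k1] := ltP (kap i t) 1; first by have := cr2 k1; move: h a0; clear; lra.
      by move: k1 kk; clear; lra.
    split; first by rewrite k1; move: x01; clear; lra.
    move=> _; apply: (@le_trans _ _ a); last by move: hx1 h; clear; lra.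
    by apply: (@le_trans _ _ r) => //; rewrite k1 ler_piMr //; [exact: ltW|move: x01; clear; lra].
  have k0 : kap i t = 0.
    have [k0|k0] := ltP 0 (kap i t); first by have := cr1 k0; move: b0; clear; lra.
    by move: k0 kk; clear; lra.
  split; last by rewrite k0; move: x01; clear; lra.
  move=> _; apply: (@le_trans _ _ (- a)); first by move: hx2 h; clear; lra.
  rewrite mulNr lerN2; apply: (@le_trans _ _ r) => //.
  by rewrite k0 ler_piMr //; [exact: ltW|move: x01; clear; lra].
have sl y : 0 <= y <= 1 -> `|y - kap i t| <= r -> bx (y, t) <= - r.
  by move=> y01 yk; have := nbx y y01 yk; rewrite ltr_norml; move: h ra; clear; lra.
split=> hx.
  have := @mean_value_le _ (fun z => b (z, t)) (fun z => bx (z, t)) (kap i t) x (- r) (ltW hx).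
  have cr2' : b (kap i t, t) <= 0 by apply: cr2; move: hx x01; clear; lra.
  suff : b (x, t) - b (kap i t, t) <= - r * (x - kap i t) -> b (x, t) <= - r * (x - kap i t).
    move=> h1 h2; apply: h1; apply: h2.
      move=> s hs; apply: (slice_der_subset _ db) => //; first by case/andP: kk.
      by case/andP: x01.
    move=> s hs; apply: sl; first by move: hs kk x01; clear; lra.
    by move: xk; rewrite !ger0_norm; move: hs hx; clear; lra.
  by move: cr2'; clear; lra.
have := @mean_value_le _ (fun z => b (z, t)) (fun z => bx (z, t)) x (kap i t) (- r) (ltW hx).
have cr1' : 0 <= b (kap i t, t) by apply: cr1; move: hx x01; clear; lra.
suff : b (kap i t, t) - b (x, t) <= - r * (kap i t - x) -> r * (kap i t - x) <= b (x, t).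
  move=> h1 h2; apply: h1; apply: h2.
    move=> s hs; apply: (slice_der_subset _ db) => //; first by case/andP: x01.
    by case/andP: kk.
  move=> s hs; apply: sl; first by move: hs kk x01; clear; lra.
  by move: xk; rewrite !ler0_norm; move: hs hx; clear; lra.
by move: cr1'; clear; lra.
Qed.

Section Geometry.
Context (R : realType) (T : R) (b bx : R * R -> R) (N : nat) (kap : 'I_N.+1 -> R -> R).
Hypothesis T0 : 0 < T.
Hypothesis cb : continuous b.
Hypothesis cbx : continuous bx.
Hypothesis db : forall x t, 0 <= x <= 1 -> has_der `[0, 1] (fun y => b (y, t)) x (bx (x, t)).
Hypothesis nd : forall x t, 0 <= x <= 1 -> 0 <= t <= T -> b (x, t) = 0 -> bx (x, t) <> 0.
Hypothesis crit : forall x t, 0 <= x <= 1 -> 0 <= t <= T ->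
  crit_max b bx x t <-> exists i, x = kap i t.
Hypothesis k01 : forall i t, 0 <= t <= T -> 0 <= kap i t <= 1.
Hypothesis ck : forall i, continuous (fun t => kap i (clamp 0 T t)).

Lemma wells : exists2 r, 0 < r & forall i, well_at T b kap i r.
Proof.
apply: finite_min => [i r r' r0 rr H x t x01 tT xk|i]; last exact: (well_ex _ T0 cb cbx db crit k01 ck).
have [h1 h2] := H x t x01 tT (le_trans xk rr); split=> hx.
  apply: le_trans (h1 hx) _; rewrite !mulNr lerN2 ler_wpM2r //; lra.
apply: le_trans (h2 hx); rewrite ler_wpM2r //; lra.
Qed.

Section Wells.
Context (r : R).
Hypothesis r0 : 0 < r.
Hypothesis hw : forall i, well_at T b kap i r.

(** If two curves were too close, the drift at their midpoint would have to
    point towards both of them. *)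
Lemma separation i j t : 0 <= t <= T -> kap i t < kap j t -> 2 * r < kap j t - kap i t.
Proof.
move=> tT ij; rewrite ltNge; apply/negP => h.
have ki := k01 i tT; have kj := k01 j tT.
pose x := (kap i t + kap j t) / 2; have x01 : 0 <= x <= 1 by rewrite /x; lra.
have xi : `|x - kap i t| <= r by rewrite ger0_norm /x; lra.
have xj : `|x - kap j t| <= r by rewrite ler0_norm /x; lra.
have [hi _] := hw x01 tT xi; have [_ hj] := hw x01 tT xj.
have ix : kap i t < x by rewrite /x; lra.
have xj' : x < kap j t by rewrite /x; lra.
have A : 0 < r * (x - kap i t) by rewrite mulr_gt0 //; lra.
have B : 0 < r * (kap j t - x) by rewrite mulr_gt0 //; lra.
have := hi ix; have := hj xj'; rewrite mulNr; lra.
Qed.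

(** By [separation] the difference of two curves never takes a value in [(0, 2
    r]], so that it cannot change sign. *)
Lemma order_preserved i j s t : 0 <= s <= T -> 0 <= t <= T ->
  kap i s < kap j s -> kap i t < kap j t.
Proof.
move=> sT tT ij; rewrite ltNge; apply/negP => ji; have rp := r0.
have sep := separation sT ij.
pose h u := kap j (clamp 0 T u) - kap i (clamp 0 T u).
have ch : continuous h by move=> u; apply: cvgB; exact: ck.
have hs : h s = kap j s - kap i s by rewrite /h !clamp_id.
have ht : h t = kap j t - kap i t by rewrite /h !clamp_id.
have main c d : 0 <= c -> c <= d -> d <= T -> Num.min (h c) (h d) <= r <= Num.max (h c) (h d) -> False.
  move=> c0 cd dT hh; have [u] := IVT cd (continuous_subspaceT ch) hh.
  rewrite in_itv /= => hu; rewrite /h clamp_id; last lra.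
  have uT : 0 <= u <= T by lra.
  move=> E; have ij' : kap i u < kap j u by rewrite -subr_gt0 E.
  by have := separation uT ij'; rewrite E; lra.
have [st|st] := leP s t.
  apply: (main s t) => //; [lra|lra|].
  by rewrite ge_min le_max hs ht; apply/andP; split; apply/orP; [right|left]; lra.
apply: (main t s) => //; [lra|exact: ltW|lra|].
by rewrite ge_min le_max hs ht; apply/andP; split; apply/orP; [left|right]; lra.
Qed.

(** At times 0 and [T] the curves run through the same set of maxima. If some
    curve moved up over a period, consider the one that starts highest among
    these: its final position is the initial position of a curve above it, which
    by preservation of order moves up too. *)
Lemma kap_periodic i :
  (forall x, 0 <= x <= 1 -> crit_max b bx x 0 <-> crit_max b bx x T) ->
  kap i T = kap i 0.
Proof.
move=> per.
have z0 : (0 : R) <= 0 <= T by rewrite lexx ltW.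
have zT : 0 <= T <= T by rewrite lexx ltW.
have ex l : exists j, kap j 0 = kap l T.
  have [|j ->] := (crit (k01 l zT) z0).1; last by exists j.
  by apply/per; [exact: k01|apply/(crit (k01 l zT) zT); exists l].
apply/le_anti/andP; split; rewrite leNgt; apply/negP => hi.
  case: (@arg_maxP _ _ _ i (fun l => kap l 0 < kap l T) (fun l => kap l 0) hi) => l hl max.
  have [j hj] := ex l.
  have lj : kap l 0 < kap j 0 by rewrite hj.
  have := order_preserved z0 zT lj; rewrite -hj => /max.
  by rewrite /= leNgt lj.
case: (@arg_minP _ _ _ i (fun l => kap l T < kap l 0) (fun l => kap l 0) hi) => l hl min.
have [j hj] := ex l.
have lj : kap j 0 < kap l 0 by rewrite hj.
have := order_preserved z0 zT lj; rewrite -hj => /min.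
by rewrite /= leNgt lj.
Qed.
End Wells.

(** At a zero of the drift away from the curves the slope is nonzero by
    nondegeneracy, and it is not negative, as the point would be a maximum.
    Compactness makes this quantitative. *)
Lemma gap_slope (w : R) : 0 < w -> exists2 a, 0 < a & forall x t,
  0 <= x <= 1 -> 0 <= t <= T -> (forall i, w <= `|x - kap i t|) ->
  `|b (x, t)| <= a -> a <= bx (x, t).
Proof.
move=> w0.
pose K : set (R * R) := (`[0, 1] `*` `[0, T]) `&`
  \bigcap_(i in [set: 'I_N.+1]) [set z | w <= `|z.1 - kap i (clamp 0 T z.2)|].
have cK : compact K.
  apply: compact_closedI; first exact: box_compact.
  apply: closed_bigI => i _.
  rewrite (_ : [set z | _] = (fun z : R * R => `|z.1 - kap i (clamp 0 T z.2)|) @^-1` [set y | w <= y]) //.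
  apply: closed_comp => [z _|]; last exact: closed_ge.
  apply: cvg_norm; apply: cvgB; first exact: cvg_fst.
  by apply: (@continuous_comp _ _ _ snd (fun t => kap i (clamp 0 T t))); [exact: cvg_snd|exact: ck].
have inK x t : 0 <= x <= 1 -> 0 <= t <= T -> (forall i, w <= `|x - kap i t|) -> K (x, t).
  move=> x01 tT h; split; first by split; rewrite /= in_itv.
  by move=> i _ /=; rewrite clamp_id.
have [K0|nK] := pselect (K !=set0); last first.
  by exists 1 => // x t x01 tT h; case: nK; exists (x, t); exact: inK.
pose G z := Num.max `|b z| (bx z).
have cG : continuous G.
  move=> z; apply: (@continuous_max _ _ (fun z => `|b z|) bx); last exact: cbx.
  by apply: cvg_norm; exact: cb.
have [[x0 t0]] := compact_EVT_min K0 cK (continuous_subspaceT cG).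
rewrite inE => -[[/=]]; rewrite !in_itv /= => x01 t0T h0 Gmin.
have G0 : 0 < G (x0, t0).
  rewrite /G lt_max normr_gt0; have [E|//] := eqVneq (b (x0, t0)) 0.
  rewrite /= lt_neqAle eq_sym; apply/andP; split; first by apply/eqP; exact: nd.
  rewrite leNgt; apply/negP => neg.
  have : crit_max b bx x0 t0 by split; rewrite ?E.
  move=> /(crit x01 t0T)[i Ei].
  by have := h0 i I; rewrite /= clamp_id // -Ei subrr normr0 leNgt w0.
exists (G (x0, t0) / 2); first by rewrite divr_gt0.
move=> x t hx ht hK hb.
have : G (x0, t0) <= G (x, t) by apply: Gmin; rewrite inE; exact: inK.
by rewrite {2}/G le_max => /orP[|]; lra.
Qed.

Section Mono.
Context (a w : R).
Hypothesis a0 : 0 < a.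
Hypothesis hs : forall x t, 0 <= x <= 1 -> 0 <= t <= T -> (forall i, w <= `|x - kap i t|) ->
  `|b (x, t)| <= a -> a <= bx (x, t).

Definition off_curves (x y t : R) : Prop :=
  forall s, x <= s <= y -> forall i, w <= `|s - kap i t|.

(** While the drift is below [a] in absolute value it grows at rate at least
    [a]; the crossing argument shows that it stays above the line of slope [a /
    2] even after leaving this range. *)
Lemma mono_right x y t : 0 <= x -> x <= y -> y <= 1 -> 0 <= t <= T -> off_curves x y t ->
  `|b (x, t)| <= a / 2 -> a / 2 * (y - x) <= b (y, t) - b (x, t).
Proof.
move=> x0 xy y1 tT cl bx2; have ap := a0.
have h : 0 <= b (y, t) - b (x, t) - a / 2 * (y - x).
  apply: (@cross_right_der _ (fun s => b (s, t) - b (x, t) - a / 2 * (s - x))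
    (fun s => bx (s, t) - 0 - a / 2 * (1 - 0)) x y xy).
  - move=> s sxy; apply: has_derB; last first.
      by apply: has_derZ; apply: has_derB; [exact: has_der_id|exact: has_der_cst].
    by apply: has_derB; [exact: (slice_der_subset _ db)|exact: has_der_cst].
  - by rewrite subrr subrr mulr0 subrr.
  move=> s sxy E.
  have sx : 0 <= a / 2 * (s - x) <= a / 2.
    have s1 : 0 <= s - x <= 1 by lra.
    by rewrite mulr_ge0 ?ler_piMr //; lra.
  have : a <= bx (s, t).
    apply: hs => //; [lra|by apply: cl; lra|].
    by move: bx2; rewrite !ler_norml; lra.
  lra.
lra.
Qed.

Lemma mono_left x y t : 0 <= x -> x <= y -> y <= 1 -> 0 <= t <= T -> off_curves x y t ->
  `|b (y, t)| <= a / 2 -> a / 2 * (y - x) <= b (y, t) - b (x, t).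
Proof.
move=> x0 xy y1 tT cl bx2; have ap := a0.
have h : 0 <= b (y, t) - b (x, t) - a / 2 * (y - x).
  apply: (@cross_left_der _ (fun s => b (y, t) - b (s, t) - a / 2 * (y - s))
    (fun s => 0 - bx (s, t) - a / 2 * (0 - 1)) x y xy).
  - move=> s sxy; apply: has_derB; last first.
      by apply: has_derZ; apply: has_derB; [exact: has_der_cst|exact: has_der_id].
    by apply: has_derB; [exact: has_der_cst|exact: (slice_der_subset _ db)].
  - by rewrite subrr subrr mulr0 subrr.
  move=> s sxy E.
  have sx : 0 <= a / 2 * (y - s) <= a / 2.
    have s1 : 0 <= y - s <= 1 by lra.
    by rewrite mulr_ge0 ?ler_piMr //; lra.
  have : a <= bx (s, t).
    apply: hs => //; [lra|by apply: cl; lra|].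
    by move: bx2; rewrite !ler_norml; lra.
  lra.
lra.
Qed.

(** A level [c] of absolute value at most [a] can only be crossed upwards. *)
Lemma level_right c x y t : 0 <= x -> x <= y -> y <= 1 -> 0 <= t <= T -> off_curves x y t ->
  `|c| <= a -> c <= b (x, t) -> c <= b (y, t).
Proof.
move=> x0 xy y1 tT cl ca cbx'; have ap := a0.
have h : 0 <= b (y, t) - c.
  apply: (@cross_right_der _ (fun s => b (s, t) - c) (fun s => bx (s, t) - 0) x y xy).
  - by move=> s sxy; apply: has_derB; [exact: (slice_der_subset _ db)|exact: has_der_cst].
  - lra.
  move=> s sxy E; have Es : b (s, t) = c by lra.
  have : a <= bx (s, t) by apply: hs => //; [lra|by apply: cl; lra|rewrite Es].
  lra.
lra.
Qed.

Lemma level_left c x y t : 0 <= x -> x <= y -> y <= 1 -> 0 <= t <= T -> off_curves x y t ->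
  `|c| <= a -> b (y, t) <= c -> b (x, t) <= c.
Proof.
move=> x0 xy y1 tT cl ca cbx'; have ap := a0.
have h : 0 <= c - b (x, t).
  apply: (@cross_left_der _ (fun s => c - b (s, t)) (fun s => 0 - bx (s, t)) x y xy).
  - by move=> s sxy; apply: has_derB; [exact: has_der_cst|exact: (slice_der_subset _ db)].
  - lra.
  move=> s sxy E; have Es : b (s, t) = c by lra.
  have : a <= bx (s, t) by apply: hs => //; [lra|by apply: cl; lra|rewrite Es].
  lra.
lra.
Qed.
End Mono.
End Geometry.

(** * Periodic curves in the gaps between maxima *)

Lemma grid_time (R : realType) (T h : R) n j : 0 < h -> n%:R * h = T ->
  (j <= 2 * n)%N -> 0 <= j%:R * h <= 2 * T.
Proof.
move=> h0 nh jn; rewrite mulr_ge0 ?(ltW h0) //= -nh mulrA ler_pM2r //.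
by rewrite -natrM ler_nat.
Qed.

(** Let the drift at step [k] be above [a / 4]. Monotonicity to the right, and
    continuity in time over a window of length [tau], keep it above [a / 8]
    along the polygon followed backward in time, so that the polygon moves to
    the right with speed at least [alpha a / 8]. In time [tau / 2] it would
    cover a distance greater than 1. *)
Lemma euler_window (R : realType) (T w a Lam B d tau al h : R) (n : nat)
    (b : R * R -> R) (l u : R -> R) (Y : nat -> R) :
  0 < w -> 0 < a -> 0 <= Lam ->
  (forall x t y s, 0 <= x <= 1 -> 0 <= t <= 2 * T -> 0 <= y <= 1 -> 0 <= s <= 2 * T ->
    `|x - y| < d -> `|t - s| < d -> `|b (x, t) - b (y, s)| < a / 8) ->
  (forall s t, 0 <= s <= 2 * T -> 0 <= t <= 2 * T -> `|l s - l t| <= Lam * `|s - t|) ->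
  (forall s t, 0 <= s <= 2 * T -> 0 <= t <= 2 * T -> `|u s - u t| <= Lam * `|s - t|) ->
  (forall t, 0 <= t <= 2 * T -> 0 <= l t /\ u t <= 1) ->
  (forall x y t, 0 <= t <= 2 * T -> l t + w <= x -> x <= y -> y <= u t - w ->
    a / 4 <= b (x, t) -> a / 4 <= b (y, t)) ->
  (forall x t, 0 <= x <= 1 -> 0 <= t <= 2 * T -> `|b (x, t)| <= B) ->
  0 < tau -> tau < d -> Lam * tau <= w -> tau <= T ->
  0 < h -> n%:R * h = T -> h <= tau / 2 -> 0 < al -> 32 < al * a * tau -> al * h * B < d ->
  (forall k, (k < 2 * n)%N -> Y k.+1 = Y k - al * h * b (Y k, k%:R * h)) ->
  (forall k, (k <= 2 * n)%N ->
     l (k%:R * h) + 2 * w <= Y k /\ Y k <= u (k%:R * h) - 2 * w) ->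
  forall k, (n <= k <= 2 * n)%N -> b (Y k, k%:R * h) <= a / 4.
Proof.
move=> w0 a0 L0 osc lipl lipu lu lev bB tau0 taud Ltau tauT h0 nh htau al0 alt alh rec inN.
move=> k /andP[nk k2n]; rewrite leNgt; apply/negP => bk.
have time j := @grid_time R T h n j h0 nh.
have Y01 j : (j <= 2 * n)%N -> 0 <= Y j <= 1.
  by move=> jn; have [h1 h2] := inN j jn; have [h3 h4] := lu _ (time j jn); move: h1 h2 h3 h4 w0; clear; lra.
have claim j : (j <= k)%N -> j%:R * h <= tau -> Y k + j%:R * h * (al * a / 8) <= Y (k - j)%N.
  elim: j => [|j IH] jk jt; first by rewrite subn0 !mul0r addr0.
  have jh : j%:R * h <= tau.
    by apply: le_trans jt; rewrite ler_pM2r // ler_nat.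
  have {}IH := IH (ltnW jk) jh.
  have [i [E1 E2]] : exists i, (k - j)%N = i.+1 /\ (k - j.+1)%N = i.
    by exists (k - j.+1)%N; rewrite subnSK.
  rewrite E2; rewrite E1 in IH.
  have i2n : (i.+1 <= 2 * n)%N by rewrite -E1 (leq_trans (leq_subr _ _)).
  have i2n' := ltnW i2n.
  have ti : k%:R * h - i.+1%:R * h = j%:R * h.
    by rewrite -mulrBl -natrB ?E1; [congr (_%:R * _); rewrite -E1 subKn // ltnW|rewrite -E1 leq_subr].
  have ti' : k%:R * h - i%:R * h = j.+1%:R * h.
    by rewrite -mulrBl -natrB ?E2; [congr (_%:R * _); rewrite -E2 subKn|rewrite -E2 leq_subr].
  have tk := time k k2n; have tti := time _ i2n; have tti' := time _ i2n'.
  have jh0 : 0 <= j%:R * h by rewrite mulr_ge0 // ltW.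
  have jjh0 : 0 <= j.+1%:R * h by rewrite mulr_ge0 // ltW.
  have Yi := Y01 i i2n'; have Yi1 := Y01 i.+1 i2n.
  have [Nk1 Nk2] := inN k k2n; have [Ni1 Ni2] := inN i.+1 i2n.
  have Lj : Lam * (j%:R * h) <= w by apply: le_trans Ltau; rewrite ler_wpM2l.
  have dl := lipl _ _ tk tti; have du := lipu _ _ tk tti.
  rewrite ti (ger0_norm jh0) in dl du.
  have {}dl := le_trans dl Lj; have {}du := le_trans du Lj.
  move: dl du; rewrite !ler_norml => /andP[dl1 dl2] /andP[du1 du2].
  have prod0 : 0 <= j%:R * h * (al * a / 8) by rewrite mulr_ge0 // divr_ge0 // mulr_ge0 // ltW.
  have big : a / 4 <= b (Y i.+1, k%:R * h).
    apply: (lev (Y k)) => //; last exact: ltW.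
    + by move: Nk1 dl1 dl2 w0; clear; lra.
    + by apply: le_trans IH; rewrite lerDl.
    by move: Ni2 du1 du2 w0; clear; lra.
  have dY : `|Y i - Y i.+1| < d.
    rewrite rec // opprB addrC subrK !normrM (gtr0_norm al0) (gtr0_norm h0).
    apply: le_lt_trans alh; apply: ler_wpM2l; last exact: bB.
    by rewrite mulr_ge0 // ltW.
  have dt : `|i%:R * h - k%:R * h| < d by rewrite distrC ti' ger0_norm //; apply: le_lt_trans taud.
  have := osc _ _ _ _ Yi tti' Yi1 tk dY dt; rewrite ltr_norml => /andP[q1 _].
  have bi : a / 8 <= b (Y i, i%:R * h) by move: q1 big; clear; lra.
  have E : Y i = Y i.+1 + al * h * b (Y i, i%:R * h) by rewrite rec // subrK.
  have alh0 : 0 < al * h by rewrite mulr_gt0.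
  have step : al * h * (a / 8) <= al * h * b (Y i, i%:R * h) by rewrite ler_pM2l.
  rewrite E; apply: (le_trans _ (lerD IH step)).
  by rewrite -natr1; clear; lra.
pose J := Num.truncn (tau / h).
have q0 : 0 <= tau / h by rewrite divr_ge0 ?ltW.
have /andP[J1 J2] := truncn_itv q0.
have Jt : J%:R * h <= tau by rewrite -ler_pdivlMr.
have Jt2 : tau / 2 <= J%:R * h.
  by move: J2 htau; rewrite ltr_pdivrMr // -natr1 -/J; clear; lra.
have Jn : (J <= k)%N.
  apply: leq_trans nk; rewrite -(ler_nat R) -(ler_pM2r h0) nh; exact: le_trans tauT.
have cl := claim J Jn Jt.
have kJ : (k - J <= 2 * n)%N by rewrite (leq_trans (leq_subr _ _)).
have Yk := Y01 k k2n; have YkJ := Y01 _ kJ.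
have al8 : 0 < al * a / 8 by rewrite divr_gt0 // mulr_gt0.
have : tau / 2 * (al * a / 8) <= J%:R * h * (al * a / 8) by rewrite ler_pM2r.
move: cl Yk YkJ alt; clear; lra.
Qed.

Section Polygon.
Context (R : realType) (h : R).
Hypothesis h0 : 0 < h.
Implicit Types (v : nat -> R).

(** A closed formula for the polygon with initial value [y0] and slope [v k] on
    [[k h, (k + 1) h]]: each clamped term is constant outside its own cell. *)
Definition polygon (n : nat) v (y0 t : R) : R :=
  y0 + \sum_(k < n) v k * clamp 0 h (t - k%:R * h).

Lemma polygon_continuous n v y0 : continuous (polygon n v y0).
Proof.
have c k : continuous (fun t => v k * clamp 0 h (t - k%:R * h)).
  move=> t; apply: cvgM; first exact: cvg_cst.
  apply: (@continuous_comp _ _ _ (fun t => t - k%:R * h) (clamp 0 h)); last exact: clamp_cont.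
  by apply: cvgB; [exact: cvg_id|exact: cvg_cst].
have S : continuous (fun t => \sum_(k < n) v k * clamp 0 h (t - k%:R * h)).
  elim: n => [|n IH].
    by under eq_fun do rewrite big_ord0; exact: cst_continuous.
  under eq_fun do rewrite big_ord_recr /=.
  by move=> t; apply: cvgD; [exact: IH|exact: c].
by move=> t; apply: cvgD; [exact: cvg_cst|exact: S].
Qed.

Lemma polygonE n v y0 k t : (k < n)%N -> k%:R * h <= t <= k.+1%:R * h ->
  polygon n v y0 t = y0 + \sum_(j < k) v j * h + v k * (t - k%:R * h).
Proof.
move=> kn /andP[t1 t2]; rewrite /polygon -addrA; congr (_ + _).
rewrite -!(big_mkord xpredT (fun j => v j * clamp 0 h (t - j%:R * h))).
rewrite -(big_mkord xpredT (fun j => v j * h)).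
rewrite (@big_cat_nat _ _ _ k) //=; last exact: ltnW.
rewrite [X in _ + X]big_ltn //; congr (_ + _).
  apply: eq_big_nat => j /andP[_ jk]; rewrite clamp_hi ?(ltW h0) //.
  have : j.+1%:R * h <= k%:R * h by rewrite ler_pM2r // ler_nat.
  by rewrite -natr1; lra.
rewrite clamp_id; last by move: t2; rewrite -natr1; lra.
rewrite big_nat_cond big1 ?addr0 // => j /andP[/andP[kj _] _].
rewrite clamp_lo ?mulr0 ?(ltW h0) // subr_le0; apply: le_trans t2 _.
by rewrite ler_pM2r // ler_nat.
Qed.

Lemma grid_cell n (t : R) : 0 < t <= n%:R * h ->
  exists2 k, (k < n)%N & k%:R * h < t <= k.+1%:R * h.
Proof.
elim: n => [|n IH] /andP[t0 tn]; first by rewrite mul0r in tn; lra.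
have [tn'|tn'] := leP t (n%:R * h).
  by have [|k kn hk] := IH; [rewrite t0|exists k => //; rewrite ltnS ltnW].
by exists n => //; rewrite tn' tn.
Qed.

Lemma polygon_der n v y0 k t : (k < n)%N -> k%:R * h < t <= k.+1%:R * h ->
  has_der `[0, t] (polygon n v y0) t (v k).
Proof.
move=> kn /andP[kt tk] e e0; exists (t - k%:R * h); first by rewrite subr_gt0.
move=> s; rewrite /= in_itv /= => /andP[s0 st]; rewrite ler0_norm ?subr_le0 // => ss.
rewrite (@polygonE n v y0 k s) //; last by apply/andP; split; lra.
rewrite (@polygonE n v y0 k t) //; last by rewrite ltW.
set S := \sum_(j < k) _.
have -> : y0 + S + v k * (s - k%:R * h) - (y0 + S + v k * (t - k%:R * h)) - v k * (s - t) = 0 by ring.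
by rewrite normr0 mulr_ge0 ?(ltW e0) //; lra.
Qed.
End Polygon.

Section Euler.
Context (R : realType).

(** Explicit Euler steps of length [h] for the flow [y' = - alpha b(y, t)]. *)
Fixpoint euler (al h : R) (b : R * R -> R) (y0 : R) (k : nat) : R :=
  match k with
  | 0%N => y0
  | k'.+1 => euler al h b y0 k' - al * h * b (euler al h b y0 k', k'%:R * h)
  end.

Lemma euler_continuous al h (b : R * R -> R) k : continuous b ->
  continuous (fun y0 => euler al h b y0 k).
Proof.
move=> cb; elim: k => [|k IH] /=; first by move=> x; exact: cvg_id.
move=> x; apply: cvgB; first exact: IH.
apply: cvgM; first exact: cvg_cst.
apply: (@continuous_comp _ _ _ (fun y0 => (euler al h b y0 k, k%:R * h)) b); last exact: cb.
by apply: cont_pair => z; [exact: IH|exact: cvg_cst].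
Qed.

Lemma euler_sum al h (b : R * R -> R) y0 k :
  y0 + \sum_(j < k) (- al * b (euler al h b y0 j, j%:R * h)) * h = euler al h b y0 k.
Proof.
elim: k => [|k IH]; first by rewrite big_ord0 addr0.
by rewrite big_ord_recr /= addrA IH; ring.
Qed.

Lemma euler_periodic (T al h y0 : R) (b : R * R -> R) n :
  (forall x t, b (x, t + T) = b (x, t)) -> n%:R * h = T -> euler al h b y0 n = y0 ->
  forall k, euler al h b y0 (k + n) = euler al h b y0 k.
Proof.
move=> per nh fix0; elim=> [|k IH]; first by rewrite add0n fix0.
by rewrite addSn /= IH natrD mulrDl nh per.
Qed.

(** A periodic curve such that, in coordinates moving with it, the drift on [D]
    points away from it at rate at least [alpha a1], up to an error [eta]. *)
Definition hump_curve (T al a1 eta : R) (b : R * R -> R) (D : R -> R -> Prop) (y : R -> R) : Prop :=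
  [/\ continuous y, y T = y 0, forall t, 0 <= t <= T -> 0 <= y t <= 1 &
    forall t, 0 < t <= T -> exists2 v, has_der `[0, t] y t v &
      forall x, 0 <= x <= 1 -> D x t ->
        al * a1 * (x - y t) ^+ 2 - eta * `|x - y t| <= (x - y t) * (v + al * b (x, t))].

(** The region between two consecutive curves [l] and [u] of maxima. Times run
    over two periods, so that each time in the second one has a full period
    before it. The drift pushes polygons of [y' = - alpha b] into the gap at its
    edges ([gf_edgel], [gf_edger]); inside, small values of [b] are crossed only
    upwards ([gf_levr], [gf_levl], [gf_mono]). *)
Record gap_flow (T w a c Lam : R) (b : R * R -> R) (l u : R -> R) : Prop := GapFlow {
  gf_T0 : 0 < T;
  gf_cb : continuous b;
  gf_per : forall x t : R, b (x, t + T) = b (x, t);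
  gf_w0 : 0 < w;
  gf_a0 : 0 < a;
  gf_c0 : 0 < c;
  gf_L0 : 0 <= Lam;
  gf_lipl : forall s t : R, 0 <= s <= 2 * T -> 0 <= t <= 2 * T -> `|l s - l t| <= Lam * `|s - t|;
  gf_lipu : forall s t : R, 0 <= s <= 2 * T -> 0 <= t <= 2 * T -> `|u s - u t| <= Lam * `|s - t|;
  gf_lu : forall t : R, 0 <= t <= 2 * T -> [/\ 0 <= l t, u t <= 1 & 8 * w <= u t - l t];
  gf_lT : l T = l 0;
  gf_uT : u T = u 0;
  gf_edgel : forall x t : R, 0 <= t <= 2 * T -> l t + 2 * w <= x <= l t + 3 * w -> b (x, t) <= - c;
  gf_edger : forall x t : R, 0 <= t <= 2 * T -> u t - 3 * w <= x <= u t - 2 * w -> c <= b (x, t);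
  gf_levr : forall x y t : R, 0 <= t <= 2 * T -> l t + w <= x -> x <= y -> y <= u t - w ->
    a / 4 <= b (x, t) -> a / 4 <= b (y, t);
  gf_levl : forall x y t : R, 0 <= t <= 2 * T -> l t + w <= x -> x <= y -> y <= u t - w ->
    b (y, t) <= - (a / 4) -> b (x, t) <= - (a / 4);
  gf_mono : forall x y t : R, 0 <= t <= 2 * T -> l t + w <= x <= u t - w ->
    l t + w <= y <= u t - w -> `|b (y, t)| <= a / 2 ->
    a / 2 * (x - y) ^+ 2 <= (x - y) * (b (x, t) - b (y, t))
}.

(** The requirements on the step [h] and on the length [tau] of the backward
    time window. The number 32 makes [tau / 2] times the speed [al a / 8] exceed
    2. *)
Record euler_step (T w a c Lam d tau al h B : R) (b : R * R -> R) (l u : R -> R) (n : nat) :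
    Prop := EulerStep {
  es_flow : gap_flow T w a c Lam b l u;
  es_osc : forall x t y s : R, 0 <= x <= 1 -> 0 <= t <= 2 * T -> 0 <= y <= 1 ->
    0 <= s <= 2 * T -> `|x - y| < d -> `|t - s| < d -> `|b (x, t) - b (y, s)| < a / 8;
  es_bound : forall x t : R, 0 <= x <= 1 -> 0 <= t <= 2 * T -> `|b (x, t)| <= B;
  es_tau0 : 0 < tau;
  es_taud : tau < d;
  es_tauL : Lam * tau <= w;
  es_tauT : tau <= T;
  es_h0 : 0 < h;
  es_nh : n%:R * h = T;
  es_htau : h <= tau / 2;
  es_al0 : 0 < al;
  es_altau : 32 < al * a * tau;
  es_alhB : al * h * B < d;
  es_alc : Lam <= al * c;
  es_small : al * h * B + Lam * h <= w
}.

(** At the edges of the gap the step is directed inwards and, for large [alpha],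
    is at least as long as the displacement of the edge during one step. *)
Lemma euler_invariant (T w a c Lam d tau al h B y0 : R) (b : R * R -> R) (l u : R -> R) n :
  euler_step T w a c Lam d tau al h B b l u n ->
  l 0 + 2 * w <= y0 <= u 0 - 2 * w ->
  forall k, (k <= 2 * n)%N -> l (k%:R * h) + 2 * w <= euler al h b y0 k /\
    euler al h b y0 k <= u (k%:R * h) - 2 * w.
Proof.
move=> S hy0; have [G Hd bB tau0 taud tauL tauT h0 nh m1 al0 alt s2 Lc small] := S.
have [T0 cb per w0 a0 c0 L0 lipl lipu lu lT uT edgel edger levr levl mono] := G.
have time j := @grid_time R T h n j h0 nh.
elim=> [|k IH] kn; first by rewrite mul0r /=; move: hy0 => /andP[].
have [h1 h2] := IH (ltnW kn).
have tk := time k (ltnW kn); have tk1 := time k.+1 kn.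
have dt : k.+1%:R * h - k%:R * h = h by rewrite -natr1; ring.
have dl := lipl _ _ tk1 tk; have du := lipu _ _ tk1 tk.
rewrite dt (gtr0_norm h0) in dl du.
have /ler_normlP[dl1 dl2] := dl; have /ler_normlP[du1 du2] := du.
have [l1 u1 ulw] := lu _ tk.
rewrite /=; set Y := euler al h b y0 k in h1 h2 *; set t := k%:R * h in tk dl1 dl2 du1 du2 l1 u1 ulw h1 h2 *.
have Y01 : 0 <= Y <= 1 by move: h1 h2 l1 u1 w0; clear; lra.
have alh : 0 < al * h by rewrite mulr_gt0.
have bY : `|b (Y, t)| <= B by exact: bB.
have sz : `|al * h * b (Y, t)| <= al * h * B.
  by rewrite normrM (gtr0_norm alh) ler_pM2l.
move: sz; rewrite ler_norml => /andP[sz1 sz2].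
have Lh : Lam * h <= al * h * c.
  by rewrite (_ : al * h * c = al * c * h); [rewrite ler_pM2r|ring].
have Lh0 : 0 <= Lam * h by rewrite mulr_ge0 // ltW.
split.
  have [hY|hY] := leP Y (l t + 3 * w); last by move: hY dl1 dl2 sz1 sz2 small; clear; lra.
  have : b (Y, t) <= - c by apply: edgel => //; move: hY h1; clear; lra.
  move=> hb; have : al * h * b (Y, t) <= al * h * - c by rewrite ler_pM2l.
  by move: h1 dl1 dl2 Lh; clear; lra.
have [hY|hY] := leP (u t - 3 * w) Y; last by move: hY du1 du2 sz1 sz2 small; clear; lra.
have : c <= b (Y, t) by apply: edger => //; move: hY h2; clear; lra.
move=> hb; have : al * h * c <= al * h * b (Y, t) by rewrite ler_pM2l.
by move: h2 du1 du2 Lh; clear; lra.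
Qed.

(** The map over one period sends the initial interval into itself. *)
Lemma euler_fixed (T w a c Lam d tau al h B : R) (b : R * R -> R) (l u : R -> R) n :
  euler_step T w a c Lam d tau al h B b l u n ->
  exists2 y0, l 0 + 2 * w <= y0 <= u 0 - 2 * w & euler al h b y0 n = y0.
Proof.
move=> S; have [G Hd HB tau0 taud tauL tauT h0 nh m1 al0 alt s2 alc s1] := S.
have [T0 cb per w0 a0 c0 L0 lipl lipu lu lT uT edgel edger levr levl mono] := G.
have t0T2 : (0 : R) <= 0 <= 2 * T by rewrite lexx mulr_ge0 // ltW.
pose g y := euler al h b y n - y.
have cg : continuous g.
  by move=> y; apply: cvgB; [exact: euler_continuous|exact: cvg_id].
have [_ _ ulw] := lu _ t0T2.
have ab : l 0 + 2 * w <= u 0 - 2 * w by move: ulw w0; clear; lra.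
have nn : (n <= 2 * n)%N by rewrite leq_pmull.
have inv y (hy : l 0 + 2 * w <= y <= u 0 - 2 * w) :=
  euler_invariant S hy nn.
have ga : 0 <= g (l 0 + 2 * w).
  have hy : l 0 + 2 * w <= l 0 + 2 * w <= u 0 - 2 * w by rewrite lexx ab.
  by have [+ _] := inv _ hy; rewrite nh lT /g subr_ge0.
have gb : g (u 0 - 2 * w) <= 0.
  have hy : l 0 + 2 * w <= u 0 - 2 * w <= u 0 - 2 * w by rewrite lexx ab.
  by have [_ +] := inv _ hy; rewrite nh uT /g subr_le0.
have h01 : Num.min (g (l 0 + 2 * w)) (g (u 0 - 2 * w)) <= 0 <= Num.max (g (l 0 + 2 * w)) (g (u 0 - 2 * w)).
  by rewrite ge_min le_max gb ga orbT.
have [y] := IVT ab (continuous_subspaceT cg) h01.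
rewrite in_itv /= => hy gy; exists y => //.
by apply/eqP; rewrite -subr_eq0; apply/eqP.
Qed.

(** Reflection [x |-> 1 - x] of [euler_window]. *)
Lemma euler_lower (T w a c Lam d tau al h B y0 : R) (b : R * R -> R) (l u : R -> R) n :
  euler_step T w a c Lam d tau al h B b l u n ->
  (forall k, (k <= 2 * n)%N -> l (k%:R * h) + 2 * w <= euler al h b y0 k /\
    euler al h b y0 k <= u (k%:R * h) - 2 * w) ->
  forall k, (n <= k <= 2 * n)%N -> - (a / 4) <= b (euler al h b y0 k, k%:R * h).
Proof.
move=> S inN k hk; have [G Hd HB tau0 taud tauL tauT h0 nh m1 al0 alt s2 alc s1] := S.
have [T0 cb per w0 a0 c0 L0 lipl lipu lu lT uT edgel edger levr levl mono] := G.
rewrite -[euler al h b y0 k](subKr 1) lerNl.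
apply: (@euler_window _ T w a Lam B d tau al h n (fun z => - b (1 - z.1, z.2))
    (fun t => 1 - u t) (fun t => 1 - l t) (fun k => 1 - euler al h b y0 k)) => //.
- move=> x t z s x01 tT z01 sT xz ts /=.
  rewrite -opprD normrN -[X in `|X|]opprK opprD opprK addrC normrN.
  rewrite distrC; apply: Hd => //; [by move: x01; clear; lra|by move: z01; clear; lra|].
  by rewrite (_ : 1 - x - (1 - z) = - (x - z)) ?normrN //; ring.
- move=> s t sT tT; rewrite (_ : 1 - u s - (1 - u t) = - (u s - u t)); last by ring.
  by rewrite normrN; exact: lipu.
- move=> s t sT tT; rewrite (_ : 1 - l s - (1 - l t) = - (l s - l t)); last by ring.
  by rewrite normrN; exact: lipl.
- by move=> t tT; have [] := lu _ tT; clear; split; lra.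
- move=> x z t tT hx xz hz /= hb.
  have : b (1 - z, t) <= - (a / 4) -> a / 4 <= - b (1 - z, t) by clear; lra.
  by apply; apply: (levl (1 - z) (1 - x)) => //; move: hx xz hz hb; clear; lra.
- by move=> x t x01 tT /=; rewrite normrN; apply: HB => //; move: x01; clear; lra.
- by move=> j jn /=; rewrite subKr /=; ring.
by move=> j jn; have := inN j jn; clear; lra.
Qed.

(** A closed polygon can be followed backward through a whole period, so that
    the bounds for the second period hold for the first one too. *)
Lemma euler_small (T w a c Lam d tau al h B y0 : R) (b : R * R -> R) (l u : R -> R) n :
  euler_step T w a c Lam d tau al h B b l u n ->
  (forall k, (k <= 2 * n)%N -> l (k%:R * h) + 2 * w <= euler al h b y0 k /\
    euler al h b y0 k <= u (k%:R * h) - 2 * w) ->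
  euler al h b y0 n = y0 ->
  forall k, (k <= n)%N -> `|b (euler al h b y0 k, k%:R * h)| <= a / 4.
Proof.
move=> S inN fix0 k kn; have [G Hd HB tau0 taud tauL tauT h0 nh m1 al0 alt s2 alc s1] := S.
have [T0 cb per w0 a0 c0 L0 lipl lipu lu lT uT edgel edger levr levl mono] := G.
have kk : (n <= k + n <= 2 * n)%N by rewrite leq_addl mul2n -addnn leq_add2r.
have E : b (euler al h b y0 (k + n)%N, (k + n)%:R * h) = b (euler al h b y0 k, k%:R * h).
  by rewrite (euler_periodic per nh fix0) natrD mulrDl nh per.
have dn := euler_lower S inN kk.
have up : b (euler al h b y0 (k + n)%N, (k + n)%:R * h) <= a / 4.
  apply: (@euler_window _ T w a Lam B d tau al h n b l u (euler al h b y0)) => //.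
  by move=> t tT; have [] := lu _ tT.
by move: up dn; rewrite E ler_norml => -> ->.
Qed.

(** On each cell the polygon has the slope [- alpha b] evaluated at the last
    node. By uniform continuity this differs from the value at the current point
    by less than [e2], which the error [eta] absorbs. *)
Lemma polygon_hump (T w a c Lam d tau d2 e2 al h B y0 eta : R) (b : R * R -> R) (l u : R -> R)
    (n : nat) : euler_step T w a c Lam d tau al h B b l u n ->
  (forall x t y s : R, 0 <= x <= 1 -> 0 <= t <= 2 * T -> 0 <= y <= 1 -> 0 <= s <= 2 * T ->
    `|x - y| < d2 -> `|t - s| < d2 -> `|b (x, t) - b (y, s)| < e2) ->
  al * h * B < d2 -> h < d2 -> e2 <= a / 8 -> al * e2 <= eta -> (0 < n)%N ->
  (forall k, (k <= 2 * n)%N -> l (k%:R * h) + 2 * w <= euler al h b y0 k /\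
    euler al h b y0 k <= u (k%:R * h) - 2 * w) ->
  euler al h b y0 n = y0 ->
  hump_curve T al (a / 2) eta b (fun x t => l t + 2 * w <= x <= u t - 2 * w)
    (polygon h n (fun k => - al * b (euler al h b y0 k, k%:R * h)) y0).
Proof.
move=> S Hd2 s3 s4 e2a e2e n0 inN fix0; have bd := euler_small S inN fix0.
have [G _ HB _ _ _ _ h0 nh _ al0 _ _ _ s1] := S.
have [T0 cb per w0 a0 c0 L0 lipl lipu lu lT uT edgel edger levr levl mono] := G.
pose Y := euler al h b y0.
pose v k := - al * b (Y k, k%:R * h).
pose y := polygon h n v y0.
rewrite -/Y -/v -/y.
have cell k t : (k < n)%N -> k%:R * h <= t <= k.+1%:R * h -> y t = Y k + v k * (t - k%:R * h).
  by move=> kn kt; rewrite /y (polygonE _ _ _ kn kt) // /v euler_sum.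
have Y01 k : (k <= 2 * n)%N -> 0 <= Y k <= 1.
  move=> kn; have [i1 i2] := inN _ kn; have [l1 u1 _] := lu _ (grid_time h0 nh kn).
  by move: i1 i2 l1 u1 w0; rewrite /Y; clear; lra.
have cell_dist k t : k%:R * h <= t <= k.+1%:R * h -> `|t - k%:R * h| <= h.
  by rewrite -natr1 => kt; rewrite ger0_norm; move: kt; clear; lra.
have le2n k : (k < n)%N -> (k <= 2 * n)%N.
  by move=> kn; rewrite ltnW // (leq_trans kn) // leq_pmull.
have close k t : (k < n)%N -> k%:R * h <= t <= k.+1%:R * h -> `|y t - Y k| <= al * h * B.
  move=> kn kt; rewrite (cell _ _ kn kt) addrC addKr.
  rewrite normrM /v normrM normrN (gtr0_norm al0).
  rewrite (_ : al * h * B = al * B * h); last by ring.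
  apply: ler_pM => //; [by rewrite mulr_ge0 // ltW| |exact: cell_dist].
  rewrite ler_pM2l //; apply: HB; first by apply: Y01; exact: le2n.
  exact: (grid_time h0 nh (le2n _ kn)).
have polygon_in t : 0 < t <= T -> exists2 k, (k < n)%N /\ k%:R * h < t <= k.+1%:R * h &
    [/\ l t + w <= y t <= u t - w, `|b (y t, t)| <= a / 2 &
       `|b (y t, t) - b (Y k, k%:R * h)| < e2].
  move=> tT; have tn : 0 < t <= n%:R * h by rewrite nh.
  have [k kn kt] := grid_cell tn; exists k => //.
  have kt' : k%:R * h <= t <= k.+1%:R * h by case/andP: kt => /ltW -> ->.
  have kn2 := le2n _ kn.
  have [i1 i2] := inN _ kn2; have tmk := grid_time h0 nh kn2.
  have t2 : 0 <= t <= 2 * T by move: tT; clear; lra.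
  have cl := close _ _ kn kt'.
  have tkn := cell_dist _ _ kt'.
  have Lt : Lam * `|t - k%:R * h| <= Lam * h by rewrite ler_wpM2l.
  have dl := le_trans (lipl _ _ t2 tmk) Lt; have du := le_trans (lipu _ _ t2 tmk) Lt.
  have F : l t + w <= y t <= u t - w.
    by move: s1 i1 i2 cl dl du; rewrite !ler_norml /Y; clear; lra.
  have y01 : 0 <= y t <= 1.
    by move: F w0; have [+ + _] := lu _ t2; clear; lra.
  have osc : `|b (y t, t) - b (Y k, k%:R * h)| < e2.
    apply: Hd2 => //; [exact: Y01|exact: le_lt_trans cl s3|].
    exact: le_lt_trans tkn s4.
  split => //.
  by move: (bd _ (ltnW kn)) e2a a0 osc; rewrite -/Y ltr_norml !ler_norml; clear; lra.
have t0T2 : (0 : R) <= 0 <= 2 * T by rewrite lexx mulr_ge0 // ltW.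
have y0E : y 0 = y0.
  rewrite (cell 0%N 0) //; last by rewrite mul0r mul1r lexx ltW.
  by rewrite mul0r subrr mulr0 addr0.
split.
- exact: polygon_continuous.
- rewrite y0E (cell n.-1 T) ?prednK //; last first.
    by rewrite nh lexx andbT -nh ler_pM2r // ler_nat leq_pred.
  rewrite -[RHS]fix0 -[in RHS](prednK n0) /= -/Y -nh -mulrBl -[in X in X - _](prednK n0) -natr1 /v.
  by rewrite (addrC _ 1) addrK; ring.
- move=> t /andP[t0 tT]; move: t0; rewrite le_eqVlt => /predU1P[<-|t0].
    by rewrite y0E; exact: (Y01 0%N).
  have tT' : 0 < t <= T by rewrite t0 tT.
  have [k _ [F _ _]] := polygon_in _ tT'; have t2 : 0 <= t <= 2 * T by move: tT'; clear; lra.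
  by move: F w0; have [+ + _] := lu _ t2; clear; lra.
move=> t tT; have [k [kn kt] [F bh osc]] := polygon_in _ tT.
exists (v k); first exact: polygon_der.
move=> x x01 xD; have t2 : 0 <= t <= 2 * T by move: tT; clear; lra.
have xF : l t + w <= x <= u t - w by move: xD w0; clear; lra.
have M := mono _ _ _ t2 xF F bh.
have A : - (eta * `|x - y t|) <= (x - y t) * (al * (b (y t, t) - b (Y k, k%:R * h))).
  rewrite lerNl -mulrN; apply: le_trans (ler_norm _) _.
  rewrite normrM mulrC ler_wpM2r // normrN normrM (gtr0_norm al0).
  by apply: le_trans e2e; rewrite ler_pM2l // ltW.
have B' : al * (a / 2 * (x - y t) ^+ 2) <= al * ((x - y t) * (b (x, t) - b (y t, t))).
  by rewrite ler_pM2l.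
rewrite /v; move: A B'; clear; lra.
Qed.

Lemma interior_hump (T w a c Lam : R) (b : R * R -> R) (l u : R -> R) : gap_flow T w a c Lam b l u -> 
  exists A, forall al, A <= al -> forall eta, 0 < eta ->
  exists y, hump_curve T al (a / 2) eta b (fun x t => l t + 2 * w <= x <= u t - 2 * w) y.
Proof.
move=> G.
have [T0 cb per w0 a0 c0 L0 lipl lipu lu lT uT edgel edger levr levl mono] := G.
have [B B0 HB] := @bounded2 _ b 0 1 0 (2 * T) cb.
have a8 : 0 < a / 8 by rewrite divr_gt0.
have [d d0 Hd] := @ucont2 _ b 0 1 0 (2 * T) cb _ a8.
have L1 : 0 < Lam + 1 by rewrite ltr_wpDl.
(* during a time [tau] neither [b] at a fixed point nor the edges of the gap
   change much *)
pose tau := Num.min (d / 2) (Num.min T (w / (Lam + 1))).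
have tau0 : 0 < tau by rewrite !lt_min T0 !divr_gt0.
have [taud tauT tauL] : [/\ tau < d, tau <= T & Lam * tau <= w].
  have m1 : tau <= d / 2 by rewrite ge_min lexx.
  have m2 : tau <= T by rewrite !ge_min lexx ?orbT.
  have m3 : tau <= w / (Lam + 1) by rewrite !ge_min lexx ?orbT.
  split => //; first by move: m1 d0; clear; lra.
  by move: m3 tau0; rewrite ler_pdivlMr //; clear; lra.
have at0 : 0 < a * tau by rewrite mulr_gt0.
(* [alpha c] exceeds the speed [Lam] of the edges *)
exists (1 + 32 / (a * tau) + Lam / c) => al hal eta eta0.
have q1 : 0 < 32 / (a * tau) by rewrite divr_gt0.
have q2 : 0 <= Lam / c by rewrite divr_ge0 // ltW.
have al0 : 0 < al by move: hal q1 q2; clear; lra.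
have alt : 32 < al * a * tau.
  by rewrite -mulrA -ltr_pdivrMr //; move: hal q1 q2; clear; lra.
have alc : Lam <= al * c by rewrite -ler_pdivrMr //; move: hal q1 q2; clear; lra.
pose e2 := Num.min (a / 8) (eta / al).
have e20 : 0 < e2 by rewrite lt_min a8 divr_gt0.
have [d2 d20 Hd2] := @ucont2 _ b 0 1 0 (2 * T) cb _ e20.
have alB : 0 < al * B + Lam + 1 by rewrite addr_gt0 // ltr_wpDr // mulr_gt0.
(* the step: a whole number of steps makes up the period *)
pose h1 := Num.min (Num.min (tau / 2) (d2 / 2)) (Num.min (w / (al * B + Lam + 1))
   (Num.min (d / (al * B + Lam + 1)) (d2 / (al * B + Lam + 1)))).
have h10 : 0 < h1 by rewrite !lt_min !divr_gt0.
pose n := (Num.truncn (T / h1)).+1.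
have n0 : 0 < n%:R :> R by rewrite ltr0n.
pose h := T / n%:R.
have h0 : 0 < h by rewrite divr_gt0.
have nh : n%:R * h = T by rewrite /h; field; rewrite gt_eqF.
have hh1 : h <= h1.
  rewrite /h ler_pdivrMr // mulrC -ler_pdivrMr //; apply: ltW; exact: truncnS_gt.
have m1 : h <= tau / 2 by apply: (le_trans hh1); rewrite !ge_min lexx.
have m2 : h <= d2 / 2 by apply: (le_trans hh1); rewrite !ge_min lexx ?orbT.
have m3 : h * (al * B + Lam + 1) <= w.
  by rewrite -ler_pdivlMr //; apply: (le_trans hh1); rewrite !ge_min lexx ?orbT.
have m4 : h * (al * B + Lam + 1) <= d.
  by rewrite -ler_pdivlMr //; apply: (le_trans hh1); rewrite !ge_min lexx ?orbT.
have m5 : h * (al * B + Lam + 1) <= d2.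
  by rewrite -ler_pdivlMr //; apply: (le_trans hh1); rewrite !ge_min lexx ?orbT.
have Lh0 : 0 <= Lam * h by rewrite mulr_ge0 // ltW.
have s1 : al * h * B + Lam * h <= w by move: m3 h0; clear; lra.
have s2 : al * h * B < d by move: m4 Lh0 h0; clear; lra.
have s3 : al * h * B < d2 by move: m5 Lh0 h0; clear; lra.
have s4 : h < d2 by move: m2 d20; clear; lra.
have S : euler_step T w a c Lam d tau al h B b l u n by split.
have [y0 hy0 fix0] := euler_fixed S.
exists (polygon h n (fun k => - al * b (euler al h b y0 k, k%:R * h)) y0).
apply: (polygon_hump S Hd2 s3 s4 _ _ _ (euler_invariant S hy0) fix0) => //.
  by rewrite ge_min lexx.
by rewrite mulrC -ler_pdivlMr // ge_min lexx orbT.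
Qed.
End Euler.

(** * Algebraic inequalities for the comparison functions *)

Section Inequalities.
Context (R : realType).

(** The inequality [(L - mu) P > 0] for [P = sg f + L (x - kappa)^4], with [s =
    x - kappa] and [mu = avg - sg eps]. The drift term is at least [4 alpha a L
    s^4]. Close to the curve the time and second derivatives, of size [L s^2],
    are absorbed by this term together with [eps f] (a discriminant condition in
    [s^2]); farther away this term alone exceeds all others. *)
Lemma well_ineq (f0 f1 eps r a L Lam C : R) :
  0 < f0 -> 0 < f1 -> 0 < eps -> 0 < r -> 0 < a -> 0 < L -> 0 <= Lam -> 0 <= C ->
  exists A, forall al, A <= al -> forall sg s f Vx Vk avg kd bb : R,
    sg * sg = 1 -> `|s| <= 1 -> f0 <= f <= f1 -> (`|s| <= r -> `|Vx - Vk| <= eps / 2) ->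
    `|Vx - Vk| <= C -> `|Vx - (avg - sg * eps)| <= C -> `|kd| <= Lam -> s * bb <= - a * s ^+ 2 ->
    0 < (sg * (- (Vk - avg) * f) + 4 * L * s ^+ 3 * - kd) - 12 * L * s ^+ 2
        - al * bb * (4 * L * s ^+ 3) + (Vx - (avg - sg * eps)) * (sg * f + L * s ^+ 4).
Proof.
move=> f00 f10 eps0 r0 a0 L0 Lam0 C0.
(* [L c1 s^2] bounds the time and second derivatives of the quartic term, [K]
   and [M1] are the rates required for [r < |s|] and for [|s| <= r] *)
pose c1 := 4 * Lam + 12; have c10 : 0 < c1 by rewrite /c1; lra.
have r20 : 0 < r ^+ 2 by rewrite exprn_gt0.
have r40 : 0 < r ^+ 2 * r ^+ 2 by rewrite mulr_gt0.
pose K := (f1 * C + 1) / (L * (r ^+ 2 * r ^+ 2)).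
have K0 : 0 < K.
  by apply: divr_gt0; [rewrite ltr_wpDl // mulr_ge0 // ltW|exact: mulr_gt0].
pose M1 := L * c1 ^+ 2 / (f0 * eps).
have fe0 : 0 < f0 * eps by rewrite mulr_gt0.
have M10 : 0 < M1 by rewrite divr_gt0 // mulr_gt0 // exprn_gt0.
exists ((C + c1 / r ^+ 2 + K + M1) / (4 * a)) => al hal sg s f Vx Vk avg kd bb sg1 s1 hf hVr hVC hVm hkd hb.
have a40 : 0 < 4 * a by rewrite mulr_gt0.
move: hal; rewrite ler_pdivrMr // => hal.
pose X := s ^+ 2; have X0 : 0 <= X by exact: sqr_ge0.
pose M := 4 * al * a - C.
have cr0 : 0 < c1 / r ^+ 2 by rewrite divr_gt0.
have hM : c1 / r ^+ 2 + K + M1 <= M by rewrite /M; move: hal; clear; lra.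
have al0 : 0 < al.
  have h : 0 < al * (4 * a) by move: hal C0 cr0 K0 M10; clear; lra.
  by rewrite pmulr_lgt0 in h.
have X1 : X <= 1 by rewrite /X -real_normK ?num_real // expr_le1.
have s3 : s ^+ 3 = s * X by rewrite /X; ring.
have s4 : s ^+ 4 = X * X by rewrite /X; ring.
have e1 : `|s ^+ 3 * kd| <= X * Lam.
  rewrite normrM; apply: ler_pM => //.
  by rewrite s3 normrM (ger0_norm X0) ler_piMl.
have e2 : X * X * a <= - (s ^+ 3 * bb).
  rewrite s3; have := ler_wpM2l X0 hb; rewrite -/X; clear; lra.
have e3 : - (C * (X * X)) <= (Vx - (avg - sg * eps)) * (X * X).
  have XX0 : 0 <= X * X by rewrite mulr_ge0.
  by move: (ler_wpM2r XX0 hVm); case/ler_normlP: hVm => h1 h2 _; have := ler_wpM2r XX0 h1; clear; lra.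
have e4 : - (f * `|Vx - Vk|) <= sg * (f * (Vx - Vk)).
  have f0' : 0 <= f by move: hf f00; clear; lra.
  have sgn : `|sg| = 1.
    by apply/eqP; rewrite -(@eqrXn2 _ 2) // expr1n -normrX expr2 sg1 normr1.
  rewrite lerNl -mulrN; apply: le_trans (ler_norm _) _.
  by rewrite normrM sgn mul1r normrN normrM (ger0_norm f0').
pose E := f * (eps - `|Vx - Vk|) + L * (M * (X * X) - c1 * X).
suff Epos : 0 < E.
  apply: (lt_le_trans Epos).
  have q1 : L * `|s ^+ 3 * kd| <= L * (X * Lam) by rewrite ler_pM2l.
  have q1' : L * (s ^+ 3 * kd) <= L * `|s ^+ 3 * kd| by rewrite ler_pM2l // ler_norm.
  have alL : 0 < 4 * al * L by rewrite !mulr_gt0.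
  have q2 : 4 * al * L * (X * X * a) <= 4 * al * L * - (s ^+ 3 * bb) by rewrite ler_pM2l.
  have q3 : L * - (C * (X * X)) <= L * ((Vx - (avg - sg * eps)) * (X * X)) by rewrite ler_pM2l.
  have expand : sg * (- (Vk - avg) * f) + 4 * L * s ^+ 3 * - kd - 12 * L * s ^+ 2
        - al * bb * (4 * L * s ^+ 3) + (Vx - (avg - sg * eps)) * (sg * f + L * s ^+ 4) =
    sg * (f * (Vx - Vk)) + (sg * sg) * f * eps - 4 * (L * (s ^+ 3 * kd)) - 12 * (L * X) +
    4 * al * L * - (s ^+ 3 * bb) + L * ((Vx - (avg - sg * eps)) * (X * X)).
    by rewrite s4 -/X; ring.
  rewrite expand sg1 /E /M /c1.
  by move: e4 q1 q1' q2 q3; clear; lra.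
have [sr|sr] := leP `|s| r.
  have hV := hVr sr.
  have g1 : f0 * eps / 2 <= f * (eps - `|Vx - Vk|).
    rewrite -mulrA; apply: ler_pM; [exact: ltW| |by case/andP: hf|by move: hV; clear; lra].
    by rewrite divr_ge0 // ltW.
  have M0 : 0 < M by move: hM cr0 K0 M10; clear; lra.
  have M1M : L * c1 ^+ 2 <= M * (f0 * eps).
    by rewrite -ler_pdivrMr //; move: hM cr0 K0; rewrite -/M1; clear; lra.
  (* [M X^2 - c1 X] is at least [- c1^2 / (4 M)] *)
  have sq : 0 <= (2 * M * X - c1) ^+ 2 by exact: sqr_ge0.
  have h : - (c1 ^+ 2) <= 4 * M * (M * (X * X) - c1 * X) by move: sq; clear; lra.
  have h2 : - (L * c1 ^+ 2) <= 4 * M * (L * (M * (X * X) - c1 * X)).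
    by move: (ler_wpM2l (ltW L0) h); clear; lra.
  have h3 : - (f0 * eps) <= 4 * (L * (M * (X * X) - c1 * X)).
    rewrite -(ler_pM2l M0); move: h2 M1M; clear; lra.
  by rewrite /E; move: g1 h3 fe0; clear; lra.
have Xr : r ^+ 2 <= X.
  rewrite /X -[s ^+ 2]real_normK ?num_real //.
  by rewrite !expr2; apply: ler_pM; rewrite ?(ltW r0) ?(ltW sr).
have g1 : - (f1 * C) <= f * (eps - `|Vx - Vk|).
  have f0' : 0 <= f by move: hf f00; clear; lra.
  have t1 : f * `|Vx - Vk| <= f1 * C by apply: ler_pM => //; case/andP: hf.
  have t2 : 0 <= f * eps by rewrite mulr_ge0 // ltW.
  by move: t1 t2; clear; lra.
have k1 : c1 * X <= c1 / r ^+ 2 * (X * X).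
  have := ler_wpM2r X0 Xr => h.
  have := ler_wpM2l (ltW cr0) h; rewrite mulrA divfK ?gt_eqF //.
have k2 : K * (r ^+ 2 * r ^+ 2) <= K * (X * X).
  by rewrite ler_pM2l //; apply: ler_pM => //; exact: ltW.
have k3 : L * (K * (r ^+ 2 * r ^+ 2)) = f1 * C + 1.
  by rewrite /K; field; rewrite !gt_eqF.
have k4 : (c1 / r ^+ 2 + K) * (X * X) <= M * (X * X).
  by apply: ler_wpM2r; [rewrite mulr_ge0|move: hM M10; clear; lra].
have k5 : L * (K * (r ^+ 2 * r ^+ 2)) <= L * (M * (X * X) - c1 * X).
  by rewrite ler_pM2l //; move: k1 k2 k4; clear; lra.
by rewrite /E; move: k5 g1; rewrite k3; clear; lra.
Qed.

(** The inequality for [A0 (1 + e)] with [e = exp (- K s^2)] and [s = x - y].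
    For [4 K s^2 <= 1] the second derivative contributes at least [A0 K e], and
    [K] is large compared with the potential; for other [s] the drift term [2
    alpha a1 K s^2 e] dominates. *)
Lemma gap_ineq (a1 C : R) : 0 < a1 -> 0 <= C ->
  exists2 K, 0 < K & exists A, forall al, A <= al -> forall A0 s v bb Vm : R,
    0 < A0 -> `|s| <= 1 -> `|Vm| <= C ->
    al * a1 * s ^+ 2 - 1 / 4 * `|s| <= s * (v + al * bb) ->
    forall e, e = expR (- (K * s ^+ 2)) ->
    0 < A0 * (2 * K * s * v * e) - A0 * ((4 * K ^+ 2 * s ^+ 2 - 2 * K) * e)
        - al * bb * (A0 * (- (2 * K * s) * e)) + Vm * (A0 * (1 + e)).
Proof.
move=> a10 C0; pose K := 6 * C + 6; have K0 : 0 < K by rewrite /K; lra.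
(* chosen so that [3/4 * (K/2)] exceeds [2 C]; [e0] is the least value of [e] *)
exists K => //.
pose e0 := expR (- K); have e00 : 0 < e0 by exact: expR_gt0.
exists ((4 * K + (4 * C + 1) / e0) / a1) => al hal A0 s v bb Vm A00 s1 hV hs e eE.
have q0 : 0 < (4 * C + 1) / e0 by rewrite divr_gt0 // ltr_wpDl // mulr_ge0.
move: hal; rewrite ler_pdivrMr // => hal.
pose X := s ^+ 2; have X0 : 0 <= X by exact: sqr_ge0.
have X1 : X <= 1 by rewrite /X -real_normK ?num_real // expr_le1.
have ep : 0 < e by rewrite eE expR_gt0.
have e1 : e <= 1 by rewrite eE -expR0 ler_expR oppr_le0 mulr_ge0 // ltW.
have ee0 : e0 <= e by rewrite eE ler_expR lerN2 ler_piMr // ltW.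
pose Bk := 2 * K * (s * (v + al * bb)) + 2 * K - 4 * K ^+ 2 * X.
have -> : A0 * (2 * K * s * v * e) - A0 * ((4 * K ^+ 2 * s ^+ 2 - 2 * K) * e)
        - al * bb * (A0 * (- (2 * K * s) * e)) + Vm * (A0 * (1 + e)) =
    A0 * (e * Bk + Vm * (1 + e)) by rewrite /Bk -/X; ring.
apply: mulr_gt0 => //.
have V2 : - (2 * C) <= Vm * (1 + e).
  have ep1 : 0 <= 1 + e <= 2 by move: ep e1; clear; lra.
  case/ler_normlP: hV => h1 _.
  have p0 : 0 <= 1 + e by case/andP: ep1.
  have := ler_wpM2r p0 h1; have := ler_wpM2l C0 (proj2 (andP ep1)); clear; lra.
have hB : 2 * K * (al * a1 * X - 1 / 4 * `|s|) + 2 * K - 4 * K ^+ 2 * X <= Bk.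
  have K20 : 0 <= 2 * K by rewrite mulr_ge0 // ltW.
  by have := ler_wpM2l K20 hs; rewrite /Bk -/X; clear; lra.
have ks : K * `|s| <= K by rewrite ler_piMr // ltW.
suff : 2 * C < e * Bk by move: V2; clear; lra.
have [hX|hX] := leP (4 * K * X) 1.
  have Kx : 4 * K ^+ 2 * X <= K.
    by have := ler_wpM2l (ltW K0) hX; rewrite expr2; clear; lra.
  have alX : 0 <= K * (al * a1 * X).
    by apply: mulr_ge0; [exact: ltW|apply: mulr_ge0 => //; move: hal q0 K0; clear; lra].
  have Bk2 : K / 2 <= Bk by move: hB Kx alX ks; clear; lra.
  have e34 : 3 / 4 <= e.
    have := expR_ge1Dx (- (K * X)); rewrite -eE; move: hX; rewrite /X; clear; lra.
  have Bk0 : 0 <= K / 2 by move: K0; clear; lra.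
  have Z0 : (0 : R) <= 3 / 4 by rewrite divr_ge0.
  have h : 3 / 4 * (K / 2) <= e * Bk by apply: ler_pM.
  by move: h; rewrite /K; move: C0; clear; lra.
have m : 0 <= al * a1 - 2 * K by move: hal q0 K0; clear; lra.
have h1 : al * a1 - 2 * K <= (al * a1 - 2 * K) * (4 * K * X).
  by rewrite ler_peMr // ltW.
have h2 : (4 * C + 1) / e0 / 2 <= Bk.
  by move: h1 hB ks hal K0; rewrite expr2; clear; lra.
have q20 : 0 <= (4 * C + 1) / e0 / 2 by move: q0; clear; lra.
have h3 : e0 * ((4 * C + 1) / e0 / 2) <= e * Bk by apply: ler_pM => //; exact: ltW.
have E : e0 * ((4 * C + 1) / e0 / 2) = (4 * C + 1) / 2 by field; rewrite gt_eqF.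
by move: h3; rewrite E; clear; lra.
Qed.
End Inequalities.

(** * Derivatives of the comparison functions *)

Section Pieces.
Context (R : realType).
Implicit Types (D : set R).

Lemma well_taylor (c L k x : R) : 0 <= x <= 1 ->
  taylor2 `[0, 1] (fun y => c + L * (y - k) ^+ 4) x (4 * L * (x - k) ^+ 3) (12 * L * (x - k) ^+ 2).
Proof.
move=> x01; apply: (@taylor2P _ 0 1 _ (fun y => 4 * L * (y - k) ^+ 3)) => //.
  move=> s _; apply: (@has_der_eq _ _ _ _ (0 + L * (4 * (s - k) ^+ 3 * 1))); first by ring.
  apply: has_derD; first exact: has_der_cst.
  by apply: has_derZ; exact: (has_der_comp (has_der_translate _ k s) (has_der_pow4 (s - k))).
apply: (@has_der_eq _ _ _ _ (4 * L * (3 * (x - k) ^+ 2 * 1))); first by ring.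
by apply: has_derZ; exact: (has_der_comp (has_der_translate _ k x) (has_der_pow3 (x - k))).
Qed.

Lemma well_time D (f kap : R -> R) (sg L x t f' kd : R) :
  has_der D f t f' -> has_der D kap t kd ->
  has_der D (fun s => sg * f s + L * (x - kap s) ^+ 4) t
    (sg * f' + 4 * L * (x - kap t) ^+ 3 * - kd).
Proof.
move=> df dk.
have h : has_der D (fun s => x - kap s) t (0 - kd) by apply: has_derB; [exact: has_der_cst|].
have := has_derD (has_derZ sg df) (has_derZ L (has_der_comp h (has_der_pow4 (x - kap t)))).
by apply: has_der_eq; ring.
Qed.

Lemma gauss_der D (K : R) (g : R -> R) (x g' : R) : has_der D g x g' ->
  has_der D (fun y => expR (- (K * g y ^+ 2))) x (- (2 * K * g x * g') * expR (- (K * g x ^+ 2))).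
Proof.
move=> dg.
have h := has_der_comp (has_derN (has_derZ K (has_der_comp dg (@has_der_sqr _ (g x)))))
  (has_der_expR (- (K * g x ^+ 2))).
by apply: has_der_eq h; ring.
Qed.

Lemma gap_taylor (A0 K c x : R) : 0 <= x <= 1 ->
  taylor2 `[0, 1] (fun y => A0 * (1 + expR (- (K * (y - c) ^+ 2)))) x
    (A0 * (- (2 * K * (x - c)) * expR (- (K * (x - c) ^+ 2))))
    (A0 * ((4 * K ^+ 2 * (x - c) ^+ 2 - 2 * K) * expR (- (K * (x - c) ^+ 2)))).
Proof.
move=> x01.
pose f' y := A0 * (- (2 * K * (y - c)) * expR (- (K * (y - c) ^+ 2))).
apply: (@taylor2P _ 0 1 _ f') => //.
  move=> s _; apply: has_derZ.
  apply: (@has_der_eq _ _ _ _ (0 + - (2 * K * (s - c) * 1) * expR (- (K * (s - c) ^+ 2)))).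
    by ring.
  by apply: has_derD; [exact: has_der_cst|apply: gauss_der; exact: has_der_translate].
have Dx : [set` `[0, 1]] x by rewrite /= in_itv.
have h1 := has_derN (has_derZ (2 * K) (@has_der_translate _ `[0, 1] c x)).
have h2 := gauss_der K (@has_der_translate _ `[0, 1] c x).
apply: (has_der_eq _ (has_derZ A0 (has_derM Dx h1 h2))).
by rewrite expr2; ring.
Qed.

Lemma gap_time D (A0 K x t v : R) (y : R -> R) : has_der D y t v ->
  has_der D (fun s => A0 * (1 + expR (- (K * (x - y s) ^+ 2)))) t
    (A0 * (2 * K * (x - y t) * v * expR (- (K * (x - y t) ^+ 2)))).
Proof.
move=> dy.
have h : has_der D (fun s => x - y s) t (0 - v) by apply: has_derB; [exact: has_der_cst|].
have := has_derZ A0 (has_derD (@has_der_cst _ D 1 t) (gauss_der K h)).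
by apply: has_der_eq; ring.
Qed.

(** The amplitude transported along a curve: with [g] the potential on the
    curve, it solves [f' = - (g - average of g) f], so that it is periodic. *)
Definition weight (T : R) (g : R -> R) (t : R) : R :=
  expR (- (seg_int 0 t g - T^-1 * seg_int 0 T g * t)).

Lemma weight_der (T : R) (g : R -> R) (t : R) : continuous g -> 0 <= t <= T ->
  has_der `[0, T] (weight T g) t (- (g t - T^-1 * seg_int 0 T g) * weight T g t).
Proof.
move=> cg tT.
have h := has_derN (has_derB (seg_int_der tT cg)
  (has_derZ (T^-1 * seg_int 0 T g) (@has_der_id _ `[0, T] t))).
have := has_der_comp h (has_der_expR _).
by apply: has_der_eq; rewrite /weight; ring.
Qed.

Lemma weight_gt0 (T : R) (g : R -> R) (t : R) : 0 < weight T g t.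
Proof. exact: expR_gt0. Qed.

Lemma weight_periodic (T : R) (g : R -> R) : 0 < T -> weight T g T = weight T g 0.
Proof.
move=> T0; rewrite /weight seg_int_point mulr0; congr (expR (- _)).
by field; rewrite gt_eqF.
Qed.

Lemma weight_continuous (T : R) (g : R -> R) : 0 < T -> continuous g ->
  continuous (fun t => weight T g (clamp 0 T t)).
Proof.
move=> T0 cg; apply: clamp_continuous_in => [|x hx e e0]; first exact: ltW.
have [d d0 Hd] := has_der_cont (weight_der cg hx) e0.
by exists d => // y hy; apply: Hd; rewrite /= in_itv.
Qed.

Lemma weight_bounds (T : R) (g : R -> R) : 0 < T -> continuous g ->
  exists f0 f1, [/\ 0 < f0, 0 < f1 & forall t, 0 <= t <= T -> f0 <= weight T g t <= f1].
Proof.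
move=> T0 cg; have cw := weight_continuous T0 cg.
have [t0 _ H0] := EVT_min (ltW T0) (continuous_subspaceT cw).
have [t1 _ H1] := EVT_max (ltW T0) (continuous_subspaceT cw).
exists (weight T g (clamp 0 T t0)), (weight T g (clamp 0 T t1)); split; try exact: weight_gt0.
move=> t tT; have := H0 t; have := H1 t; rewrite in_itv /= !(@clamp_id _ 0 T t) //.
by move=> /(_ tT) -> /(_ tT) ->.
Qed.
End Pieces.

(** * Gaps between consecutive curves *)

(** What the comparison needs to know about [m]: [b] is its slope, [kap] its
    curves of maxima, [r] the radius of the wells, [r / 4] the distance from the
    curves beyond which [b] increases where it is below [a] in absolute value.
    *)
Record landscape (R : realType) (T r a Lam : R) (b : R * R -> R) (N : nat)
    (kap : 'I_N.+1 -> R -> R) : Prop := Landscape {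
  ls_T0 : 0 < T;
  ls_r0 : 0 < r;
  ls_a0 : 0 < a;
  ls_L0 : 0 <= Lam;
  ls_cb : continuous b;
  ls_per : forall x t : R, b (x, t + T) = b (x, t);
  ls_k01 : forall i (t : R), 0 <= t <= T -> 0 <= kap i t <= 1;
  ls_kd : forall i (t : R), 0 <= t <= T -> exists2 v, has_der `[0, T] (kap i) t v & `|v| <= Lam;
  ls_kT : forall i, kap i T = kap i 0;
  ls_well : forall i, well_at T b kap i r;
  ls_sep : forall i j (t : R), 0 <= t <= T -> kap i t < kap j t -> 2 * r < kap j t - kap i t;
  ls_ord : forall i j (s t : R), 0 <= s <= T -> 0 <= t <= T ->
    kap i s < kap j s -> kap i t < kap j t;
  ls_monor : forall x y t : R, 0 <= x -> x <= y -> y <= 1 -> 0 <= t <= T ->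
    off_curves kap (r / 4) x y t -> `|b (x, t)| <= a / 2 -> a / 2 * (y - x) <= b (y, t) - b (x, t);
  ls_monol : forall x y t : R, 0 <= x -> x <= y -> y <= 1 -> 0 <= t <= T ->
    off_curves kap (r / 4) x y t -> `|b (y, t)| <= a / 2 -> a / 2 * (y - x) <= b (y, t) - b (x, t);
  ls_levr : forall c x y t : R, 0 <= x -> x <= y -> y <= 1 -> 0 <= t <= T ->
    off_curves kap (r / 4) x y t -> `|c| <= a -> c <= b (x, t) -> c <= b (y, t);
  ls_levl : forall c x y t : R, 0 <= x -> x <= y -> y <= 1 -> 0 <= t <= T ->
    off_curves kap (r / 4) x y t -> `|c| <= a -> b (y, t) <= c -> b (x, t) <= c;
  ls_e0 : forall t : R, 0 <= t <= T -> (forall i, 0 < kap i t) -> 0 <= b (0, t);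
  ls_e1 : forall t : R, 0 <= t <= T -> (forall i, kap i t < 1) -> b (1, t) <= 0
}.

Section Gaps.
Context (R : realType) (N : nat) (kap : 'I_N.+1 -> R -> R).
Notation gap := (option 'I_N.+1 * option 'I_N.+1)%type.

(** A gap is a pair of curves, where [None] stands for an end point of [[0, 1]].
    It is valid when the first curve lies below the second and no curve lies
    between them. *)
Definition valid_at (t : R) (g : gap) : Prop :=
  (forall l, (exists2 i, g.1 = Some i & kap l t <= kap i t) \/
             (exists2 j, g.2 = Some j & kap j t <= kap l t)) /\
  (forall i j, g.1 = Some i -> g.2 = Some j -> kap i t < kap j t).

Definition gap_lo (r : R) (p : option 'I_N.+1) (t : R) : R :=
  if p is Some i then kap i t + r / 2 else 0.
Definition gap_hi (r : R) (q : option 'I_N.+1) (t : R) : R :=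
  if q is Some j then kap j t - r / 2 else 1.

(** The part of the gap at distance at least [r / 2] from its curves. *)
Definition in_gap (r : R) (g : gap) (x t : R) : Prop := gap_lo r g.1 t <= x <= gap_hi r g.2 t.

Lemma valid_preserved (T r a Lam s t : R) b g : landscape T r a Lam b kap ->
  0 <= s <= T -> 0 <= t <= T -> valid_at s g -> valid_at t g.
Proof.
move=> H sT tT [h1 h2]; have ord := ls_ord H; split=> [l|i j pi qj].
  have le i j : kap i s <= kap j s -> kap i t <= kap j t.
    by rewrite leNgt => ij; rewrite leNgt; apply/negP => /(ord _ _ _ _ tT sT); apply/negP.
  by case: (h1 l) => -[i E /le h]; [left|right]; exists i.
exact: ord sT tT (h2 _ _ pi qj).
Qed.

Lemma gap_clear (w x y t : R) g : valid_at t g -> 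
  (forall i, g.1 = Some i -> kap i t + w <= x) ->
  (forall j, g.2 = Some j -> y <= kap j t - w) -> off_curves kap w x y t.
Proof.
move=> [h1 h2] hx hy s sxy l; rewrite ler_normr; case: (h1 l) => -[i E h].
  apply/orP; left; move: (hx i E) h sxy; clear; lra.
apply/orP; right; move: (hy i E) h sxy; clear; lra.
Qed.

(** Take the closest curves on both sides of [x]. *)
Lemma gap_cover (T r a Lam x t : R) b : landscape T r a Lam b kap ->
  0 <= x <= 1 -> 0 <= t <= T -> (forall i, r / 2 < `|x - kap i t|) ->
  exists2 g : gap, valid_at t g & in_gap r g x t.
Proof.
move=> H x01 tT far; have r0 := ls_r0 H.
have [p [p1 p2]] : exists p : option 'I_N.+1,
    (forall i, p = Some i -> kap i t < x) /\
    forall l, kap l t < x -> exists2 i, p = Some i & kap l t <= kap i t.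
  have [[i0 h0]|no] := pselect (exists i, kap i t < x); last first.
    by exists None; split=> // l hl; case: no; exists l.
  case: (@arg_maxP _ _ _ i0 (fun l => kap l t < x) (fun l => kap l t) h0) => i hi max.
  by exists (Some i); split=> [_ [<-]//|l hl]; exists i => //; exact: max.
have [q [q1 q2]] : exists q : option 'I_N.+1,
    (forall i, q = Some i -> x < kap i t) /\
    forall l, x < kap l t -> exists2 i, q = Some i & kap i t <= kap l t.
  have [[i0 h0]|no] := pselect (exists i, x < kap i t); last first.
    by exists None; split=> // l hl; case: no; exists l.
  case: (@arg_minP _ _ _ i0 (fun l => x < kap l t) (fun l => kap l t) h0) => i hi max.
  by exists (Some i); split=> [_ [<-]//|l hl]; exists i => //; exact: max.
have ne l : kap l t != x.
  by apply/eqP => E; have := far l; rewrite E subrr normr0; lra.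
exists (p, q).
  split=> [l|i j /p1 h1 /q1 h2]; last exact: lt_trans h1 h2.
  by have := ne l; rewrite neq_lt => /orP[/p2|/q2]; [left|right].
rewrite /in_gap /=; case: p p1 {p2} => [i|] p1 /=; case: q q1 {q2} => [j|] q1 /=.
- have h1 := p1 i erefl; have h2 := q1 j erefl; have := far i; have := far j.
  by rewrite ltr0_norm ?gtr0_norm ?subr_gt0 ?subr_lt0 //; lra.
- by have h1 := p1 i erefl; have := far i; rewrite gtr0_norm ?subr_gt0 //; lra.
- by have h1 := q1 j erefl; have := far j; rewrite ltr0_norm ?subr_lt0 //; lra.
by [].
Qed.
End Gaps.

Lemma landscape_lip (R : realType) (T r a Lam : R) b N (kap : 'I_N.+1 -> R -> R) i (s t : R) :
  landscape T r a Lam b kap -> 0 <= s <= T -> 0 <= t <= T ->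
  `|kap i s - kap i t| <= Lam * `|s - t|.
Proof.
move=> H; wlog st : s t / s <= t => [W sT tT|].
  by have [|/ltW] := leP s t => /W; [|rewrite distrC (distrC s)]; apply.
move=> sT tT; pose v s := if pselect (0 <= s <= T) is left h then projT1 (cid2 (ls_kd H i h)) else 0.
have hv s' : 0 <= s' <= T -> has_der `[0, T] (kap i) s' (v s') /\ `|v s'| <= Lam.
  by move=> h; rewrite /v; case: pselect => // h'; case: cid2.
rewrite distrC (distrC s) (ger0_norm (_ : 0 <= t - s)) ?subr_ge0 //.
apply: (mean_value_abs st (f' := v)) => s' hs'; last by apply: (hv _ _).2; lra.
apply: has_der_subset (hv _ _).1 => [z|]; last lra.
by rewrite /= !in_itv /=; lra.
Qed.

Lemma landscape_ck (R : realType) (T r a Lam : R) b N (kap : 'I_N.+1 -> R -> R) i :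
  landscape T r a Lam b kap -> continuous (fun t => kap i (clamp 0 T t)).
Proof.
move=> H; apply: clamp_continuous_in => [|t tT e e0]; first exact/ltW/(ls_T0 H).
have [v dv _] := ls_kd H i tT; have [d d0 Hd] := has_der_cont dv e0.
by exists d => // y hy; apply: Hd; rewrite /= in_itv.
Qed.

Definition wrap (R : realType) (T t : R) : R := if t <= T then t else t - T.

Lemma wrap_in (R : realType) (T t : R) : 0 <= t <= 2 * T -> 0 <= wrap T t <= T.
Proof. by rewrite /wrap; case: (leP t T); lra. Qed.

Lemma wrap_id (R : realType) (T t : R) : t <= T -> wrap T t = t.
Proof. by rewrite /wrap => ->. Qed.

Lemma wrap_per (R : realType) (T : R) (b : R * R -> R) (x t : R) :
  (forall x t : R, b (x, t + T) = b (x, t)) -> b (x, wrap T t) = b (x, t).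
Proof. by move=> per; rewrite /wrap; case: (leP t T) => // _; rewrite -[in RHS](subrK T t) per. Qed.

Lemma wrap_lip (R : realType) (T Lam s t : R) (k : R -> R) : 0 < T -> k T = k 0 ->
  (forall s t, 0 <= s <= T -> 0 <= t <= T -> `|k s - k t| <= Lam * `|s - t|) ->
  0 <= s <= 2 * T -> 0 <= t <= 2 * T -> `|k (wrap T s) - k (wrap T t)| <= Lam * `|s - t|.
Proof.
move=> T0 kT lip; wlog st : s t / s <= t => [W sT tT|].
  by have [|/ltW] := leP s t => /W; [|rewrite distrC (distrC s)]; apply.
move=> sT tT; rewrite /wrap; case: (leP s T) => sT'; case: (leP t T) => tT'.
- by apply: lip; lra.
- have h1 : `|k s - k T| <= Lam * `|s - T| by apply: lip; lra.
  have h2 : `|k 0 - k (t - T)| <= Lam * `|0 - (t - T)| by apply: lip; lra.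
  have -> : k s - k (t - T) = (k s - k T) + (k 0 - k (t - T)) by rewrite kT; ring.
  apply: le_trans (ler_normD _ _) _; apply: le_trans (lerD h1 h2) _.
  rewrite -mulrDr le_eqVlt; apply/orP; left; apply/eqP; congr (_ * _).
  by rewrite !ler0_norm; lra.
- lra.
have -> : s - t = (s - T) - (t - T) by ring.
by apply: lip; lra.
Qed.

(** Between two curves this is [interior_hump]. In the gap next to an end point
    the end point itself is the curve: the drift is directed away from it, since
    otherwise the end point would be a maximum. The last two conclusions give
    the sign of the slope of the comparison function at the end points. *)
Lemma gap_hump (R : realType) (T r a Lam : R) b N (kap : 'I_N.+1 -> R -> R)
    (g : option 'I_N.+1 * option 'I_N.+1) :
  landscape T r a Lam b kap -> valid_at kap 0 g ->
  exists A, forall al, A <= al ->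
    exists2 y, hump_curve T al (a / 2) (1 / 4) b (in_gap kap r g) y &
      (g.1 = None -> forall t, y t = 0) /\ (g.2 = None -> forall t, y t = 1).
Proof.
move=> H Hv; have [T0 r0 a0 L0 cb per k01 kd kT well sep ord mr ml lr ll e0 e1] := H.
have val t : 0 <= t <= T -> valid_at kap t g.
  by move=> tT; apply: valid_preserved H _ tT Hv; rewrite lexx ltW.
case: g Hv val => -[i|] [j|] Hv val.
- pose l t := kap i (wrap T t); pose u t := kap j (wrap T t).
  have lt t : 0 <= t <= T -> kap i t < kap j t by move=> /val[_]; apply.
  have perw x t : b (x, wrap T t) = b (x, t) by exact: wrap_per.
  have cl x y t : 0 <= t <= 2 * T -> l t + r / 4 <= x -> y <= u t - r / 4 ->
      off_curves kap (r / 4) x y (wrap T t).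
    by move=> /wrap_in/val v h1 h2; apply: gap_clear v _ _ => /= k [<-].
  have k01l t : 0 <= t <= 2 * T -> 0 <= l t by move=> /wrap_in/(k01 i)/andP[].
  have k01u t : 0 <= t <= 2 * T -> u t <= 1 by move=> /wrap_in/(k01 j)/andP[].
  have G : gap_flow T (r / 4) a (r * r / 2) Lam b l u.
    split=> //.
    + by rewrite divr_gt0.
    + by rewrite divr_gt0 // mulr_gt0.
    + by move=> s t; apply: wrap_lip => // s' t'; exact: landscape_lip H.
    + by move=> s t; apply: wrap_lip => // s' t'; exact: landscape_lip H.
    + move=> t t2; split; [exact: k01l|exact: k01u|].
      by have := sep i j _ (wrap_in t2) (lt _ (wrap_in t2)); rewrite /l /u; lra.
    + by rewrite /l !wrap_id // ltW.
    + by rewrite /u !wrap_id // ltW.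
    + move=> x t t2 hx; have sp := sep i j _ (wrap_in t2) (lt _ (wrap_in t2)).
      have := k01l _ t2; have := k01u _ t2; rewrite /u /l in hx * => hu hl.
      have x01 : 0 <= x <= 1 by move: hx hu hl sp r0; clear; lra.
      have xk : `|x - kap i (wrap T t)| <= r.
        by rewrite ger0_norm; move: hx r0; clear; lra.
      have [h _] := well i x _ x01 (wrap_in t2) xk.
      have kx : kap i (wrap T t) < x by move: hx r0; clear; lra.
      rewrite -perw; apply: le_trans (h kx) _; rewrite mulNr lerN2 -mulrA ler_pM2l //.
      by move: hx r0; clear; lra.
    + move=> x t t2 hx; have sp := sep i j _ (wrap_in t2) (lt _ (wrap_in t2)).
      have := k01l _ t2; have := k01u _ t2; rewrite /u /l in hx * => hu hl.
      have x01 : 0 <= x <= 1 by move: hx hu hl sp r0; clear; lra.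
      have xk : `|x - kap j (wrap T t)| <= r.
        by rewrite ler0_norm; move: hx r0; clear; lra.
      have [_ h] := well j x _ x01 (wrap_in t2) xk.
      have kx : x < kap j (wrap T t) by move: hx r0; clear; lra.
      rewrite -perw; apply: le_trans (h kx); rewrite -mulrA ler_pM2l //.
      by move: hx r0; clear; lra.
    + move=> x y t t2 lx xy yu; have := k01l _ t2; have := k01u _ t2 => hu hl.
      have x0 : 0 <= x by move: lx hl r0; clear; lra.
      have y1 : y <= 1 by move: yu hu r0; clear; lra.
      have a4 : `|a / 4| <= a by rewrite ger0_norm; move: a0; clear; lra.
      by rewrite -(perw x t) -(perw y t); exact: (lr (a / 4) x y _ x0 xy y1 (wrap_in t2) (cl x y t t2 lx yu) a4).
    + move=> x y t t2 lx xy yu; have := k01l _ t2; have := k01u _ t2 => hu hl.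
      have x0 : 0 <= x by move: lx hl r0; clear; lra.
      have y1 : y <= 1 by move: yu hu r0; clear; lra.
      have a4 : `|- (a / 4)| <= a by rewrite normrN ger0_norm; move: a0; clear; lra.
      by rewrite -(perw x t) -(perw y t); exact: (ll (- (a / 4)) x y _ x0 xy y1 (wrap_in t2) (cl x y t t2 lx yu) a4).
    + move=> x y t t2 lx ly by2; have := k01l _ t2; have := k01u _ t2 => hu hl.
      have x01 : 0 <= x <= 1 by move: lx hu hl r0; clear; lra.
      have y01 : 0 <= y <= 1 by move: ly hu hl r0; clear; lra.
      have wt := wrap_in t2.
      move: by2; rewrite -(perw x t) -(perw y t) => by2.
      have [xy|/ltW yx] := leP x y.
        have : a / 2 * (y - x) <= b (y, wrap T t) - b (x, wrap T t).
          apply: ml => //; [by case/andP: x01|by case/andP: y01|].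
          by apply: cl => //; [case/andP: lx|case/andP: ly].
        move=> h; have yx : 0 <= y - x by rewrite subr_ge0.
        by have := ler_wpM2l yx h; rewrite expr2; clear; lra.
      have : a / 2 * (x - y) <= b (x, wrap T t) - b (y, wrap T t).
        apply: mr => //; [by case/andP: y01|by case/andP: x01|].
        by apply: cl => //; [case/andP: ly|case/andP: lx].
      move=> h; have xy : 0 <= x - y by rewrite subr_ge0.
      by have := ler_wpM2l xy h; rewrite expr2; clear; lra.
  have [A HA] := interior_hump G; exists A => al /HA /(_ (1 / 4)) [|y [cy yT y01 Hy]].
    by rewrite divr_gt0.
  exists y => //; split=> // t tT; have [v dv h] := Hy t tT; exists v => // x x01.
  rewrite /in_gap /= => D; apply: h => //; rewrite /l /u wrap_id; last by case/andP: tT.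
  by move: D; clear; lra.
- exists 0 => al al0; exists (fun=> 1); last by [].
  split=> // [t|t _|t tT].
    exact: cvg_cst.
    by rewrite ?ler01 ?lexx.
  have tT' : 0 <= t <= T by case/andP: tT => /ltW -> ->.
  exists 0; first exact: has_der_cst.
  move=> x x01 /andP[/= D _]; have [v1 v2] := val t tT'.
  have cl : off_curves kap (r / 4) x 1 t.
    by apply: gap_clear (val t tT') _ _ => //= k [<-]; move: D r0; clear; lra.
  have b1 : b (1, t) <= 0.
    apply: e1 => // k; case: (v1 k) => -[i' //= [<-] h].
    by move: D h r0 x01; clear; lra.
  have hb : b (x, t) <= - (a / 2 * (1 - x)).
    have [h|h] := leP (- (a / 2)) (b (1, t)).
      have : a / 2 * (1 - x) <= b (1, t) - b (x, t).
        by case/andP: x01 => x0 x1; apply: ml => //; rewrite ler0_norm //; move: h; clear; lra.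
      by move: b1; clear; lra.
    have : b (x, t) <= - (a / 2).
      case/andP: x01 => x0 x1; apply: (ll _ x 1) => //; last exact: ltW.
      by rewrite normrN ger0_norm; move: a0; clear; lra.
    have : a / 2 * (1 - x) <= a / 2 * 1.
      by rewrite ler_pM2l; move: x01 a0; clear; lra.
    by clear; lra.
  rewrite add0r ler0_norm; last by move: x01; clear; lra.
  have x1 : 0 <= 1 - x by move: x01; clear; lra.
  have := ler_wpM2l (mulr_ge0 al0 x1) hb; rewrite expr2; move: x1; clear; nra.
- exists 0 => al al0; exists (fun=> 0); last by [].
  split=> // [t|t _|t tT].
    exact: cvg_cst.
    by rewrite ?ler01 ?lexx.
  have tT' : 0 <= t <= T by case/andP: tT => /ltW -> ->.
  exists 0; first exact: has_der_cst.
  move=> x x01 /andP[/= _ D]; have [v1 v2] := val t tT'.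
  have cl : off_curves kap (r / 4) 0 x t.
    by apply: gap_clear (val t tT') _ _ => //= k [<-]; move: D r0; clear; lra.
  have b1 : 0 <= b (0, t).
    apply: e0 => // k; case: (v1 k) => -[i' //= [<-] h].
    by move: D h r0 x01; clear; lra.
  have hb : a / 2 * x <= b (x, t).
    have [h|h] := leP (b (0, t)) (a / 2).
      have : a / 2 * (x - 0) <= b (x, t) - b (0, t).
        by case/andP: x01 => x0 x1; apply: mr => //; rewrite ger0_norm.
      by move: b1; clear; lra.
    have : a / 2 <= b (x, t).
      case/andP: x01 => x0 x1; apply: (lr _ 0 x) => //; last exact: ltW.
      by rewrite ger0_norm; move: a0; clear; lra.
    have : a / 2 * x <= a / 2 * 1.
      by rewrite ler_pM2l; move: x01 a0; clear; lra.
    by clear; lra.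
  have x1 : 0 <= x by move: x01; clear; lra.
  rewrite add0r !subr0 ger0_norm //.
  have := ler_wpM2l (mulr_ge0 al0 x1) hb; rewrite expr2; move: x1; clear; nra.
by have [v _] := Hv; case: (v ord0) => -[].
Qed.

(** * Wells and the upper bound *)

(** [sg] is the sign of [th] and so of [P] at the contact point. The bound on
    [lam] is an upper one for [sg = -1] and a lower one for [sg = 1]. *)
Lemma touch_bound (R : realType) (T al lam e sg mu th : R) (m V u ut ux uxx P : R * R -> R)
    (x0 t0 pt px pxx : R) :
  near_eigenfunction T m V al lam e u ut ux uxx ->
  0 <= x0 <= 1 -> 0 < t0 <= T ->
  taylor2 `[0, 1] (fun y => P (y, t0)) x0 px pxx ->
  has_der `[0, t0] (fun s => P (x0, s)) t0 pt ->
  (exists2 d, 0 < d & forall y, 0 <= y <= 1 -> `|y - x0| < d -> th * u (y, t0) <= P (y, t0)) ->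
  (exists2 d, 0 < d & forall s, 0 <= s <= t0 -> `|s - t0| < d -> th * u (x0, s) <= P (x0, s)) ->
  P (x0, t0) = th * u (x0, t0) -> (x0 = 0 -> px <= 0) -> (x0 = 1 -> 0 <= px) ->
  sg * sg = 1 -> 0 < sg * th ->
  0 < pt - pxx - al * dx m (x0, t0) * px + (V (x0, t0) - mu) * P (x0, t0) ->
  sg * (mu - lam) < e.
Proof.
move=> ne x01 t0T Ptay Pder Hx Ht PE P0 P1 sg1 sgth pos.
have h := touching ne x01 t0T Ptay Pder Hx Ht PE P0 P1.
have [_ upos _ _ _] := ne.
have u0 : 0 < u (x0, t0) by apply: upos => //; move: t0T; clear; lra.
have absth : `|th| = sg * th.
  rewrite -[RHS]gtr0_norm // normrM; suff -> : `|sg| = 1 by rewrite mul1r.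
  by apply/eqP; rewrite -(@pexpr_eq1 _ `|sg| 2) // -normrX expr2 sg1 normr1.
have E : sg * (sg * th * (e * u (x0, t0))) = e * (th * u (x0, t0)).
  by transitivity (sg * sg * (e * (th * u (x0, t0)))); [ring|rewrite sg1 mul1r].
have key : 0 < (sg * th * u (x0, t0)) * (e - sg * (mu - lam)).
  have -> : sg * th * u (x0, t0) * (e - sg * (mu - lam)) =
      sg * th * (e * u (x0, t0)) + sg * sg * ((lam - mu) * (th * u (x0, t0))) by ring.
  rewrite sg1 mul1r -PE -absth; move: h pos; clear; lra.
by rewrite pmulr_rgt0 ?subr_gt0 // mulr_gt0 in key.
Qed.

(** The potential along the curve [k], made continuous on the whole line by
    projecting onto the domain. *)
Definition curve_pot (R : realType) (T : R) (V : R * R -> R) (k : R -> R) (s : R) : R :=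
  V (clamp2 0 T (k (clamp 0 T s), s)).

Definition curve_avg (R : realType) (T : R) (V : R * R -> R) (k : R -> R) : R :=
  T^-1 * seg_int 0 T (curve_pot T V k).

(** The quartic term confines contact to a neighbourhood of the curve, and on
    the curve it changes neither the value nor the first three derivatives. *)
Definition well_piece (R : realType) (T : R) (V : R * R -> R) (k : R -> R) (sg L : R)
    (z : R * R) : R :=
  sg * weight T (curve_pot T V k) z.2 + L * (z.1 - k z.2) ^+ 4.

Definition gap_piece (R : realType) (A0 K : R) (y : R -> R) (z : R * R) : R :=
  A0 * (1 + expR (- (K * (z.1 - y z.2) ^+ 2))).

Lemma curve_pot_continuous (R : realType) (T : R) (V : R * R -> R) (k : R -> R) :
  continuous (V \o clamp2 0 T) -> continuous (fun t => k (clamp 0 T t)) ->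
  continuous (curve_pot T V k).
Proof.
move=> cV ck s.
apply: (@continuous_comp _ _ _ (fun s => (k (clamp 0 T s), s)) (V \o clamp2 0 T)); last exact: cV.
by apply: cont_pair => // x; exact: cvg_id.
Qed.

Lemma curve_potE (R : realType) (T : R) (V : R * R -> R) (k : R -> R) (t : R) :
  0 <= t <= T -> 0 <= k t <= 1 -> curve_pot T V k t = V (k t, t).
Proof. by move=> tT k01; rewrite /curve_pot clamp_id // clamp2_id. Qed.

Lemma curve_avg_abs (R : realType) (T C : R) (V : R * R -> R) (k : R -> R) : 0 < T ->
  continuous (curve_pot T V k) -> (forall t, 0 <= t <= T -> `|curve_pot T V k t| <= C) ->
  `|curve_avg T V k| <= C.
Proof.
move=> T0 cV H; rewrite /curve_avg normrM gtr0_norm ?invr_gt0 // mulrC ler_pdivrMr //.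
by have := seg_int_abs (ltW T0) cV H; rewrite subr0.
Qed.

Lemma well_strict (R : realType) (T r a Lam eps L : R) b (V : R * R -> R) N (kap : 'I_N.+1 -> R -> R) i :
  landscape T r a Lam b kap -> continuous (V \o clamp2 0 T) -> 0 < eps -> 0 < L ->
  exists A, forall al, A <= al -> forall sg x t : R, sg * sg = 1 -> 0 <= x <= 1 -> 0 <= t <= T ->
    `|x - kap i t| <= r -> exists2 kd, has_der `[0, T] (kap i) t kd &
    0 < (sg * (- (curve_pot T V (kap i) t - curve_avg T V (kap i)) * weight T (curve_pot T V (kap i)) t)
          + 4 * L * (x - kap i t) ^+ 3 * - kd) - 12 * L * (x - kap i t) ^+ 2
        - al * b (x, t) * (4 * L * (x - kap i t) ^+ 3)
        + (V (x, t) - (curve_avg T V (kap i) - sg * eps)) * well_piece T V (kap i) sg L (x, t).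
Proof.
move=> H cV eps0 L0; have [T0 r0 a0 L0' _ _ k01 kd _ well _ _ _ _ _ _ _ _] := H.
have cg := curve_pot_continuous cV (@landscape_ck _ _ _ _ _ _ _ _ i H).
have [f0 [f1 [f00 f10 Hf]]] := weight_bounds T0 cg.
have [B B0 HB] := @bounded2 _ (V \o clamp2 0 T) 0 1 0 T cV.
have e2 : 0 < eps / 2 by rewrite divr_gt0.
have [d d0 Hd] := @ucont2 _ (V \o clamp2 0 T) 0 1 0 T cV _ e2.
have C0 : 0 <= 2 * B + eps by move: B0 eps0; clear; lra.
have d20 : 0 < d / 2 by rewrite divr_gt0.
have [A HA] := well_ineq f00 f10 eps0 d20 r0 L0 L0' C0.
exists A => al hal sg x t sg1 x01 tT xk.
have [v dv vL] := kd i t tT; exists v => //.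
have kk := k01 i t tT.
have gE := @curve_potE _ T V (kap i) t tT kk.
have bV y s : 0 <= y <= 1 -> 0 <= s <= T -> `|V (y, s)| <= B.
  by move=> y01 sT; have := HB y s y01 sT; rewrite /= clamp2_id.
have bav : `|curve_avg T V (kap i)| <= B.
  apply: curve_avg_abs => // s sT; rewrite curve_potE //; last exact: k01.
  by apply: bV => //; exact: k01.
have bx := bV x t x01 tT; have bk := bV _ t kk tT.
have sgabs : `|sg * eps| = eps.
  have s1 : `|sg| = 1.
    by apply/eqP; rewrite -(@pexpr_eq1 _ `|sg| 2) // -normrX expr2 sg1 normr1.
  by rewrite normrM s1 mul1r gtr0_norm.
rewrite /well_piece /=; apply: HA => //.
- by rewrite ler_norml; move: x01 kk; clear; lra.
- exact: Hf.
- move=> xd; rewrite gE; have := Hd x t (kap i t) t x01 tT kk tT.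
  rewrite subrr normr0 /= !clamp2_id // => h; apply: ltW; apply: h => //.
  by apply: le_lt_trans xd _; move: d0; clear; lra.
- rewrite gE; apply: le_trans (ler_normB _ _) _; move: bx bk eps0 B0; clear; lra.
- apply: le_trans (ler_normB _ _) _.
  have := ler_normB (curve_avg T V (kap i)) (sg * eps); rewrite sgabs.
  by move: bx bav; clear; lra.
have [h1 h2] := well i x t x01 tT xk.
case: (ltgtP (kap i t) x) => kx; last by rewrite kx subrr mul0r expr0n mulr0.
  have s0 : 0 <= x - kap i t by rewrite subr_ge0 ltW.
  by have := ler_wpM2l s0 (h1 kx); rewrite expr2; clear; lra.
have s0 : 0 <= kap i t - x by rewrite subr_ge0 ltW.
by have := ler_wpM2l s0 (h2 kx); rewrite expr2; clear; lra.
Qed.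

Lemma ratio_continuous (R : realType) (T : R) (P u : R * R -> R) : 0 <= T ->
  continuous (P \o clamp2 0 T) -> continuous u ->
  (forall x t : R, 0 <= x <= 1 -> 0 <= t <= T -> 0 < u (x, t)) ->
  continuous (fun z => P (clamp2 0 T z) / u (clamp2 0 T z)).
Proof.
move=> T0 cP cu u0 z; apply: cvgM; first exact: cP.
apply: cvgV; first by rewrite gt_eqF // u0 //; apply: clamp_in.
by apply: (@continuous_comp _ _ _ (clamp2 0 T) u); [exact: clamp2_cont|exact: cu].
Qed.

Lemma well_piece_continuous (R : realType) (T : R) (V : R * R -> R) (k : R -> R) (sg L : R) : 0 < T ->
  continuous (curve_pot T V k) -> continuous (fun t => k (clamp 0 T t)) ->
  continuous (well_piece T V k sg L \o clamp2 0 T).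
Proof.
move=> T0 cg ck z; apply: cvgD.
  apply: cvgM; first exact: cvg_cst.
  apply: (@continuous_comp _ _ _ snd (fun t => weight T (curve_pot T V k) (clamp 0 T t))).
    exact: cvg_snd.
  exact: weight_continuous.
apply: cvgM; first exact: cvg_cst.
apply: (@continuous_comp _ _ _ (fun z : R * R => clamp 0 1 z.1 - k (clamp 0 T z.2)) (fun x => x ^+ 4)); last first.
  exact: exprn_continuous.
apply: cvgB.
  by apply: (@continuous_comp _ _ _ fst); [exact: cvg_fst|exact: clamp_cont].
by apply: (@continuous_comp _ _ _ snd (fun t => k (clamp 0 T t))); [exact: cvg_snd|exact: ck].
Qed.

Lemma well_touch (R : realType) (T r a Lam al lam e L sg th mu : R) (b m V u ut ux uxx : R * R -> R) N
    (kap : 'I_N.+1 -> R -> R) i (x0 t0 kd : R) :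
  landscape T r a Lam b kap -> continuous (V \o clamp2 0 T) -> 0 < L ->
  near_eigenfunction T m V al lam e u ut ux uxx ->
  0 <= x0 <= 1 -> 0 < t0 <= T -> b (x0, t0) = dx m (x0, t0) ->
  (forall x t : R, 0 <= x <= 1 -> 0 <= t <= T -> th * u (x, t) <= well_piece T V (kap i) sg L (x, t)) ->
  well_piece T V (kap i) sg L (x0, t0) = th * u (x0, t0) ->
  sg * sg = 1 -> 0 < sg * th ->
  has_der `[0, T] (kap i) t0 kd ->
  0 < (sg * (- (curve_pot T V (kap i) t0 - curve_avg T V (kap i)) * weight T (curve_pot T V (kap i)) t0)
        + 4 * L * (x0 - kap i t0) ^+ 3 * - kd) - 12 * L * (x0 - kap i t0) ^+ 2
      - al * b (x0, t0) * (4 * L * (x0 - kap i t0) ^+ 3)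
      + (V (x0, t0) - mu) * well_piece T V (kap i) sg L (x0, t0) ->
  sg * (mu - lam) < e.
Proof.
move=> H cV L0 ne x01 t0T bm le PE sg1 sgth dk pos.
have T0 := ls_T0 H; have kk : 0 <= kap i t0 <= 1.
  by apply: (ls_k01 H); move: t0T; clear; lra.
have t0T' : 0 <= t0 <= T by move: t0T; clear; lra.
have cg := curve_pot_continuous cV (@landscape_ck _ _ _ _ _ _ _ _ i H).
have sub : [set` `[0, t0]] `<=` [set` `[0, T]].
  by move=> z; rewrite /= !in_itv /=; move: t0T; clear; lra.
have s3 s : (s ^+ 3 : R) = s * s ^+ 2 by rewrite exprS.
apply: (touch_bound ne x01 t0T (well_taylor (sg * weight T (curve_pot T V (kap i)) t0) L (kap i t0) x01)
  _ _ _ PE) => //; last first.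
- by rewrite bm in pos; exact: pos.
- move=> x1; rewrite s3 x1; apply: mulr_ge0; first by apply: mulr_ge0 => //; exact: ltW.
  by apply: mulr_ge0; [move: kk; clear; lra|exact: sqr_ge0].
- move=> x1; rewrite s3 x1 sub0r mulNr mulrN oppr_le0.
  apply: mulr_ge0; first by apply: mulr_ge0 => //; exact: ltW.
  by apply: mulr_ge0; [move: kk; clear; lra|exact: sqr_ge0].
- exists 1 => // s s0 _; apply: le => //; move: s0 t0T; clear; lra.
- by exists 1 => // y y01 _; exact: le.
apply: (well_time sg L x0); apply: has_der_subset sub _ => //.
exact: weight_der.
Qed.

Lemma well_piece_periodic (R : realType) (T : R) (V : R * R -> R) (k : R -> R) (sg L x : R) :
  0 < T -> k T = k 0 -> well_piece T V k sg L (x, T) = well_piece T V k sg L (x, 0).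
Proof. by move=> T0 kT; rewrite /well_piece /= weight_periodic // kT. Qed.

Lemma pow4_gt (R : realType) (r s c : R) : 0 < r -> 0 < c -> r < `|s| ->
  c < c / r ^+ 4 * s ^+ 4.
Proof.
move=> r0 c0 rs; rewrite mulrAC -mulrA ltr_pMr //.
rewrite ltr_pdivlMr ?exprn_gt0 // mul1r.
have -> : s ^+ 4 = `|s| ^+ 4 by rewrite -normrX ger0_norm // (exprM s 2 2) sqr_ge0.
by rewrite ltr_pXn2r // nnegrE ltW.
Qed.

Lemma upper_bound (R : realType) (T r a Lam eps : R) (b m V : R * R -> R) N
    (kap : 'I_N.+1 -> R -> R) i :
  landscape T r a Lam b kap -> continuous (V \o clamp2 0 T) -> 0 < eps ->
  (forall x t : R, 0 <= x <= 1 -> 0 <= t <= T -> b (x, t) = dx m (x, t)) ->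
  exists A, forall al, A <= al -> forall lam e u ut ux uxx,
    near_eigenfunction T m V al lam e u ut ux uxx ->
    lam < curve_avg T V (kap i) + eps + e.
Proof.
move=> H cV eps0 bm; have T0 := ls_T0 H; have r0 := ls_r0 H.
have ck := @landscape_ck _ _ _ _ _ _ _ _ i H.
have cg := curve_pot_continuous cV ck.
have [f0 [f1 [f00 f10 Hf]]] := weight_bounds T0 cg.
(* beyond distance [r] from the curve the quartic term exceeds the largest
   amplitude *)
pose L := f1 / r ^+ 4; have L0 : 0 < L by rewrite divr_gt0 // exprn_gt0.
have [A HA] := well_strict i H cV eps0 L0.
exists A => al hal lam e u ut ux uxx ne.
have [cu upos uT _ _] := ne.
pose P := well_piece T V (kap i) (-1) L.
have cP := @well_piece_continuous _ _ _ _ (-1) L T0 cg ck.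
have cF := ratio_continuous (ltW T0) cP cu upos.
have z1 : (0 : R) <= 1 by exact: ler01.
have [x0 [t0 [x01 t0T Hmin]]] := EVT_min2 z1 (ltW T0) cF.
pose th := P (x0, t0) / u (x0, t0).
have le x t : 0 <= x <= 1 -> 0 <= t <= T -> th * u (x, t) <= P (x, t).
  move=> hx ht; have := Hmin x t hx ht; rewrite !clamp2_id //.
  by rewrite -/P -/th ler_pdivlMr // upos.
have th0 : th < 0.
  have tT : (0 : R) <= 0 <= T by rewrite lexx ltW.
  have kk := ls_k01 H i tT.
  have := le _ _ kk tT; rewrite /P /well_piece /= subrr expr0n mulr0 addr0 mulN1r => h.
  rewrite ltNge; apply/negP => th0.
  have : 0 <= th * u (kap i 0, 0) by rewrite mulr_ge0 // ltW // upos.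
  by move: (weight_gt0 T (curve_pot T V (kap i)) 0) h; clear; lra.
(* by periodicity contact occurs at a positive time *)
have [t1 [t1T PE]] : exists t1, 0 < t1 <= T /\ P (x0, t1) = th * u (x0, t1).
  have PE : P (x0, t0) = th * u (x0, t0) by rewrite /th divfK // gt_eqF // upos.
  have [t00|t00] := eqVneq t0 0; last first.
    by exists t0; split=> //; rewrite lt_neqAle eq_sym t00.
  exists T; split; first by rewrite T0 lexx.
  by rewrite /P (well_piece_periodic _ _ _ _ T0 (ls_kT H i)) uT -t00.
have t1T' : 0 <= t1 <= T by move: t1T; clear; lra.
have near : `|x0 - kap i t1| <= r.
  rewrite leNgt; apply/negP => far.
  have := pow4_gt r0 f10 far; rewrite -/L => h.
  have : P (x0, t1) < 0 by rewrite PE nmulr_rlt0 // upos.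
  rewrite /P /well_piece /= mulN1r => h'.
  by have /andP[_] := Hf t1 t1T'; move: h h'; clear; lra.
have sg1 : (-1 : R) * -1 = 1 by rewrite mulrNN mulr1.
have [kd dk pos] := HA al hal (-1) x0 t1 sg1 x01 t1T' near.
have sgth : 0 < -1 * th by rewrite mulN1r oppr_gt0.
have := well_touch (i := i) H cV L0 ne x01 t1T (bm _ _ x01 t1T') le PE sg1 sgth dk pos.
by clear; lra.
Qed.

Lemma in_gap_near (R : realType) (T r a Lam : R) b N (kap : 'I_N.+1 -> R -> R) g (x t : R) :
  landscape T r a Lam b kap -> 0 <= x <= 1 -> 0 <= t <= T ->
  in_gap kap r g x t -> (forall i, r / 2 < `|x - kap i t|) ->
  (exists2 d, 0 < d & forall y, 0 <= y <= 1 -> `|y - x| < d -> in_gap kap r g y t) /\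
  (exists2 d, 0 < d & forall s, 0 <= s <= t -> `|s - t| < d -> in_gap kap r g x s).
Proof.
move=> H x01 tT; case: g => p q /andP[/= lo hi] far; have r0 := ls_r0 H.
have time i e : 0 < e -> exists2 d, 0 < d & forall s, 0 <= s <= t -> `|s - t| < d ->
    `|kap i s - kap i t| < e.
  move=> e0; have [v dv _] := ls_kd H i tT; have [d d0 Hd] := has_der_cont dv e0.
  exists d => // s st; apply: Hd; rewrite /= in_itv /=; move: st tT; clear; lra.
have [d [d0 HdL HdR]] : exists d, [/\ 0 < d,
    forall y, 0 <= y -> `|y - x| < d -> gap_lo kap r p t <= y &
    forall s, 0 <= s <= t -> `|s - t| < d -> gap_lo kap r p s <= x].
  case: p lo => [i|] lo; last first.
    by exists 1; split=> //= *; case/andP: x01.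
  have m0 : 0 < x - (kap i t + r / 2).
    rewrite subr_gt0 lt_neqAle lo andbT; apply/eqP => E; have := far i.
    by rewrite -E addrC addKr ger0_norm ?ltxx // divr_ge0 // ltW.
  have [d d0 Hd] := time i _ m0.
  exists (Num.min d (x - (kap i t + r / 2))); split; first by rewrite lt_min d0.
    by move=> y _; rewrite lt_min => /andP[_] /=; rewrite ltr_norml; clear; lra.
  move=> s hs; rewrite lt_min => /andP[/(Hd s hs)] /=; rewrite ltr_norml; clear; lra.
have [d' [d'0 HdL' HdR']] : exists d, [/\ 0 < d,
    forall y, y <= 1 -> `|y - x| < d -> y <= gap_hi kap r q t &
    forall s, 0 <= s <= t -> `|s - t| < d -> x <= gap_hi kap r q s].
  case: q hi => [i|] hi; last first.
    by exists 1; split=> //= *; case/andP: x01.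
  have m0 : 0 < (kap i t - r / 2) - x.
    rewrite subr_gt0 lt_neqAle hi andbT; apply/eqP => E; have := far i.
    by rewrite E addrC addKr normrN ger0_norm ?ltxx // divr_ge0 // ltW.
  have [d'' d0'' Hd] := time i _ m0.
  exists (Num.min d'' ((kap i t - r / 2) - x)); split; first by rewrite lt_min d0''.
    by move=> y _; rewrite lt_min => /andP[_] /=; rewrite ltr_norml; clear; lra.
  move=> s hs; rewrite lt_min => /andP[/(Hd s hs)] /=; rewrite ltr_norml; clear; lra.
have dd : 0 < Num.min d d' by rewrite lt_min d0.
split; exists (Num.min d d') => // y y0; rewrite lt_min => /andP[h1 h2]; rewrite /in_gap /=.
  by rewrite HdL ?HdL' //; case/andP: y0.
by rewrite HdR ?HdR'.
Qed.

Lemma in_gap_closed (R : realType) (T r a Lam : R) b N (kap : 'I_N.+1 -> R -> R) g :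
  landscape T r a Lam b kap -> closed [set z : R * R | in_gap kap r g z.1 (clamp 0 T z.2)].
Proof.
move=> H.
have ck i : continuous (fun z : R * R => kap i (clamp 0 T z.2)).
  move=> z; apply: (@continuous_comp _ _ _ snd (fun t => kap i (clamp 0 T t))); first exact: cvg_snd.
  exact: (landscape_ck (i := i) H).
have clo : continuous (fun z : R * R => gap_lo kap r g.1 (clamp 0 T z.2)).
  rewrite /gap_lo; case: g.1 => [i|] z; last exact: cvg_cst.
  by apply: cvgD; [exact: ck|exact: cvg_cst].
have chi : continuous (fun z : R * R => gap_hi kap r g.2 (clamp 0 T z.2)).
  rewrite /gap_hi; case: g.2 => [i|] z; last exact: cvg_cst.
  by apply: cvgB; [exact: ck|exact: cvg_cst].
rewrite (_ : [set z | _] = (fun z : R * R => z.1 - gap_lo kap r g.1 (clamp 0 T z.2)) @^-1` [set y | 0 <= y]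
   `&` (fun z : R * R => gap_hi kap r g.2 (clamp 0 T z.2) - z.1) @^-1` [set y | 0 <= y]); last first.
  by apply/seteqP; split=> z; rewrite /in_gap /= !subr_ge0; [move=> /andP[]|move=> [-> ->]].
apply: closedI.
  apply: closed_comp => [z _|]; last exact: closed_ge.
  by apply: cvgB; [exact: cvg_fst|exact: clo].
apply: closed_comp => [z _|]; last exact: closed_ge.
by apply: cvgB; [exact: chi|exact: cvg_fst].
Qed.

(** * Gap functions and the lower bound *)

Lemma gap_piece_continuous (R : realType) (T A0 K : R) (y : R -> R) : continuous y ->
  continuous (gap_piece A0 K y \o clamp2 0 T).
Proof.
move=> cy z; apply: cvgM; first exact: cvg_cst.
apply: cvgD; first exact: cvg_cst.
apply: (@continuous_comp _ _ _ (fun z : R * R => clamp 0 1 z.1 - y (clamp 0 T z.2))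
  (fun s => expR (- (K * s ^+ 2)))).
  apply: cvgB.
    by apply: (@continuous_comp _ _ _ fst); [exact: cvg_fst|exact: clamp_cont].
  apply: (@continuous_comp _ _ _ snd (fun t => y (clamp 0 T t))); first exact: cvg_snd.
  by apply: continuous_comp; [exact: clamp_cont|exact: cy].
apply: (@continuous_comp _ _ _ (fun s : R => - (K * s ^+ 2)) expR); last exact: continuous_expR.
by apply: cvgN; apply: cvgM; [exact: cvg_cst|exact: exprn_continuous].
Qed.

(** The point is away from all curves, so that a neighbourhood of it belongs to
    the gap and the contact is a local one. *)
Lemma gap_touch (R : realType) (T r a Lam al lam e A0 K th mu : R) (b m V u ut ux uxx : R * R -> R) N
    (kap : 'I_N.+1 -> R -> R) (g : option 'I_N.+1 * option 'I_N.+1) (y : R -> R) (x0 t0 : R) :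
  landscape T r a Lam b kap -> 0 < A0 -> 0 < K -> 0 < th ->
  near_eigenfunction T m V al lam e u ut ux uxx ->
  0 <= x0 <= 1 -> 0 < t0 <= T -> b (x0, t0) = dx m (x0, t0) ->
  in_gap kap r g x0 t0 -> (forall i, r / 2 < `|x0 - kap i t0|) ->
  (forall x t : R, 0 <= x <= 1 -> 0 <= t <= T -> in_gap kap r g x t ->
    th * u (x, t) <= gap_piece A0 K y (x, t)) ->
  gap_piece A0 K y (x0, t0) = th * u (x0, t0) ->
  hump_curve T al (a / 2) (1 / 4) b (in_gap kap r g) y ->
  (g.1 = None -> forall t, y t = 0) -> (g.2 = None -> forall t, y t = 1) ->
  (forall s v : R, `|s| <= 1 ->
    al * (a / 2) * s ^+ 2 - 1 / 4 * `|s| <= s * (v + al * b (x0, t0)) ->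
    forall e, e = expR (- (K * s ^+ 2)) ->
    0 < A0 * (2 * K * s * v * e) - A0 * ((4 * K ^+ 2 * s ^+ 2 - 2 * K) * e)
        - al * b (x0, t0) * (A0 * (- (2 * K * s) * e)) + (V (x0, t0) - mu) * (A0 * (1 + e))) ->
  mu - lam < e.
Proof.
move=> H A00 K0 th0 ne x01 t0T bm ig far le PE [cy yT y01 Hy] y0 y1 ineq.
have t0T' : 0 <= t0 <= T by move: t0T; clear; lra.
have r0 := ls_r0 H.
have [[d d0 Hd] [d' d'0 Hd']] := in_gap_near H x01 t0T' ig far.
have [v dv hv] := Hy t0 t0T.
have yy := y01 t0 t0T'.
have s1 : `|x0 - y t0| <= 1 by rewrite ler_norml; move: x01 yy; clear; lra.
have pos := ineq _ v s1 (hv x0 x01 ig) _ erefl.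
rewrite bm in pos.
have sg1 : (1 : R) * 1 = 1 by rewrite mulr1.
have sgth : 0 < 1 * th by rewrite mul1r.
rewrite -[X in X < _]mul1r.
apply: (touch_bound ne x01 t0T (gap_taylor A0 K (y t0) x01) (gap_time A0 K x0 dv) _ _ PE) => //.
- by exists d => // z z01 zd; apply: le => //; exact: Hd.
- exists d' => // s st sd; apply: le => //; last exact: Hd'.
  by move: st t0T; clear; lra.
- move=> x00; have -> : y t0 = 0.
    apply: y0; case E: g.1 => [i|//].
    exfalso; have := ls_k01 H i t0T'; case/andP: ig => + _; rewrite E /= x00; move: r0; clear; lra.
  by rewrite x00 subrr !(mulr0, oppr0, mul0r).
move=> x00; have -> : y t0 = 1.
  apply: y1; case E: g.2 => [i|//].
  exfalso; have := ls_k01 H i t0T'; case/andP: ig => _; rewrite E /= x00; move: r0; clear; lra.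
by rewrite x00 subrr !(mulr0, oppr0, mul0r).
Qed.

(** The pieces are indexed by a sum type: wells, defined on the whole box, and
    gap functions, defined on the part of their gap away from the curves. The
    least quotient [P / u] over all pieces and their domains is a contact point
    to which [well_touch] or [gap_touch] applies. *)
Lemma lower_bound (R : realType) (T r a Lam eps M : R) (b m V : R * R -> R) N
    (kap : 'I_N.+1 -> R -> R) :
  landscape T r a Lam b kap -> continuous (V \o clamp2 0 T) -> 0 < eps ->
  (forall x t : R, 0 <= x <= 1 -> 0 <= t <= T -> b (x, t) = dx m (x, t)) ->
  (forall i, M <= curve_avg T V (kap i)) ->
  exists A, forall al, A <= al -> forall lam e u ut ux uxx,
    near_eigenfunction T m V al lam e u ut ux uxx ->
    M - eps < lam + e.
Proof.
move=> H cV eps0 bm HM; have T0 := ls_T0 H; have r0 := ls_r0 H; have a0 := ls_a0 H.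
have T0' : 0 <= T by exact: ltW.
have ck i : continuous (fun t => kap i (clamp 0 T t)) by exact: (landscape_ck (i := i) H).
have cg i := curve_pot_continuous cV (ck i).
pose mu := M - eps.
have [B B0 HB] := @bounded2 _ (V \o clamp2 0 T) 0 1 0 T cV.
have C0 : 0 <= B + `|mu| by rewrite addr_ge0 // ltW.
have a20 : 0 < a / 2 by rewrite divr_gt0.
have [K K0 [A1 HA1]] := gap_ineq a20 C0.
have [W0 HW0] : exists W0, forall W, W0 <= W -> forall i : 'I_N.+1, forall t, 0 <= t <= T ->
    weight T (curve_pot T V (kap i)) t <= W.
  apply: (@finite_eventually _ _ (fun (i : 'I_N.+1) W => forall t, 0 <= t <= T ->
    weight T (curve_pot T V (kap i)) t <= W)) => i.
  have [f0 [f1 [_ _ Hf]]] := weight_bounds T0 (cg i).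
  by exists f1 => W hW t /Hf /andP[_ h]; exact: le_trans hW.
pose A0 := 2 * (`|W0| + 1); have A00 : 0 < A0 by rewrite mulr_gt0 // ltr_wpDl.
have HW i t : 0 <= t <= T -> weight T (curve_pot T V (kap i)) t <= A0 / 2.
  apply: HW0; rewrite /A0; have := ler_norm W0; clear; lra.
(* A gap function takes values in [[A0, 2 A0]]. At distance [r] a well is above
   [3 A0], so that contact with a well occurs closer to its curve; within
   distance [r / 2] it is below [A0], so that contact with a gap function occurs
   farther away. *)
have A30 : 0 < 3 * A0 by rewrite mulr_gt0.
pose L := 3 * A0 / r ^+ 4; have L0 : 0 < L by rewrite divr_gt0 // exprn_gt0.
have [A2 HA2] := finite_eventually (fun i => well_strict i H cV eps0 L0).
have [A3 HA3] : exists A, forall al, A <= al -> forall g : option 'I_N.+1 * option 'I_N.+1,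
    exists y, continuous y /\ (valid_at kap 0 g ->
      [/\ hump_curve T al (a / 2) (1 / 4) b (in_gap kap r g) y,
        g.1 = None -> forall t, y t = 0 & g.2 = None -> forall t, y t = 1]).
  apply: (@finite_eventually _ _ (fun (g : option 'I_N.+1 * option 'I_N.+1) al =>
    exists y, continuous y /\ (valid_at kap 0 g ->
      [/\ hump_curve T al (a / 2) (1 / 4) b (in_gap kap r g) y,
        g.1 = None -> forall t, y t = 0 & g.2 = None -> forall t, y t = 1]))) => g.
  have [v|nv] := pselect (valid_at kap 0 g); last first.
    by exists 0 => al _; exists (fun=> 0); split=> // t; exact: cvg_cst.
  have [A HA] := gap_hump H v; exists A => al /HA[y hy [h1 h2]].
  by exists y; split=> //; case: hy.
exists (Num.max A1 (Num.max A2 A3)) => al; rewrite !ge_max => /and3P[al1 al2 al3].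
move=> lam e u ut ux uxx ne; have [cu upos uT _ _] := ne.
have [y Hy] := choice (HA3 al al3).
pose P (k : 'I_N.+1 + option 'I_N.+1 * option 'I_N.+1) : R * R -> R :=
  match k with inl i => well_piece T V (kap i) 1 L | inr g => gap_piece A0 K (y g) end.
pose box := `[0, 1] `*` `[0, T] : set (R * R).
pose dom (k : 'I_N.+1 + option 'I_N.+1 * option 'I_N.+1) : set (R * R) := box `&`
  match k with inl _ => setT | inr g => [set z | valid_at kap 0 g] `&`
    [set z | in_gap kap r g z.1 (clamp 0 T z.2)] end.
have cdom k : compact (dom k).
  apply: compact_closedI; first exact: box_compact.
  case: k => [i|g]; first exact: closedT.
  apply: closedI; last exact: in_gap_closed H.
  have [v|nv] := pselect (valid_at kap 0 g).
    by rewrite (_ : [set _ | _] = setT); [exact: closedT|apply/seteqP; split].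
  by rewrite (_ : [set _ | _] = set0); [exact: closed0|apply/seteqP; split].
have cF k : continuous (fun z => P k (clamp2 0 T z) / u (clamp2 0 T z)).
  apply: ratio_continuous => //; case: k => [i|g].
    exact: well_piece_continuous.
  by apply: gap_piece_continuous; case: (Hy g).
have ne0 : exists k, dom k !=set0.
  exists (inl ord0), (0, 0); split=> //; split; rewrite /= in_itv /=.
    by rewrite lexx ler01.
  by rewrite lexx T0'.
have [k [[x0 t0] [[[/= x01 t0T] dk] Hmin]]] := family_min cdom cF ne0.
rewrite in_itv /= in x01; rewrite in_itv /= in t0T.
pose th := P k (x0, t0) / u (x0, t0).
have le k' x t : 0 <= x <= 1 -> 0 <= t <= T -> dom k' (x, t) -> th * u (x, t) <= P k' (x, t).
  move=> hx ht /Hmin; rewrite !clamp2_id //.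
  by rewrite -/th ler_pdivlMr // upos.
have pow4 (s : R) : 0 <= s ^+ 4 by rewrite (exprM s 2 2) sqr_ge0.
have Ppos z : 0 < P k z.
  case: (k) => [i|g] /=.
    rewrite /well_piece mul1r ltr_pwDl ?weight_gt0 //.
    by rewrite mulr_ge0 // ltW.
  by rewrite /gap_piece mulr_gt0 // ltr_wpDr // expR_ge0.
have th0 : 0 < th by rewrite divr_gt0 // upos.
(* by periodicity contact occurs at a positive time *)
have [t1 [t1T PE dk1]] : exists t1, [/\ 0 < t1 <= T, P k (x0, t1) = th * u (x0, t1) & dom k (x0, t1)].
  have PE : P k (x0, t0) = th * u (x0, t0) by rewrite /th divfK // gt_eqF // upos.
  have b0 : box (x0, t0) by split; rewrite /= in_itv.
  have [t00|t00] := eqVneq t0 0; last first.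
    by exists t0; split=> //; rewrite lt_neqAle eq_sym t00; case/andP: t0T => -> ->.
  have tT : 0 <= T <= T by rewrite T0' lexx.
  have zT : (0 : R) <= 0 <= T by rewrite T0' lexx.
  exists T; split; first by rewrite T0 lexx.
    rewrite uT -t00 -PE t00; case: (k) dk => [i _|g [vg _]] /=.
      exact: well_piece_periodic T0 (ls_kT H i).
    by have [_ /(_ vg)[[_ yT _ _] _ _]] := Hy g; rewrite /gap_piece /= yT.
  split; first by split; rewrite /= in_itv.
  case: (k) dk => [//|g] [v ig]; split=> //; move: ig; rewrite /= t00 !clamp_id //.
  rewrite /in_gap /gap_lo /gap_hi; case: g.1 => [i|]; case: g.2 => [j|] //; rewrite ?(ls_kT H) //.
have t1T' : 0 <= t1 <= T by move: t1T; clear; lra.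
have boxd x t : 0 <= x <= 1 -> 0 <= t <= T -> box (x, t) by split; rewrite /= in_itv.
have wle i : `|x0 - kap i t1| <= r / 2 -> well_piece T V (kap i) 1 L (x0, t1) < A0.
  move=> hs; have r2 : 0 <= r / 2 by rewrite divr_ge0 // ltW.
  have h4 : (x0 - kap i t1) ^+ 4 <= (r / 2) ^+ 4.
    have -> : (x0 - kap i t1) ^+ 4 = `|x0 - kap i t1| ^+ 4 by rewrite -normrX ger0_norm.
    by rewrite lerXn2r // nnegrE.
  have E : L * (r / 2) ^+ 4 = 3 * A0 / 16.
    by rewrite /L; field; rewrite gt_eqF.
  have := ler_wpM2l (ltW L0) h4; rewrite E /well_piece /= mul1r; have := HW i t1 t1T'.
  by move: A00; clear; lra.
(* some piece defined at the contact point is at most [2 A0], hence so is the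
   touching one *)
have small : P k (x0, t1) <= 2 * A0.
  rewrite PE; have [[i hi]|no] := pselect (exists i, `|x0 - kap i t1| <= r / 2).
    apply: (@le_trans _ _ (well_piece T V (kap i) 1 L (x0, t1))).
      by apply: (le (inl i)) => //; split=> //; exact: boxd.
    by have := wle i hi; move: A00; clear; lra.
  have far i : r / 2 < `|x0 - kap i t1| by rewrite ltNge; apply/negP => h; apply: no; exists i.
  have [g vg ig] := gap_cover H x01 t1T' far.
  apply: (@le_trans _ _ (gap_piece A0 K (y g) (x0, t1))).
    apply: (le (inr g)) => //; split; first exact: boxd.
    split; last by rewrite /= clamp_id.
    by apply: valid_preserved H t1T' _ vg; rewrite lexx T0'.
  rewrite /gap_piece /= mulrC ler_pM2r //; have : expR (- (K * (x0 - y g t1) ^+ 2)) <= 1.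
    by rewrite -expR0 ler_expR oppr_le0 mulr_ge0 ?sqr_ge0 // ltW.
  by clear; lra.
suff : mu - lam < e by rewrite /mu; clear; lra.
case: k Hmin dk th le Ppos th0 PE dk1 small => [i|g] Hmin dk th le Ppos th0 PE dk1 small.
  have near : `|x0 - kap i t1| <= r.
    rewrite leNgt; apply/negP => far.
    have := pow4_gt r0 A30 far; rewrite -/L => h.
    move: small; rewrite /= /well_piece /= mul1r.
    by move: (weight_gt0 T (curve_pot T V (kap i)) t1) h A00; clear; lra.
  have sg1 : (1 : R) * 1 = 1 by rewrite mulr1.
  have sgth : 0 < 1 * th by rewrite mul1r.
  have [kd dkd pos] := HA2 al al2 i 1 x0 t1 sg1 x01 t1T' near.
  have le' (x t : R) : 0 <= x <= 1 -> 0 <= t <= T -> th * u (x, t) <= well_piece T V (kap i) 1 L (x, t).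
    by move=> hx ht; apply: (le (inl i)) => //; split=> //; exact: boxd.
  have lem : (V (x0, t1) - (curve_avg T V (kap i) - 1 * eps)) * well_piece T V (kap i) 1 L (x0, t1) <=
      (V (x0, t1) - mu) * well_piece T V (kap i) 1 L (x0, t1).
    rewrite ler_pM2r; last exact: Ppos.
    by have := HM i; rewrite /mu; clear; lra.
  rewrite -[X in X < _]mul1r.
  apply: (well_touch (i := i) H cV L0 ne x01 t1T (bm _ _ x01 t1T') le' PE sg1 sgth dkd).
  by apply: lt_le_trans pos _; rewrite lerD2l.
have [_ [vg]] := dk1; rewrite /= clamp_id // => ig.
have [_ /(_ vg)[hy y0 y1]] := Hy g.
have far i : r / 2 < `|x0 - kap i t1|.
  rewrite ltNge; apply/negP => h; have := wle i h.
  have : th * u (x0, t1) <= well_piece T V (kap i) 1 L (x0, t1).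
    by apply: (le (inl i)) => //; split=> //; exact: boxd.
  rewrite -PE /= /gap_piece /=.
  have : A0 * 1 <= A0 * (1 + expR (- (K * (x0 - y g t1) ^+ 2))).
    by rewrite ler_pM2l // lerDl expR_ge0.
  by clear; lra.
apply: (gap_touch H A00 K0 th0 ne x01 t1T (bm _ _ x01 t1T') ig far _ PE hy y0 y1).
  move=> x t hx ht hg; apply: (le (inr g)) => //; split; first exact: boxd.
  by split=> //=; rewrite clamp_id.
move=> s v s1 hs e' ee; apply: (HA1 al al1) => //.
apply: le_trans (ler_normB _ _) _; rewrite lerD2r.
by have := HB x0 t1 x01 t1T'; rewrite /= clamp2_id.
Qed.

(** * From the maxima of m to the limit *)

Section Setup.
Context (R : realType).
Implicit Types (T : R) (m : R * R -> R).

(** The slopes of [m] are continuous on the strip only; extended in this way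
    they are continuous on the plane. *)
Definition xclamp (f : R * R -> R) (z : R * R) : R := f (clamp 0 1 z.1, z.2).

Lemma xclamp_continuous (f : R * R -> R) :
  {within `[0, 1] `*` [set: R], continuous f} -> continuous (xclamp f).
Proof.
rewrite -[xclamp f]/(f \o (fun z => (clamp 0 1 z.1, z.2))); apply: within_comp.
  apply: cont_pair => z; last exact: cvg_snd.
  by apply: (@continuous_comp _ _ _ fst); [exact: cvg_fst|exact: clamp_cont].
by move=> z; split=> //=; rewrite in_itv /=; apply: clamp_in; exact: ler01.
Qed.

Lemma xclampE (f : R * R -> R) (x t : R) : 0 <= x <= 1 -> xclamp f (x, t) = f (x, t).
Proof. by move=> x01; rewrite /xclamp /= clamp_id. Qed.

Lemma xclamp_periodic T (f : R * R -> R) : t_periodic T f ->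
  forall x t : R, xclamp f (x, t + T) = xclamp f (x, t).
Proof. by move=> per x t; apply: per; rewrite /= in_itv /=; apply: clamp_in; exact: ler01. Qed.

Lemma dx_periodic T (f : R * R -> R) : x_derivable [set: R] f -> t_periodic T f ->
  t_periodic T (dx f).
Proof.
move=> df per x t; rewrite /= in_itv /= => x01.
by apply: (dx_eq df) => // y y01; apply: per; rewrite /= in_itv.
Qed.

Lemma xclamp_der (f : R * R -> R) (x t : R) : x_derivable [set: R] f -> 0 <= x <= 1 ->
  has_der `[0, 1] (fun y => xclamp f (y, t)) x (xclamp (dx f) (x, t)).
Proof.
move=> df x01; rewrite xclampE //.
apply: (has_der_ext _ _ (dx_has_der (t := t) df x01 I)); first by rewrite /= in_itv.
by move=> y; rewrite /= in_itv /= => y01; rewrite xclampE.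
Qed.

(** For a maximum the first and second order conditions are those of the
    second-order expansion, strict by nondegeneracy; conversely, the leading
    nonzero term of the expansion decides. *)
Lemma local_max_crit T m (x t : R) : C20 [set: R] m -> all_critical_nondegenerate T m ->
  0 <= x <= 1 -> 0 <= t <= T ->
  (\forall y \near x, `[0, 1]%classic y -> m (y, t) <= m (x, t)) <->
  crit_max (xclamp (dx m)) (xclamp (dx (dx m))) x t.
Proof.
move=> [[_ dm _] [_ ddm _]] nd x01 tT.
have tay : taylor2 `[0, 1] (fun y => m (y, t)) x (dx m (x, t)) (dx (dx m) (x, t)).
  apply: (taylor2P x01 (f' := fun y => dx m (y, t))) => [s s01|].
    exact: (dx_has_der (t := t) dm).
  exact: (dx_has_der (t := t) ddm).
rewrite /crit_max !xclampE //; split=> [[d /= d0 Hd]|[h1 h2 h3]].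
  have mn : exists2 d, 0 < d & forall y, 0 <= y <= 1 -> `|y - x| < d -> -1 * m (x, t) <= -1 * m (y, t).
    exists d => // y y01 yd; have : m (y, t) <= m (x, t).
      by apply: Hd; rewrite /ball_ /= ?in_itv //= distrC.
    by clear; lra.
  have ntay := taylor2Z (-1) tay; split=> hx.
  - have x1 : 0 < x <= 1 by move: hx x01; clear; lra.
    by have := local_min_left ntay x1 mn; clear; lra.
  - have x1 : 0 <= x < 1 by move: hx x01; clear; lra.
    by have := local_min_right ntay x1 mn; clear; lra.
  have p0 : -1 * dx m (x, t) = 0 by rewrite hx mulr0.
  have := local_min_second ntay x01 p0 mn => h.
  have : dx (dx m) (x, t) != 0.
    have tT' : [set` `[0, T]] t by rewrite /= in_itv.
    have [nd1 nd2] := nd t tT'.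
    have [x0|x0] := eqVneq x 0; first by case: (nd2 x (or_introl x0)); rewrite ?hx ?eqxx.
    have [x1|x1] := eqVneq x 1; first by case: (nd2 x (or_intror x1)); rewrite ?hx ?eqxx.
    by apply: nd1 => //; rewrite /= in_itv /= !lt_neqAle x1 eq_sym x0.
  by rewrite neq_lt => /orP[//|]; move: h; clear; lra.
have [b0|b0] := eqVneq (dx m (x, t)) 0.
  have q0 := h3 b0; have e0 : 0 < - dx (dx m) (x, t) / 4 by move: q0; clear; lra.
  have [d d0 Hd] := tay _ e0; exists d => //= y; rewrite /ball_ /= distrC => yx y01.
  have := Hd y y01 yx; rewrite b0 ler_norml => /andP[_].
  have X0 := sqr_ge0 (y - x); have := mulr_le0_ge0 (ltW q0) X0.
  by clear; lra.
have [d d0 Hd] := dx_has_der (t := t) dm x01 I (e := `|dx m (x, t)|) (ltac:(by rewrite normr_gt0)).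
exists d => //= y; rewrite /ball_ /= distrC => yx y01.
have := Hd y y01 yx; rewrite ler_norml => /andP[_]; move: y01; rewrite in_itv /= => y01.
have [x1|x1] := ltP x 1.
  have [x0|x0] := ltP 0 x.
    by case/negP: b0; apply/eqP/le_anti; rewrite h1 // h2.
  have yx0 : 0 <= y - x by move: x0 y01; clear; lra.
  by rewrite (ler0_norm (h2 x1)) (ger0_norm yx0); clear; lra.
have b1 : 0 <= dx m (x, t) by apply: h1; move: x1; clear; lra.
have yx0 : y - x <= 0 by move: x1 y01; clear; lra.
by rewrite (ger0_norm b1) (ler0_norm yx0); clear; lra.
Qed.
End Setup.

Lemma C1_lipschitz (R : realType) (T : R) (k : R -> R) : 0 <= T -> C1_in `[0, T] k ->
  exists Lam, forall L, Lam <= L -> forall t, 0 <= t <= T ->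
    exists2 v, has_der `[0, T] k t v & `|v| <= L.
Proof.
move=> T0 [dk cdk]; have cd := within_clamp T0 cdk.
have cn : continuous (fun t => `|derive_in `[0, T] k (clamp 0 T t)|).
  by move=> t; apply: cvg_norm; exact: cd.
have [t0 _ Hmax] := EVT_max T0 (continuous_subspaceT cn).
exists `|derive_in `[0, T] k (clamp 0 T t0)| => L hL t tT.
exists (derive_in `[0, T] k t).
  by apply: has_der_derive_in; apply: dk; rewrite /= in_itv.
apply: le_trans hL; have := Hmax t; rewrite in_itv /= => /(_ tT).
by rewrite (clamp_id tT).
Qed.

(** All constants come from compactness of [[0, 1] x [0, T]]. *)
Lemma maxima_landscape (R : realType) (T : R) (m : R * R -> R) (N : nat) (kap : 'I_N.+1 -> R -> R) :
  0 < T -> C20 [set: R] m -> t_periodic T m -> all_critical_nondegenerate T m ->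
  (forall i, C1_in `[0, T] (kap i)) ->
  spatial_local_maxima T m =
    [set z | exists i t, `[0, T]%classic t /\ z = (kap i t, t)] ->
  exists r a Lam, landscape T r a Lam (xclamp (dx m)) kap.
Proof.
move=> T0 mC per nd kC max; have T0' := ltW T0.
have [[_ dm cdm] [_ ddm cddm]] := mC.
pose b := xclamp (dx m); pose bx := xclamp (dx (dx m)).
have cb : continuous b by exact: xclamp_continuous.
have cbx : continuous bx by exact: xclamp_continuous.
have perb := xclamp_periodic (dx_periodic dm per).
have perbx := xclamp_periodic (dx_periodic ddm (dx_periodic dm per)).
have db (x t : R) : 0 <= x <= 1 -> has_der `[0, 1] (fun y => b (y, t)) x (bx (x, t)).
  by move=> x01; exact: xclamp_der.
have k01 i (t : R) : 0 <= t <= T -> 0 <= kap i t <= 1.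
  move=> tT; have : spatial_local_maxima T m (kap i t, t).
    by rewrite max; exists i, t; split=> //; rewrite /= in_itv.
  by move=> [[/=]]; rewrite !in_itv.
have crit (x t : R) : 0 <= x <= 1 -> 0 <= t <= T ->
    crit_max b bx x t <-> exists i, x = kap i t.
  move=> x01 tT; rewrite -(local_max_crit mC nd x01 tT).
  have E : spatial_local_maxima T m (x, t) <-> exists i, x = kap i t.
    rewrite max; split=> [[i [s [_ [-> ->]]]]|[i ->]]; first by exists i.
    by exists i, t; split=> //; rewrite /= in_itv.
  rewrite -E; split=> [h|[_ h]]; last exact: h.
  by split; [split; rewrite /= in_itv|exact: h].
have ndb (x t : R) : 0 <= x <= 1 -> 0 <= t <= T -> b (x, t) = 0 -> bx (x, t) <> 0.
  move=> x01 tT; rewrite /b /bx !xclampE // => b0; apply/eqP.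
  have tT' : [set` `[0, T]] t by rewrite /= in_itv.
  have [nd1 nd2] := nd t tT'.
  have [x0|x0] := eqVneq x 0; first by case: (nd2 x (or_introl x0)); rewrite ?b0 ?eqxx.
  have [x1|x1] := eqVneq x 1; first by case: (nd2 x (or_intror x1)); rewrite ?b0 ?eqxx.
  by apply: nd1 => //; rewrite /= in_itv /= !lt_neqAle x1 eq_sym x0.
have [Lam0 HLam] := finite_eventually (fun i => C1_lipschitz T0' (kC i)).
have kd i (t : R) : 0 <= t <= T -> exists2 v, has_der `[0, T] (kap i) t v & `|v| <= `|Lam0|.
  by apply: HLam; exact: ler_norm.
have ck i : continuous (fun t => kap i (clamp 0 T t)).
  apply: clamp_continuous_in => // t tT e e0.
  have [v dv _] := kd i t tT; have [d d0 Hd] := has_der_cont dv e0.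
  by exists d => // y hy; apply: Hd; rewrite /= in_itv.
have [r r0 hw] := wells T0 cb cbx db crit k01 ck.
have r4 : 0 < r / 4 by rewrite divr_gt0.
have [a a0 hs] := gap_slope cb cbx ndb crit ck r4.
exists r, a, `|Lam0|; split=> //.
- move=> i; apply: (kap_periodic T0 crit k01 ck r0 hw) => x x01.
  have E (f : R * R -> R) : (forall x t : R, f (x, t + T) = f (x, t)) -> f (x, T) = f (x, 0).
    by move=> p; rewrite -[T in LHS]add0r p.
  by rewrite /crit_max (E b perb) (E bx perbx).
- by move=> i j t; exact: (separation k01 r0 hw).
- by move=> i j s t; exact: (order_preserved k01 ck r0 hw).
- by move=> x y t; exact: (mono_right db a0 hs).
- by move=> x y t; exact: (mono_left db a0 hs).
- by move=> c x y t; exact: (level_right db a0 hs).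
- by move=> c x y t; exact: (level_left db a0 hs).
- move=> t tT kpos; rewrite leNgt; apply/negP => b0.
  have z01 := introT andP (conj (lexx (0 : R)) (@ler01 R)).
  have : crit_max b bx 0 t.
    by split=> [|_|E]; [rewrite ltxx|exact: ltW|rewrite -/b E ltxx in b0].
  by move/(crit 0 t z01 tT) => [i E]; have := kpos i; rewrite -E ltxx.
move=> t tT kpos; rewrite leNgt; apply/negP => b0.
have z01 := introT andP (conj (@ler01 R) (lexx (1 : R))).
have : crit_max b bx 1 t.
  by split=> [_||E]; [exact: ltW|rewrite ltxx|rewrite -/b E ltxx in b0].
by move/(crit 1 t z01 tT) => [i E]; have := kpos i; rewrite -E ltxx.
Qed.

Theorem theorem1p1 (R : realType) (T : R) (m V : R * R -> R)
    (N : nat) (kappa : 'I_N.+1 -> R -> R) (lambda : R -> R)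
    (T_gt0 : 0 < T)
    (m_C20 : C20 [set: R] m) (m_periodic : t_periodic T m)
    (V_continuous : {within `[0, 1] `*` [set: R], continuous V})
    (V_periodic : t_periodic T V)
    (m_nondegenerate : all_critical_nondegenerate T m)
    (kappa_C1 : forall i, C1_in `[0, T] (kappa i))
    (kappa_maxima : spatial_local_maxima T m =
       [set z | exists i t, `[0, T]%classic t /\ z = (kappa i t, t)])
    (lambda_principal : forall alpha, 0 < alpha ->
       principal_eigenvalue T m V alpha (lambda alpha)) :
  let average i :=
    T^-1 * \int[@lebesgue_measure R]_(s in `[0, T]) V (kappa i s, s) in
  lambda alpha @[alpha --> +oo] -->
    \big[Num.min/average ord0]_(i < N.+1) average i.
Proof.
have T0' := ltW T_gt0.
have [r [a [Lam H]]] :=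
  maxima_landscape T_gt0 m_C20 m_periodic m_nondegenerate kappa_C1 kappa_maxima.
have cV : continuous (V \o clamp2 0 T) by exact: cont_clamp2_setT.
have bm x t : 0 <= x <= 1 -> 0 <= t <= T -> xclamp (dx m) (x, t) = dx m (x, t).
  by move=> x01 _; exact: xclampE.
move=> average.
have avgE i : average i = curve_avg T V (kappa i).
  rewrite /average /curve_avg; congr (_ * _); apply: seg_int_ext => s sT.
  by rewrite curve_potE // (ls_k01 H).
set M := \big[Num.min/_]_(i < _) _.
have HM i : M <= curve_avg T V (kappa i) by rewrite -avgE; exact: bigmin_le.
have [i0 Mi0] : exists i, M = curve_avg T V (kappa i).
  by have [i E] := bigmin_attained average; exists i; rewrite -avgE.
apply/cvgrPdist_lt => e e0; have e4 : 0 < e / 4 by rewrite divr_gt0.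
have [A1 HA1] := upper_bound i0 H cV e4 bm.
have [A2 HA2] := lower_bound H cV e4 bm HM.
exists (Num.max 0 (Num.max A1 A2)); split; first exact: num_real.
move=> al; rewrite !gt_max => /and3P[al0 al1 al2] /=.
have [phi [sol pos _]] := lambda_principal al al0.
have [u [ut [ux [uxx ne]]]] := classical_approximation T_gt0 m_C20 m_periodic
  V_continuous V_periodic sol pos e4.
have := HA1 al (ltW al1) _ _ _ _ _ _ ne; rewrite -Mi0.
have := HA2 al (ltW al2) _ _ _ _ _ _ ne.
by rewrite ltr_norml; clear; lra.
Qed.
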